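(* Let $k$ be a positive integer and let $r=(2k+1)(2k+2)$. If $G$ is a $2(6k+2r+1)$-edge-connected bipartite graph such that $|E(G)|$ is divisible by $2k+1$, then $G$ admits a decomposition into $(2k+1)$-paths.
   Context: All graphs are finite and simple. The length of a path is its number of edges; an $\ell$-path is a path of length $\ell$ (with $\ell+1$ distinct vertices). A decomposition of $G$ into $\ell$-paths is a set of pairwise edge-disjoint subgraphs of $G$, each of which is an $\ell$-path, whose edge sets cover $E(G)$. *)

(* Defs.v *)
From mathcomp Require Import all_boot.
Set Implicit Arguments.
Unset Strict Implicit.
Unset Printing Implicit Defensive.

Record sgraph := SGraph {
  vertex :> finType;
  adj : rel vertex;
  adj_sym : symmetric adj;
  adj_irr : irreflexive adj }.

Section Graph.
Variable G : sgraph.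

Definition edges : {set {set G}} := [set [set x; y] | x in G, y in adj x].

Definition bipartite : Prop :=
  exists A : {set G}, forall x y : G, adj x y -> (x \in A) != (y \in A).

Definition del_edges (F : {set {set G}}) : rel G :=
  [rel x y | adj x y && ([set x; y] \notin F)].

(* No lower bound on the number of vertices: graphs with at most one vertex
   are n-edge-connected for every n. *)
Definition edge_connected (n : nat) : Prop :=
  forall F : {set {set G}}, F \subset edges -> #|F| < n ->
  forall x y : G, connect (del_edges F) x y.

(* A pair (vertex set, edge set), such as those representing subgraphs of G. *)
Definition pregraph : Type := ({set G} * {set {set G}})%type.

Definition subgraph (H : pregraph) : Prop :=
  H.2 \subset edges /\ (forall f, f \in H.2 -> f \subset H.1).

(* The edges of the path with consecutive vertices x :: p. *)
Definition path_edges (x : G) (p : seq G) : {set {set G}} :=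
  [set:: pairmap (fun a b => [set a; b]) x p].

Definition is_path (l : nat) (H : pregraph) : Prop :=
  exists (x : G) (p : seq G),
    [/\ uniq (x :: p), size p = l, H.1 = [set:: x :: p] & H.2 = path_edges x p].

Definition path_decomposition (l : nat) (D : {set pregraph}) : Prop :=
  [/\ forall H, H \in D -> subgraph H /\ is_path l H,
      forall H1 H2, H1 \in D -> H2 \in D -> H1 != H2 -> [disjoint H1.2 & H2.2]
    & \bigcup_(H in D) H.2 = edges].

End Graph.

(* Main.v *)
Require Import Defs.
From mathcomp Require Import all_boot all_order all_algebra.
From mathcomp Require Import zify ring.
Set Implicit Arguments.
Unset Strict Implicit.
Unset Printing Implicit Defensive.

(** Write m = 2k+1, let A be one side of the bipartition, and represent an
edge by the pair of its ends, the end in A first.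

The edges are split into two parts: in the first one all degrees at vertices
of A are divisible by m, in the second one all degrees at the other vertices
are.  Each part is then decomposed on its own, with all paths starting on the
side whose degrees are divisible.

Splitting ([oriented_split]).  Tree packing ([nash_williams]) turns the edge
connectivity into 6k+2r+1 disjoint spanning connected sets of edges.  Each
part is given r of them in advance.  The set R of the remaining edges has at
least 3m-2 edges in every cut, and this suffices for orienting R with
out-degrees in prescribed residue classes mod m ([mod_orientation], a theorem
of the kind proved by Lovasz, Thomassen, Wu and Zhang).  An edge of R joins
the first part if it is oriented out of A, and the second part otherwise, so
the residues can be chosen to make the degrees of both parts divisible; the
hypothesis that m divides the number of edges is what makes the prescribed
residues add up to the size of R.

Decomposing a part ([path_list]).  Let mN(a) be the degree of a vertex a of
A.  Start with N(a) paths of length 0 at each a and lengthen all paths by one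
edge, m times.  The edges must then be partitioned into sets U_1, D_1, ...,
U_k, D_k, M such that each of them has degree N(a) at each a, and U_i and D_i
have the same degree at each vertex outside A: in this way every stage has as
many new edges at a vertex as there are paths to be extended there.  A new
edge may lead back to its path, but when there are at least 2k new edges at
each vertex, the new edges can be exchanged between the paths, and paths can
be cut and reconnected, until every extension is a path ([extend_paths]).

The partition.  First M is chosen with degree N(a) at each a and such that
the remaining degrees are even ([even_remainder]); the remainder has an
Eulerian orientation, which separates the edges leaving A from those entering
A ([euler_split]) and which splits into k balanced classes ([arc_classes]).
To get the parities right, M contains one edge of each pair in a pairing of
the edges of a set Z, where Z is connected with even degrees, and small degree
at A ([even_core]), and paired edges share their end in A.  The other ends of
the pairs form the edges of a graph on the complement of A, which is connected
for a suitable pairing ([connected_pairing]); switching the choices along its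
paths corrects the parities outside A without changing the degrees in A.

Tree packing, the low-degree trees inside Z and all selections with prescribed
degrees come from one source, Rado's theorem on independent transversals of
set families ([rado]). *)

(** * Rado's theorem on independent transversals *)

Section Rado.
Variables (E : finType) (rk : {set E} -> nat).
Hypothesis rk_mono : forall X Y : {set E}, X \subset Y -> rk X <= rk Y.
Hypothesis rk_sub : forall X Y : {set E},
  rk (X :|: Y) + rk (X :&: Y) <= rk X + rk Y.
Hypothesis rk_card : forall X, rk X <= #|X|.

(** If deleting x from the set of i violated the rank condition on a family J
of indices, and deleting y violated it on K, then i is in J and K, and by
submodularity the condition would already fail on the union of J and K or on
their intersection without i. *)
Lemma rado_drop (I : finType) (S : I -> {set E}) (i : I) (x y : E) :
  x != y -> (forall J : {set I}, #|J| <= rk (\bigcup_(j in J) S j)) ->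
  let del z := fun j => if j == i then S i :\ z else S j in
  (forall J : {set I}, #|J| <= rk (\bigcup_(j in J) del x j)) \/
  (forall J : {set I}, #|J| <= rk (\bigcup_(j in J) del y j)).
Proof.
move=> xy HS del.
case: (boolP [forall J : {set I}, #|J| <= rk (\bigcup_(j in J) del x j)]).
  by move/forallP; left.
case: (boolP [forall J : {set I}, #|J| <= rk (\bigcup_(j in J) del y j)]).
  by move/forallP; right.
move=> /forallPn[K hK] /forallPn[J hJ]; exfalso.
have sub z (L : {set I}) : \bigcup_(j in L :\ i) S j \subset \bigcup_(j in L) del z j.
  apply/bigcupsP => j; rewrite !inE => /andP[ji jL].
  apply: (bigcup_max j) => //; by rewrite /del (negbTE ji).
have inL z (L : {set I}) : ~~ (#|L| <= rk (\bigcup_(j in L) del z j)) -> i \in L.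
  apply: contraR => iL; have e : L = L :\ i.
    by apply/setP => j; rewrite !inE; case: eqP => // ->; rewrite (negbTE iL).
  by rewrite {1}e (leq_trans (HS _)) // rk_mono // sub.
have iJ := inL _ _ hJ; have iK := inL _ _ hK.
have := rk_sub (\bigcup_(j in J) del x j) (\bigcup_(j in K) del y j).
have h1 : \bigcup_(j in J :|: K) S j \subset
  \bigcup_(j in J) del x j :|: \bigcup_(j in K) del y j.
  apply/bigcupsP => j; case: (eqVneq j i) => [-> _|ji].
    apply/subsetP => e eS; rewrite inE.
    case: (eqVneq e x) => [ex|ex].
      apply/orP; right; apply/bigcupP; exists i => //.
      by rewrite /del eqxx !inE eS ex xy.
    apply/orP; left; apply/bigcupP; exists i => //.
    by rewrite /del eqxx !inE eS ex.
  rewrite inE => /orP[jJ|jK].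
    apply: subset_trans (subsetUl _ _); apply: (bigcup_max j) => //.
    by rewrite /del (negbTE ji).
  apply: subset_trans (subsetUr _ _); apply: (bigcup_max j) => //.
  by rewrite /del (negbTE ji).
have h2 : \bigcup_(j in (J :&: K) :\ i) S j \subset
  \bigcup_(j in J) del x j :&: \bigcup_(j in K) del y j.
  rewrite subsetI; apply/andP; split.
    by apply: subset_trans (sub x J); apply/bigcupsP => j; rewrite !inE =>
      /and3P[ji jJ _]; apply: bigcup_sup; rewrite !inE ji.
  by apply: subset_trans (sub y K); apply/bigcupsP => j; rewrite !inE =>
    /and3P[ji _ jK]; apply: bigcup_sup; rewrite !inE ji.
have := leq_trans (HS _) (rk_mono h1); have := leq_trans (HS _) (rk_mono h2).
have := cardsUI J K; have := cardsD1 i (J :&: K); rewrite inE iJ iK /=.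
lia.
Qed.

(** The sets can be shrunk to singletons by [rado_drop]; then the condition
for all indices together is the conclusion. *)
Lemma rado (I : finType) (S : I -> {set E}) :
  (forall J : {set I}, #|J| <= rk (\bigcup_(i in J) S i)) ->
  exists f : I -> E, (forall i, f i \in S i) /\ #|I| <= rk (f @: [set: I]).
Proof.
have [n] := ubnP (\sum_i #|S i|); elim: n S => // n IHn S ltn HS.
case: (boolP [forall i, #|S i| <= 1]) => [/forallP h1|].
  have h i : {e | S i == [set e]}.
    apply: sigW; have /cards1P[e ->] : #|S i| == 1; last by exists e.
    rewrite eqn_leq h1.
    by have := leq_trans (HS [set i]) (rk_card _); rewrite cards1 big_set1.
  exists (fun i => sval (h i)); split=> [i|].
    by rewrite {2}(eqP (svalP (h i))) inE.
  rewrite -cardsT (leq_trans (HS _)) // rk_mono //; apply/bigcupsP => i _.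
  by rewrite (eqP (svalP (h i))) sub1set; apply/imsetP; exists i; rewrite ?inE.
case/forallPn=> i; rewrite -ltnNge => /card_gt1P[x [y [xS yS xy]]].
have step z : z \in S i ->
    (forall J : {set I}, #|J| <=
       rk (\bigcup_(j in J) (if j == i then S i :\ z else S j))) ->
    exists f : I -> E, (forall i, f i \in S i) /\ #|I| <= rk (f @: [set: I]).
  move=> zS HS'; have [|f [fS rf]] := IHn _ _ HS'.
    rewrite -ltnS; apply: leq_trans ltn; rewrite ltnS.
    rewrite [X in _ < X](bigD1 i) //= (bigD1 i) //= eqxx.
    rewrite [in X in _ < X](cardsD1 z) zS /= -addnA add1n ltnS.
    rewrite leq_add2l; apply: leq_sum => j ji; by rewrite (negbTE ji).
  exists f; split=> // j; have := fS j; case: eqP => // ->.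
  by rewrite inE => /andP[].
by case: (rado_drop i xy HS) => /step; apply.
Qed.

End Rado.

(** Reduces to [rado] by adding d elements, each independent of everything
else, to all sets. *)
Lemma rado_defect (E : finType) (rk : {set E} -> nat) :
  (forall X Y : {set E}, X \subset Y -> rk X <= rk Y) ->
  (forall X Y : {set E}, rk (X :|: Y) + rk (X :&: Y) <= rk X + rk Y) ->
  (forall X, rk X <= #|X|) ->
  forall (I : finType) (S : I -> {set E}) (d : nat),
  (forall J : {set I}, #|J| <= rk (\bigcup_(i in J) S i) + d) ->
  exists (J : {set I}) (f : I -> option E),
    [/\ forall i, i \in J -> exists2 e, f i = Some e & e \in S i
      & #|I| <= rk [set e | Some e \in f @: J] + d].
Proof.
move=> rk_mono rk_sub rk_card I S d HS.
pose rk' (X : {set E + 'I_d}) := rk [set e | inl e \in X] + #|[set j | inr j \in X]|.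
pose S' i : {set E + 'I_d} := [set x | if x is inl e then e \in S i else true].
have [||||f [fS rf]] := @rado _ rk' _ _ _ I S'.
- move=> X Y sXY; apply: leq_add.
    by apply: rk_mono; apply/subsetP => e; rewrite !inE; apply: (subsetP sXY).
  by apply: subset_leq_card; apply/subsetP => e; rewrite !inE; apply: (subsetP sXY).
- move=> X Y; rewrite /rk'.
  have := rk_sub [set e | inl e \in X] [set e | inl e \in Y].
  have := cardsUI [set j | inr j \in X] [set j | inr j \in Y].
  have -> : [set e | inl e \in X :|: Y] =
     [set e | inl e \in X] :|: [set e | inl e \in Y] by apply/setP=> e; rewrite !inE.
  have -> : [set e | inl e \in X :&: Y] =
     [set e | inl e \in X] :&: [set e | inl e \in Y] by apply/setP=> e; rewrite !inE.
  have -> : [set j | inr j \in X :|: Y] =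
     [set j | inr j \in X] :|: [set j | inr j \in Y] by apply/setP=> e; rewrite !inE.
  have -> : [set j | inr j \in X :&: Y] =
     [set j | inr j \in X] :&: [set j | inr j \in Y] by apply/setP=> e; rewrite !inE.
  lia.
- move=> X; apply: leq_trans (_ : #|[set e | inl e \in X]| + #|[set j | inr j \in X]| <= _).
    by rewrite leq_add2r.
  rewrite -(card_imset _ (@inl_inj E 'I_d)) -(card_imset [set j | inr j \in X] (@inr_inj E 'I_d)).
  rewrite -cardsUI; have -> : (inl @: [set e | inl e \in X]) :&: (inr @: [set j | inr j \in X]) = set0.
    apply/setP=> x; rewrite !inE; apply/negP => /andP[/imsetP[e _ ->] /imsetP[] //].
  rewrite cards0 addn0; apply: subset_leq_card; apply/subsetP => x.
  by rewrite inE => /orP[] /imsetP[y]; rewrite inE => h ->.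
- move=> J; case: (set_0Vmem J) => [->|[i0 i0J]]; first by rewrite cards0.
  apply: leq_trans (HS J) _; apply: leq_add.
    apply: rk_mono; apply/subsetP => e /bigcupP[i iJ eS]; rewrite inE.
    by apply/bigcupP; exists i; rewrite ?inE.
  have -> : [set j | inr j \in \bigcup_(i in J) S' i] = setT.
    by apply/setP=> j; rewrite !inE; apply/bigcupP; exists i0; rewrite ?inE.
  by rewrite cardsT card_ord.
exists [set i | if f i is inl _ then true else false].
exists (fun i => if f i is inl e then Some e else None); split.
  move=> i; rewrite inE; have := fS i; rewrite inE; case: (f i) => // e eS _.
  by exists e.
apply: leq_trans rf _; rewrite /rk' leq_add //.
  apply: rk_mono; apply/subsetP => e; rewrite !inE => /imsetP[i _ fi].
  by apply/imsetP; exists i; rewrite ?inE -?fi.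
by rewrite -[X in _ <= X]card_ord; apply: max_card.
Qed.

(** * Selections with prescribed degrees *)

Lemma card_fibers (E R : finType) (r : E -> R) (X : {set E}) :
  \sum_y #|[set e in X | r e == y]| = #|X|.
Proof.
rewrite -sum1_card (partition_big r xpredT) //=; apply: eq_bigr => y _.
by rewrite -sum1_card; apply: eq_bigl => e; rewrite inE.
Qed.

Lemma card_fibers_in (E R : finType) (r : E -> R) (X : {set E}) (K : {set R}) :
  \sum_(y in K) #|[set e in X | r e == y]| = #|[set e in X | r e \in K]|.
Proof.
rewrite -[in RHS](card_fibers r) [RHS](bigID (mem K)) /= [X in _ = _ + X]big1.
  rewrite addn0; apply: eq_bigr => y yK; apply: eq_card => e; rewrite !inE.
  by case: eqP => [->|_]; rewrite ?yK ?andbT ?andbF.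
move=> y yK; apply: eq_card0 => e; rewrite !inE.
by case: eqP => [->|_]; rewrite ?(negbTE yK) ?andbF.
Qed.

Lemma card_tag_fiber (L : finType) (n : L -> nat) (x : L) :
  #|[set s : {x : L & 'I_(n x)} | tag s == x]| = n x.
Proof.
have inj : injective (fun j : 'I_(n x) => Tagged (fun x => 'I_(n x)) j).
  by move=> i j /eqP; rewrite eq_Tagged => /eqP.
rewrite -[RHS]card_ord -[RHS](card_imset _ inj); apply: eq_card => -[y j].
rewrite inE /=; apply/eqP/imsetP => [yx|[i _ /(congr1 tag)] //].
by case: x / yx inj => _; exists j.
Qed.

(** Taking every element of F with weight 1/D meets both requirements.  An
integral solution comes from [rado] for the matroid in which a set is
independent if it has at most [cap y] elements over each y; each x needs
[n x] transversal elements. *)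
Lemma fair_selection (E L R : finType) (F : {set E}) (l : E -> L) (r : E -> R)
    (D : nat) (n : L -> nat) (cap : R -> nat) :
  0 < D ->
  (forall x, D * n x <= #|[set e in F | l e == x]|) ->
  (forall y, #|[set e in F | r e == y]| <= D * cap y) ->
  exists M : {set E}, [/\ M \subset F,
    forall x, #|[set e in M | l e == x]| = n x &
    forall y, #|[set e in M | r e == y]| <= cap y].
Proof.
move=> D0 hn hcap.
pose fib (X : {set E}) (y : R) : {set E} := [set e in X | r e == y].
pose rk (X : {set E}) := \sum_y minn (cap y) #|fib X y|.
have fibS (X Y : {set E}) (y : R) : X \subset Y -> fib X y \subset fib Y y.
  by move=> /subsetP sXY; apply/subsetP => e; rewrite !inE => /andP[/sXY -> ->].
pose I : finType := {x : L & 'I_(n x)}.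
pose S (s : I) := [set e in F | l e == tag s].
have rk_card (X : {set E}) : rk X <= #|X|.
  by rewrite -(card_fibers r X); apply: leq_sum => y _; rewrite geq_minr.
have [||//||f [fS rf]] := @rado E rk _ _ _ I S.
- move=> X Y sXY; apply: leq_sum => y _.
  by rewrite leq_min geq_minl (leq_trans (geq_minr _ _)) // subset_leq_card // fibS.
- move=> X Y; rewrite /rk -!big_split; apply: leq_sum => y _ /=.
  have := cardsUI (fib X y) (fib Y y).
  have -> : fib X y :|: fib Y y = fib (X :|: Y) y.
    by apply/setP => e; rewrite !inE -andb_orl.
  have -> : fib X y :&: fib Y y = fib (X :&: Y) y.
    by apply/setP => e; rewrite !inE; case: (r e == y); rewrite ?andbT ?andbF.
  have := subset_leq_card (fibS _ _ y (subsetIl X Y)).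
  have := subset_leq_card (fibS _ _ y (subsetIr X Y)).
  lia.
- move=> J; pose K := [set tag s | s in J]; pose X := \bigcup_(i in J) S i.
  have XE : X = [set e in F | l e \in K].
    apply/setP => e; rewrite inE; apply/bigcupP/andP.
      by case=> s sJ; rewrite inE => /andP[-> /eqP ->]; split=> //; apply: imset_f.
    by case=> eF /imsetP[s sJ ls]; exists s => //; rewrite inE eF ls eqxx.
  rewrite -/X -(leq_pmul2l D0); apply: (@leq_trans #|X|).
    rewrite XE -card_fibers_in; apply: (@leq_trans (\sum_(x in K) D * n x)).
      rewrite -big_distrr leq_pmul2l //=.
      rewrite (eq_bigr (fun x => #|[set s in [set: I] | tag s == x]|)); last first.
        by move=> x _; rewrite -(card_tag_fiber n x); apply: eq_card => s; rewrite !inE.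
      rewrite card_fibers_in; apply/subset_leq_card/subsetP => s sJ.
      by rewrite !inE imset_f.
    by apply: leq_sum.
  rewrite -(card_fibers r) /rk big_distrr; apply: leq_sum => y _ /=.
  rewrite minnMr leq_min leq_pmull // andbT; apply: leq_trans (hcap y).
  apply/subset_leq_card/fibS; rewrite XE; apply/subsetP => e; rewrite inE; by case/andP.
have cM : #|f @: [set: I]| <= #|I| by rewrite -cardsT leq_imset_card.
have cM' : #|f @: [set: I]| = #|I|.
  by apply/eqP; rewrite eqn_leq cM (leq_trans rf) ?rk_card.
have finj : injective f.
  have /imset_injP h : #|f @: [set: I]| == #|[set: I]| by rewrite cardsT cM'.
  by move=> s1 s2; apply: h; rewrite inE.
exists (f @: [set: I]); split.
- by apply/subsetP => e /imsetP[s _ ->]; have := fS s; rewrite inE; case/andP.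
- move=> x; rewrite -[RHS](card_tag_fiber n x) -(card_imset _ finj).
  apply: eq_card => e; rewrite inE; apply/andP/imsetP.
    case=> /imsetP[s _ ->] /eqP lx; exists s => //; rewrite inE.
    by have := fS s; rewrite inE lx eq_sym; case/andP.
  case=> s; rewrite inE => /eqP sx ->; split; first by rewrite imset_f.
  by have := fS s; rewrite inE sx; case/andP.
move=> y; have := rf; rewrite -cM' -(card_fibers r) /rk.
rewrite (bigD1 y) //= [X in _ <= X](bigD1 y) //= leqNgt.
apply: contraNT; rewrite -ltnNge => lty.
rewrite -addSn leq_add //; first by rewrite gtn_min lty.
by apply: leq_sum => z _; rewrite geq_minr.
Qed.

(** * The rank function of a graph *)

Definition erel (V : finType) (X : {set V * V}) : rel V :=
  [rel x y | ((x, y) \in X) || ((y, x) \in X)].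

Definition spanning (V : finType) (X : {set V * V}) : Prop :=
  forall x y, connect (erel X) x y.

Section GraphicRank.
Variable V : finType.
Local Notation U := {ffun V -> rat^o}.
Local Open Scope ring_scope.
Import GRing.Theory.
Implicit Types (X Y : {set V * V}) (x y : V).

Definition point_vec (x : V) : U := [ffun v => (v == x)%:R].
Definition edge_vec (e : V * V) : U := point_vec e.1 - point_vec e.2.
Definition edge_span (X : {set V * V}) : {vspace U} := <<[seq edge_vec e | e <- enum X]>>%VS.
(** The rank of the graphic matroid, as the dimension of the span of the
vectors x - y over all edges xy: submodularity is then that of dimension. *)
Definition grank (X : {set V * V}) : nat := \dim (edge_span X).

Lemma edge_span_mem X e : e \in X -> edge_vec e \in edge_span X.
Proof. by move=> eX; rewrite memv_span // map_f // mem_enum. Qed.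

Lemma edge_span_subP X (W : {vspace U}) :
  (forall e, e \in X -> edge_vec e \in W) -> (edge_span X <= W)%VS.
Proof.
by move=> h; apply/span_subvP => _ /mapP[e eX ->]; apply: h; rewrite -mem_enum.
Qed.

Lemma edge_spanS (X Y : {set V * V}) : X \subset Y -> (edge_span X <= edge_span Y)%VS.
Proof. by move/subsetP=> h; apply: edge_span_subP => e /h; apply: edge_span_mem. Qed.

Lemma grank_mono (X Y : {set V * V}) : X \subset Y -> (grank X <= grank Y)%N.
Proof. by move=> /edge_spanS/dimvS. Qed.

Lemma grank_submod (X Y : {set V * V}) :
  (grank (X :|: Y) + grank (X :&: Y) <= grank X + grank Y)%N.
Proof.
rewrite /grank -[X in (_ <= X)%N]dimv_sum_cap; apply: leq_add; apply: dimvS.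
  apply: edge_span_subP => e; rewrite inE => /orP[] /edge_span_mem h.
    by rewrite (subvP (addvSl _ _)).
  by rewrite (subvP (addvSr _ _)).
by rewrite subv_cap !edge_spanS // ?subsetIl ?subsetIr.
Qed.

Lemma grank_card X : (grank X <= #|X|)%N.
Proof. by rewrite (leq_trans (dim_span _)) // size_map -cardE. Qed.

Lemma dim_ffun_rat : \dim {:U} = #|V|.
Proof. by rewrite dimvf /dim /= muln1. Qed.

(** A vertex set without outgoing edges defines a linear form that vanishes on
the edge vectors. *)
Lemma edge_span_sum0 X (C : {set V}) u :
  (forall e, e \in X -> (e.1 \in C) = (e.2 \in C)) ->
  u \in edge_span X -> \sum_(v in C) u v = 0.
Proof.
move=> hC uX.
rewrite (coord_span (X := in_tuple _) uX) /=.
under eq_bigr => v _ do rewrite sum_ffunE.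
rewrite exchange_big big1 //= => i _.
have /mapP[e] : [seq edge_vec e | e <- enum X]`_i \in [seq edge_vec e | e <- enum X] by rewrite mem_nth.
rewrite mem_enum => /hC eC ->; under eq_bigr => v _ do rewrite ffunE.
rewrite -scaler_sumr.
under eq_bigr => v _ do rewrite !ffunE.
have ptC x : \sum_(v in C) (v == x)%:R = (x \in C)%:R :> rat.
  case: (boolP (x \in C)) => xC.
    by rewrite (bigD1 x) //= eqxx big1 ?addr0 // => v /andP[_ /negbTE ->].
  by rewrite big1 // => v vC; case: eqP => // vx; rewrite vx (negbTE xC) in vC.
by rewrite sumrB !ptC eC subrr scaler0.
Qed.

Lemma connect_edge_span X x y : connect (erel X) x y -> point_vec x - point_vec y \in edge_span X.
Proof.
case/connectP=> p; elim: p x => [|z p IHp] x /= => [_ ->|].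
  by rewrite subrr mem0v.
case/andP=> xz pz /(IHp _ pz) h.
rewrite -(subrK (point_vec z) (point_vec x)) -addrA memvD // .
by case/orP: xz => /edge_span_mem // ; rewrite -memvN opprB.
Qed.

Lemma connect_erel_sym X : connect_sym (@erel V X).
Proof. by apply: sym_connect_sym => x y; rewrite /erel /= orbC. Qed.

(** Otherwise the component of x separates x from y, and the linear form of
[edge_span_sum0] takes the value 1 on x - y. *)
Lemma edge_span_connect X x y : point_vec x - point_vec y \in edge_span X -> connect (erel X) x y.
Proof.
move=> h; have := edge_span_sum0 (C := [set z | connect (erel X) x z]) _ h.
set H := (X in (X -> _) -> _); have hH : H.
  move=> e eX; rewrite !inE; apply: same_connect_r; first exact: connect_erel_sym.
  by apply: connect1; rewrite /erel /= -surjective_pairing eX.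
move/(_ hH) => {hH H}; apply: contra_eqT => nxy.
have -> : \sum_(v in [set z | connect (erel X) x z]) (point_vec x - point_vec y) v = 1.
  rewrite (bigD1 x) ?inE ?connect0 //= big1 ?addr0.
    rewrite !ffunE eqxx; case: eqP => [xy|]; last by rewrite subr0.
    by rewrite xy connect0 in nxy.
  move=> v; rewrite inE => /andP[xv vx]; rewrite !ffunE (negbTE vx).
  by case: eqP => [vy|]; [rewrite -vy xv in nxy | rewrite subr0].
by rewrite oner_neq0.
Qed.

Lemma point_notin_span X x : point_vec x \notin edge_span X.
Proof.
apply/negP => /(edge_span_sum0 (C := setT)).
rewrite (bigD1 x) //= big1 => [|v /andP[_ vx]]; last by rewrite ffunE (negbTE vx).
rewrite ffunE eqxx addr0 => /(_ _)/eqP; rewrite oner_eq0 => h.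
by have: false by apply: h => e; rewrite !inE.
Qed.

Lemma grank_lt X : (0 < #|V|)%N -> (grank X < #|V|)%N.
Proof.
case/card_gt0P=> x _; rewrite -dim_ffun_rat /grank (ltn_leqif (dimv_leqif_sup (subvf _))).
by apply/negP => /subvP /(_ (point_vec x) (memvf _)); apply/negP/point_notin_span.
Qed.

Lemma points_full (W : {vspace U}) : (forall v, point_vec v \in W) -> W = {:U}%VS.
Proof.
move=> h; apply/eqP; rewrite eqEsubv subvf /=; apply/subvP => u _.
have -> : u = \sum_v u v *: point_vec v.
  apply/ffunP => v; rewrite sum_ffunE (bigD1 v) //= big1.
    by rewrite !ffunE eqxx addr0 /GRing.scale /= mulr1.
  by move=> w wv; rewrite !ffunE eq_sym (negbTE wv) /GRing.scale /= mulr0.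
by apply: memv_suml => v _; rewrite memvZ.
Qed.

(** With rank |V| - 1 the edge vectors and x span everything, so y is a
multiple of x plus a combination of edge vectors; the sum of the coordinates
shows that the multiple is x itself. *)
Lemma grank_spanning X : (#|V|.-1 <= grank X)%N -> spanning X.
Proof.
move=> h x y; apply: edge_span_connect; set W := (edge_span X + <[point_vec x]>)%VS.
have WT : W = {:U}%VS.
  apply/eqP; rewrite -(geq_leqif (dimv_leqif_eq (subvf _))) dim_ffun_rat.
  have V0 : (0 < #|V|)%N by apply/card_gt0P; exists x.
  rewrite -(prednK V0) (leq_ltn_trans h) // /grank.
  rewrite (ltn_leqif (dimv_leqif_sup (addvSl _ _))) subv_add subvv /= -memvE.
  exact: point_notin_span.
have /memv_addP[u uX [w /vlineP[c ->] yE]] : point_vec y \in W by rewrite WT memvf.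
have ptT z : \sum_(v in [set: V]) point_vec z v = 1.
  rewrite (bigD1 z) //= big1 => [|v /andP[_ vx]]; last by rewrite ffunE (negbTE vx).
  by rewrite ffunE eqxx addr0.
have : \sum_(v in [set: V]) (point_vec y) v = \sum_(v in [set: V]) u v + c * \sum_(v in [set: V]) point_vec x v.
  by rewrite yE big_distrr -big_split /=; apply: eq_bigr => v _; rewrite !ffunE.
rewrite !ptT (edge_span_sum0 _ uX) => [|e]; last by rewrite !inE.
rewrite add0r mulr1 => c1; rewrite yE -c1 scale1r opprD addrC -addrA addNr addr0.
by rewrite memvN.
Qed.

(** The edge vectors and one vertex of each component span everything. *)
Lemma grank_roots X : (#|V| <= grank X + #|[set x | roots (erel X) x]|)%N.
Proof.
set Rt := [set x | _]; rewrite -dim_ffun_rat.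
have <- : (edge_span X + <<[seq point_vec x | x <- enum Rt]>>)%VS = {:U}%VS.
  apply: points_full => v; rewrite -(subrK (point_vec (fingraph.root (erel X) v)) (point_vec v)) memv_add //.
    by apply/connect_edge_span/connect_root.
  by rewrite memv_span // map_f // mem_enum inE roots_root //; exact: connect_erel_sym.
apply: leq_trans (dimv_add_leqif _ _) _; rewrite leq_add2l.
by rewrite (leq_trans (dim_span _)) // size_map -cardE.
Qed.

Lemma spanning_grank X : spanning X -> (#|V|.-1 <= grank X)%N.
Proof.
move=> hX; have := grank_roots X; have: (#|[set x | roots (erel X) x]| <= 1)%N.
  apply/card_le1P => x; rewrite inE => xr y; rewrite !inE.
  apply/idP/eqP => [yr|->//]; have := hX x y; rewrite -(root_connect (connect_erel_sym X)).
  by rewrite (eqP xr) (eqP yr) => /eqP.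
by lia.
Qed.

Lemma grank_diff X Y : (grank X <= grank Y + #|X :\: Y|)%N.
Proof.
have := grank_submod (X :&: Y) (X :\: Y); rewrite setID => h.
have := grank_card (X :\: Y); have := grank_mono (subsetIr X Y); lia.
Qed.

End GraphicRank.

(** * Packing spanning sets, and spanning sets of low degree *)

Section Trees.
Variable V : finType.
Implicit Types (X J : {set V * V}).

Definition cut X (C : {set V}) := [set e in X | (e.1 \in C) != (e.2 \in C)].

(** Every component of J is left by at least 2t edges of X, none of them in J,
and an edge leaves at most two components. *)
Lemma cut_roots X J (t : nat) :
  (forall C : {set V}, C != set0 -> C != setT -> 2 * t <= #|cut X C|) ->
  t * (#|[set x | roots (erel J) x]|.-1) <= #|X :\: J|.
Proof.
move=> hcut; set Rt := [set x | _]; pose rt := fingraph.root (erel J).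
case: (leqP #|Rt| 1) => [h|R1]; first by rewrite (_ : _.-1 = 0) ?muln0 //; lia.
rewrite -(leq_pmul2l (isT : 0 < 2)) mulnA.
apply: (@leq_trans (2 * t * #|Rt|)); first by rewrite leq_mul2l leq_pred orbT.
pose Y := X :\: J; rewrite -/Y.
have rtC e : e \in J -> rt e.1 = rt e.2.
  move=> eJ; apply/eqP; rewrite root_connect; last exact: connect_erel_sym.
  by apply: connect1; rewrite /erel /= -surjective_pairing eJ.
apply: (@leq_trans (\sum_(z in Rt) (#|[set e in Y | rt e.1 == z]| +
                                   #|[set e in Y | rt e.2 == z]|))).
  rewrite mulnC -sum_nat_const; apply: leq_sum => z zR.
  pose C := [set x | rt x == z].
  have zz : rt z = z by move: zR; rewrite inE => /eqP.
  have C0 : C != set0 by apply/set0Pn; exists z; rewrite inE zz.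
  have CT : C != setT.
    apply: contraTneq R1 => CT; rewrite -leqNgt; apply/card_le1_eqP => u v.
    rewrite !inE => /eqP ur /eqP vr.
    have : u \in C by rewrite CT inE. have : v \in C by rewrite CT inE.
    by rewrite !inE /rt ur vr => /eqP -> /eqP ->.
  apply: leq_trans (hcut _ C0 CT) _; rewrite -cardsUI.
  apply: leq_trans (leq_addr _ _); apply/subset_leq_card/subsetP => e.
  rewrite !inE => /andP[eX]; case: (boolP (e \in J)) => [/rtC -> /eqP//|_ /=].
  by rewrite eX; do 2 case: (_ == z).
rewrite big_split /= mul2n -addnn leq_add //.
  rewrite (card_fibers_in (fun e : V * V => rt e.1)) subset_leq_card //.
  by apply/subsetP => e; rewrite inE => /andP[].
rewrite (card_fibers_in (fun e : V * V => rt e.2)) subset_leq_card //.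
by apply/subsetP => e; rewrite inE => /andP[].
Qed.

(** Rado's theorem with a slot for each edge of E0, which may be put into any
of t layers; the rank of a set is the sum of the ranks of its layers, and the
defect is the number of edges left over.  The rank condition for a set J of
edges is [cut_roots]. *)
Lemma nash_williams (E0 : {set V * V}) (t : nat) : 0 < #|V| ->
  (forall C : {set V}, C != set0 -> C != setT -> 2 * t <= #|cut E0 C|) ->
  exists X : 'I_t -> {set V * V},
    [/\ forall i, X i \subset E0, forall i, spanning (X i) &
        forall i j, i != j -> [disjoint X i & X j]].
Proof.
move=> V0 hcut; pose n := #|V|.
pose layer (Y : {set (V * V) * 'I_t}) i := [set e | (e, i) \in Y].
pose rk (Y : {set (V * V) * 'I_t}) := \sum_i grank (layer Y i).
pose I : finType := {e : V * V | e \in E0}.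
pose S (e : I) : {set (V * V) * 'I_t} := [set x | x.1 == val e].
(* what the rank condition for J amounts to, without subtractions *)
have hJ J : J \subset E0 -> t * n + #|J| <= t * grank J + t + #|E0|.
  move=> JE; have h1 := @cut_roots _ J _ hcut; have h2 := grank_roots J.
  have h3 := cardsID J E0; rewrite (setIidPr JE) in h3.
  rewrite -/n in h2; set c := #|[set x | _]| in h1 h2.
  have : t * n <= t * (grank J + c) by rewrite leq_mul2l h2 orbT.
  have : t * c <= t * c.-1 + t by rewrite -mulnSr leq_mul2l leqSpred orbT.
  rewrite mulnDr; lia.
have [||||J [f [fS rf]]] := @rado_defect _ rk _ _ _ I S (#|E0| - t * n.-1).
- move=> X Y sXY; apply: leq_sum => i _; apply: grank_mono.
  by apply/subsetP => e; rewrite !inE; apply: (subsetP sXY).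
- move=> X Y; rewrite /rk -!big_split; apply: leq_sum => i _ /=.
  apply: leq_trans (grank_submod _ _); apply: leq_add; apply: grank_mono;
  by apply/subsetP => e; rewrite !inE.
- move=> Y; rewrite -(card_fibers (@snd _ _)); apply: leq_sum => i _.
  apply: leq_trans (grank_card _) _.
  rewrite -(card_imset _ (_ : injective (fun e : V * V => (e, i)))); last by move=> e1 e2 [].
  apply/subset_leq_card/subsetP => e' /imsetP[e]; rewrite !inE => h -> /=.
  by rewrite h eqxx.
- move=> J; pose J' := [set val e | e in J].
  have J'E : J' \subset E0 by apply/subsetP => _ /imsetP[e _ ->]; apply: (valP e).
  have -> : rk (\bigcup_(i in J) S i) = t * grank J'.
    rewrite /rk -[in RHS](card_ord t) -sum_nat_const; apply: eq_bigr => i _.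
    congr grank; apply/setP => e; rewrite inE.
    apply/bigcupP/imsetP => [[e' e'J]|[e' e'J ->]]; last by exists e'; rewrite ?inE.
    by rewrite inE => /eqP /= ->; exists e'.
  have tn : t * n = t * n.-1 + t by rewrite -mulnSr prednK.
  have arith a c d e g : c = d + t -> c + a <= g + t + e -> a <= g + (e - d) by lia.
  have cJ : #|J'| = #|J| by rewrite /J' card_imset //; exact: val_inj.
  by apply: arith tn _; rewrite -cJ; exact: hJ.
pose Y := [set e | Some e \in f @: J].
exists (layer Y).
have fval e i : (e, i) \in Y -> exists2 s, val s = e & f s = Some (e, i).
  rewrite inE => /imsetP[s sJ fs]; exists s => //.
  by have [e' ] := fS _ sJ; rewrite -fs => -[<-]; rewrite inE /= eq_sym => /eqP.
have fval' i e : e \in layer Y i -> e \in E0.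
  by rewrite inE => /fval[s <- _]; apply: valP.
split.
- by move=> i; apply/subsetP=> e; apply: fval'.
- move=> i; apply: grank_spanning; move: rf.
  rewrite -/Y card_sig -[#|_|]/(#|[pred e | e \in E0]|) /=.
  have -> : #|[pred e | e \in E0]| = #|E0| by apply: eq_card.
  have h0 := hJ _ (sub0set E0); have g0 : grank (set0 : {set V*V}) = 0.
    by apply/eqP; rewrite -leqn0 (leq_trans (grank_card _)) ?cards0.
  rewrite g0 muln0 cards0 add0n addn0 in h0.
  have tn : t * n = t * n.-1 + t by rewrite -mulnSr prednK.
  have gle j : grank (layer Y j) <= n.-1 by rewrite -ltnS prednK // grank_lt.
  move=> h; have {h} : t * n.-1 <= rk Y by lia.
  rewrite leqNgt => h; rewrite leqNgt; apply: contra h => lt.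
  rewrite /rk (bigD1 i) //=.
  have -> : t * n.-1 = n.-1 + (\sum_(j | j != i) n.-1).
    by rewrite -[in LHS](card_ord t) -sum_nat_const (bigD1 i).
  by rewrite -addSn leq_add //; apply: leq_sum => j _.
- move=> i j ij; rewrite -setI_eq0; apply/eqP/setP => e; rewrite in_setI in_set0.
  apply/negP => /andP[]; rewrite !in_set -/Y => h1 h2.
  have /fval[s se fs] : (e, i) \in Y by rewrite inE.
  have /fval[s' s'e fs'] : (e, j) \in Y by rewrite inE.
  have ss : s = s' by apply: val_inj; rewrite se s'e.
  by move: fs'; rewrite -ss fs => -[ji]; rewrite ji eqxx in ij.
Qed.

(** Rado's theorem with [h a] slots at each a in A, to be filled with edges at
a.  If only the slots at the vertices of K are considered, each of the x given
sets keeps rank at least |V| - 1 minus the number of its edges at the other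
vertices; averaging over the x sets gives the rank condition. *)
Lemma low_degree_spanning (A : {set V}) (x : nat) (T : 'I_x -> {set V * V})
    (h : V -> nat) : 0 < x ->
  (forall i e, e \in T i -> e.1 \in A) ->
  (forall i, spanning (T i)) ->
  (forall i j, i != j -> [disjoint T i & T j]) ->
  let P := \bigcup_i T i in
  (forall a, a \in A -> #|[set e in P | e.1 == a]| <= x * h a) ->
  exists T' : {set V * V}, [/\ T' \subset P, spanning T' &
    forall a, a \in A -> #|[set e in T' | e.1 == a]| <= h a].
Proof.
move=> x0 TA Tsp Tdis P hP; pose n := #|V|.
pose h' a := if a \in A then h a else 0.
pose XK (K : {set V}) := [set e in P | e.1 \in K].
have key K : n.-1 <= grank (XK K) + \sum_(a in ~: K) h' a.
  rewrite -(leq_pmul2l x0).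
  apply: (@leq_trans (\sum_i (grank (XK K) + #|T i :\: XK K|))).
    rewrite -[x in x * n.-1](card_ord x) -sum_nat_const; apply: leq_sum => i _.
    exact: leq_trans (spanning_grank (Tsp i)) (grank_diff _ _).
  rewrite big_split /= sum_nat_const card_ord mulnDr leq_add2l.
  have -> : \sum_i #|T i :\: XK K| = #|P :\: XK K|.
    have -> : P :\: XK K = \bigcup_i (T i :\: XK K).
      by apply/setP => e; rewrite inE /P; apply/andP/bigcupP => [[h1 /bigcupP[i _ h2]]|[i _]];
        [exists i; rewrite // inE h1 | rewrite inE => /andP[-> eT]; split=> //;
         apply/bigcupP; exists i].
    rewrite -[RHS]sum1_card partition_disjoint_bigcup.
      by apply: eq_bigr => i _; rewrite sum1_card.
    by move=> i j /Tdis; apply: disjointW; apply/subsetP => e; rewrite inE => /andP[].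
  rewrite big_distrr /=.
  apply: (@leq_trans (\sum_(a in ~: K) #|[set e in P | e.1 == a]|)).
    rewrite card_fibers_in; apply/subset_leq_card/subsetP => e.
    by rewrite !inE => /andP[h1 eP]; move: h1; rewrite eP /= => ->.
  apply: leq_sum => a _; rewrite /h'; case: ifP => [|/negbT aA]; first exact: hP.
  rewrite muln0 leqn0 cards_eq0; apply/eqP/setP => e; rewrite !inE; apply/negP.
  by case/andP => /bigcupP[i _ /TA] + /eqP ea; rewrite ea (negbTE aA).
pose I : finType := {a : V & 'I_(h' a)}.
pose S (s : I) := [set e in P | e.1 == tag s].
have cI : #|I| = \sum_a h' a.
  rewrite -cardsT -(card_fibers (@tag V (fun a => 'I_(h' a)))); apply: eq_bigr => a _.
  by rewrite -[RHS](card_tag_fiber h' a); apply: eq_card => s; rewrite !inE.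
have [||||J [f [fS rf]]] := @rado_defect _ (@grank V) _ _ _ I S (#|I| - n.-1).
- exact: grank_mono.
- exact: grank_submod.
- exact: grank_card.
- move=> J; pose K := [set tag s | s in J].
  have -> : \bigcup_(s in J) S s = XK K.
    apply/setP => e; rewrite inE; apply/bigcupP/andP.
      by case=> s sJ; rewrite inE => /andP[-> /eqP ->]; split=> //; apply: imset_f.
    by case=> eF /imsetP[s sJ ls]; exists s => //; rewrite inE eF ls eqxx.
  have h1 := key K; have h2 := key set0.
  have h3 : grank (XK set0) = 0.
    apply/eqP; rewrite -leqn0 (leq_trans (grank_card _)) // leqn0 cards_eq0.
    by apply/eqP/setP => e; rewrite !inE andbF.
  rewrite h3 add0n in h2.
  have h4 : #|I| = \sum_(a in K) h' a + \sum_(a in ~: K) h' a.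
    rewrite cI (bigID (mem K)) /=; congr (_ + _); apply: eq_bigl => a; by rewrite inE.
  have h5 : #|J| <= \sum_(a in K) h' a.
    rewrite (eq_bigr (fun a => #|[set s in [set: I] | tag s == a]|)); last first.
      by move=> a _; rewrite -(card_tag_fiber h' a); apply: eq_card => s; rewrite !inE.
    rewrite card_fibers_in; apply/subset_leq_card/subsetP => s sJ.
    by rewrite !inE imset_f.
  have h6 : \sum_(a in ~: set0) h' a = #|I|.
    by rewrite cI; apply: eq_bigl => a; rewrite !inE.
  rewrite h6 in h2; lia.
have fval e : Some e \in f @: J -> exists2 s, f s = Some e & e \in P /\ e.1 = tag s.
  case/imsetP=> s sJ fs; exists s => //.
  by have [e'] := fS _ sJ; rewrite -fs => -[<-]; rewrite inE => /andP[-> /eqP].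
exists [set e | Some e \in f @: J]; split.
- by apply/subsetP => e; rewrite inE => /fval[s _ []].
- apply: grank_spanning; have := key set0.
  have h6 : \sum_(a in ~: set0) h' a = #|I|.
    by rewrite cI; apply: eq_bigl => a; rewrite !inE.
  have h3 : grank (XK set0) = 0.
    apply/eqP; rewrite -leqn0 (leq_trans (grank_card _)) // leqn0 cards_eq0.
    by apply/eqP/setP => e; rewrite !inE andbF.
  rewrite h6 h3 add0n -/n; move: rf; lia.
move=> a aA; have <- : h' a = h a by rewrite /h' aA.
rewrite -[in X in _ <= X](card_tag_fiber h' a) -(card_imset _ (@Some_inj _)).
apply: leq_trans (leq_imset_card f _); apply/subset_leq_card/subsetP => y /imsetP[e].
rewrite !inE => /andP[/fval[s fs [_ es]] /eqP ea] ->.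
by rewrite -fs imset_f // inE -es ea.
Qed.
End Trees.

(** * Distance to the multiples of 2m *)

Section Nrm.
Import GRing.Theory Num.Theory Order.TTheory.
Local Open Scope ring_scope.
Variable m : int.
Hypothesis m2 : 2 <= m.

Definition cong (x y : int) := (2 * m %| x - y)%Z.

(** The distance from x to the nearest multiple of 2m. *)
Definition mdist (x : int) : int :=
  let r := (x %% (2 * m))%Z in if r <= m then r else 2 * m - r.

Lemma congP x y : reflect (exists q, x = y + q * (2 * m)) (cong x y).
Proof.
apply: (iffP dvdzP) => -[q e]; exists q.
  by rewrite -e addrC subrK.
by rewrite e addrC addKr.
Qed.

Lemma cong_refl x : cong x x. Proof. by rewrite /cong subrr dvdz0. Qed.
Lemma cong_sym x y : cong x y -> cong y x.
Proof. by rewrite /cong -opprB rpredN. Qed.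
Lemma cong_trans y x z : cong x y -> cong y z -> cong x z.
Proof. by move=> h1 h2; rewrite /cong -(subrK y x) -addrA rpredD. Qed.
Lemma congD x y z t : cong x y -> cong z t -> cong (x + z) (y + t).
Proof. by move=> h1 h2; rewrite /cong opprD addrACA rpredD. Qed.
Lemma congN x y : cong x y -> cong (- x) (- y).
Proof. by rewrite /cong -opprD rpredN. Qed.
Lemma congB x y z t : cong x y -> cong z t -> cong (x - z) (y - t).
Proof. by move=> h1 /congN; apply: congD. Qed.

Lemma mdist_uniq x n q : 0 <= n <= m -> x = q * (2 * m) + n \/ x = q * (2 * m) - n ->
  mdist x = n.
Proof.
move=> hn; rewrite /mdist; have M0 : `|2 * m| = 2 * m by lia.
case=> ->; rewrite modzMDl.
  rewrite modz_small ?M0; last lia.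
  by case: ifP; lia.
case: (eqVneq n 0) => [->|n0]; first by rewrite oppr0 mod0z; case: ifP; lia.
rewrite -(modzMDl 1) modz_small ?M0; last lia.
by case: ifP; lia.
Qed.

Lemma mdist_ex x : exists q, 0 <= mdist x <= m /\
  (x = q * (2 * m) + mdist x \/ x = q * (2 * m) - mdist x).
Proof.
have M0 : 2 * m != 0 by lia.
have r0 := modz_ge0 x M0; have r1 := ltz_mod x M0.
have e := divz_eq x (2 * m); rewrite /mdist; case: ifP => h.
  by exists (x %/ (2 * m))%Z; split; [lia | left].
exists ((x %/ (2 * m))%Z + 1); split; first by lia.
by right; rewrite {1}e mulrDl mul1r; lia.
Qed.

Lemma mdist_bound x : 0 <= mdist x <= m.
Proof. by have [q []] := mdist_ex x. Qed.

Lemma mdist_cong x y : cong x y -> mdist x = mdist y.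
Proof.
case/congP=> q ->; have [q' [h e]] := mdist_ex y; apply: (mdist_uniq (q := q' + q)) => //.
by lia.
Qed.

Lemma mdist_eq0 x : mdist x = 0 -> cong x 0.
Proof. by move=> h; apply/congP; have [q [_]] := mdist_ex x; rewrite h => e; exists q; lia. Qed.


Lemma mdist_le x q : mdist x <= `|x - q * (2 * m)|.
Proof.
have [q' [h e]] := mdist_ex x.
have : x - q * (2 * m) = (q' - q) * (2 * m) + mdist x \/
       x - q * (2 * m) = (q' - q) * (2 * m) - mdist x.
  by lia.
set z := x - _; set k := q' - q.
have [->|[h1|h1]] : k = 0 \/ (k <= - 1 \/ 1 <= k) by lia.
- lia.
- have : k * (2 * m) <= -1 * (2 * m) by rewrite ler_wpM2r; lia.
  lia.
have : 1 * (2 * m) <= k * (2 * m) by rewrite ler_wpM2r; lia.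
lia.
Qed.

Lemma mdist_abs x : mdist x <= `|x|.
Proof. by have := mdist_le x 0; rewrite mul0r subr0. Qed.

Lemma mdistN x : mdist (- x) = mdist x.
Proof.
have [q [h e]] := mdist_ex x; apply: (mdist_uniq (q := - q)) => //; lia.
Qed.

Lemma mdistD x y : mdist (x + y) <= mdist x + mdist y.
Proof.
have [q [h e]] := mdist_ex x; have [q' [h' e']] := mdist_ex y.
apply: le_trans (mdist_le _ (q + q')) _; rewrite mulrDl.
have -> : x + y - (q * (2 * m) + q' * (2 * m)) = (x - q * (2 * m)) + (y - q' * (2 * m)) by ring.
apply: le_trans (ler_normD _ _) _; apply: lerD; lia.
Qed.

Lemma mdist_step x : mdist (x + 1) = mdist x + 1 \/ mdist (x + 1) = mdist x - 1.
Proof.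
have [q [h e]] := mdist_ex x; case: e => e.
  case: (ltrP (mdist x) m) => hm; [left|right].
    by apply: (mdist_uniq (q := q)); lia.
  by apply: (mdist_uniq (q := q + 1)); lia.
case: (ltrP 0 (mdist x)) => hm; [right|left]; apply: (mdist_uniq (q := q)); lia.
Qed.

Lemma mdist_stepN x : mdist (x - 1) = mdist x + 1 \/ mdist (x - 1) = mdist x - 1.
Proof. by rewrite -mdistN -(mdistN x) opprB addrC; apply: mdist_step. Qed.

Lemma mdist_dec x : mdist x != 0 -> mdist (x + 1) = mdist x - 1 \/ mdist (x - 1) = mdist x - 1.
Proof.
have [q [h e]] := mdist_ex x => n0; case: e => e; [right|left];
  apply: (mdist_uniq (q := q)); lia.
Qed.

Lemma mdist_shift x : mdist (x + m) = m - mdist x.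
Proof.
have [q [h e]] := mdist_ex x; case: e => e.
  by apply: (mdist_uniq (q := q + 1)); lia.
by apply: (mdist_uniq (q := q)); lia.
Qed.

Lemma mdist_par x : (2 %| mdist x - x)%Z.
Proof.
have [q [h e]] := mdist_ex x; have : (2 %| q * (2 * m))%Z by rewrite mulrCA dvdz_mulr.
lia.
Qed.

Lemma cong_par x y : cong x y -> (2 %| x - y)%Z.
Proof.
case/congP=> q ->; rewrite addrC addKr; by rewrite mulrCA dvdz_mulr.
Qed.
End Nrm.

(** * Net degrees of orientations *)

Section Net.
Import GRing.Theory Num.Theory Order.TTheory.
Local Open Scope ring_scope.
Variable V : finType.
Implicit Types (es : seq (V * V)) (f g : V -> int) (A : {set V}).

Definition arc_net (e : V * V) (v : V) : int := (v == e.1)%:Z - (v == e.2)%:Z.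

(** The possible values of out-degree minus in-degree, over all orientations of
es.  Contractions and liftings create parallel edges and loops, whence the
list of pairs. *)
Fixpoint net es f : Prop :=
  if es is e :: es' then
    exists f', net es' f' /\
      ((forall v, f v = f' v + arc_net e v) \/ (forall v, f v = f' v - arc_net e v))
  else forall v, f v = 0.

Definition crosses A (e : V * V) := (e.1 \in A) != (e.2 \in A).
Definition cross_num es A : int := (count (crosses A) es)%:Z.

Lemma net_ext es f g : f =1 g -> net es f -> net es g.
Proof.
move=> fg; case: es => [h v|e es [f' [h1 h2]]]; first by rewrite -fg.
by exists f'; split=> //; case: h2 => h2; [left|right] => v; rewrite -fg.
Qed.

Lemma net_opp es f : net es f -> net es (fun v => - f v).
Proof.
elim: es f => [|e es IH] f /=; first by move=> h v; rewrite h.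
case=> f' [/IH h1 h2]; exists (fun v => - f' v); split=> //.
by case: h2 => h2; [right|left] => v; rewrite h2; lia.
Qed.

Lemma net_cat es1 es2 f g :
  net es1 f -> net es2 g -> net (es1 ++ es2) (fun v => f v + g v).
Proof.
move=> + h2; elim: es1 f => [|e es IH] f /=.
  by move=> h; apply: net_ext h2 => v; rewrite h add0r.
case=> f' [/IH h1 h]; exists (fun v => f' v + g v); split=> //.
by case: h => h; [left|right] => v; rewrite h; lia.
Qed.

Lemma net_catE es1 es2 f : net (es1 ++ es2) f ->
  exists f1 f2, [/\ net es1 f1, net es2 f2 & forall v, f v = f1 v + f2 v].
Proof.
elim: es1 f => [|e es IH] f /=.
  by move=> h; exists (fun=> 0), f; split=> // v; rewrite add0r.
case=> f' [/IH [f1 [f2 [h1 h2 h3]]] h]; case: h => h.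
  exists (fun v => f1 v + arc_net e v), f2; split=> //; last by move=> v; rewrite h h3; lia.
  by exists f1; split=> //; left.
exists (fun v => f1 v - arc_net e v), f2; split=> //; last by move=> v; rewrite h h3; lia.
by exists f1; split=> //; right.
Qed.

Lemma net_catC es1 es2 f : net (es1 ++ es2) f -> net (es2 ++ es1) f.
Proof.
case/net_catE=> f1 [f2 [h1 h2 h3]]; apply: net_ext (net_cat h2 h1) => v.
by rewrite h3 addrC.
Qed.

Lemma net_perm es es' f : perm_eq es es' -> net es f -> net es' f.
Proof.
elim: es es' f => [|e es IH] es' f.
  by rewrite perm_sym => /perm_nilP ->.
move=> h; have : e \in es' by rewrite -(perm_mem h) mem_head.
move=> ees'; case/splitPr: ees' h => s1 s2 h [f' [h1 h2]].
apply: net_catC; rewrite /=.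
have p : perm_eq es (s2 ++ s1).
  by rewrite -(perm_cons e) (permPl h) -cat_cons perm_catC.
by exists f'; split=> //; apply: IH h1.
Qed.

Lemma net_swap x y es f : net ((x, y) :: es) f -> net ((y, x) :: es) f.
Proof.
case=> f' [h1 h2]; exists f'; split=> //; rewrite /arc_net /= in h2 *.
by case: h2 => h; [right|left] => v; rewrite h; lia.
Qed.

Lemma sum_arc_net e A : \sum_(v in A) arc_net e v = (e.1 \in A)%:Z - (e.2 \in A)%:Z.
Proof.
have pt x : \sum_(v in A) (v == x)%:Z = (x \in A)%:Z.
  case: (boolP (x \in A)) => xA.
    by rewrite (bigD1 x) //= eqxx big1 ?addr0 // => v /andP[_ /negbTE ->].
  by rewrite big1 // => v vA; case: eqP => // vx; rewrite vx (negbTE xA) in vA.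
by rewrite /arc_net sumrB !pt.
Qed.

Lemma cross_num_cons e es A : cross_num (e :: es) A = (crosses A e)%:Z + cross_num es A.
Proof. by []. Qed.

Lemma cross_num_cat es1 es2 A : cross_num (es1 ++ es2) A = cross_num es1 A + cross_num es2 A.
Proof. by rewrite /cross_num count_cat. Qed.

Lemma cross_num_perm es1 es2 A : perm_eq es1 es2 -> cross_num es1 A = cross_num es2 A.
Proof. by move/permP=> h; rewrite /cross_num h. Qed.

Lemma net_cross_num es f A : net es f ->
  `|\sum_(v in A) f v| <= cross_num es A /\ (2 %| cross_num es A - \sum_(v in A) f v)%Z.
Proof.
elim: es f => [|e es IH] f /=.
  by move=> h; rewrite big1 // => v; rewrite h.
case=> f' [/IH [h1 h2] h]; rewrite cross_num_cons /crosses.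
have : \sum_(v in A) f v = \sum_(v in A) f' v + ((e.1 \in A)%:Z - (e.2 \in A)%:Z) \/
       \sum_(v in A) f v = \sum_(v in A) f' v - ((e.1 \in A)%:Z - (e.2 \in A)%:Z).
  case: h => h; [left|right]; rewrite -sum_arc_net -?sumrB -?big_split; exact: eq_bigr.
move: h1 h2; do 2 case: (_ \in A) => /=; lia.
Qed.

Lemma net_cross_num1 es f v : net es f ->
  `|f v| <= cross_num es [set v] /\ (2 %| cross_num es [set v] - f v)%Z.
Proof. by move/(net_cross_num [set v]); rewrite big_set1. Qed.

Lemma cross_num_par es A : (2 %| cross_num es A - \sum_(v in A) cross_num es [set v])%Z.
Proof.
elim: es => [|e es IH]; first by rewrite big1 // subrr.
rewrite cross_num_cons; under eq_bigr => v _ do rewrite cross_num_cons.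
rewrite big_split /=.
have h : (2 %| (crosses A e)%:Z - \sum_(v in A) (crosses [set v] e)%:Z)%Z.
  have : (2 %| \sum_(v in A) ((crosses [set v] e)%:Z - arc_net e v))%Z.
    apply: rpred_sum => v _; rewrite /crosses /arc_net !inE ![_ == v]eq_sym.
    by do 2 case: (v == _).
  rewrite sumrB sum_arc_net; set S := \sum_(v in A) _; rewrite /crosses.
  by do 2 case: (_ \in A) => /=; lia.
by rewrite opprD addrACA rpredD.
Qed.

Lemma cross_numC es A : cross_num es (~: A) = cross_num es A.
Proof.
rewrite /cross_num; congr Posz; apply: eq_count => e; rewrite /crosses !inE.
by do 2 case: (_ \in A).
Qed.

End Net.

(** * Orientations with prescribed residues: the induction setting *)

Section Orient.
Import GRing.Theory Num.Theory Order.TTheory.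
Local Open Scope ring_scope.
Variables (V : finType) (m : int).
Hypothesis m2 : 2 <= m.
Implicit Types (es : seq (V * V)) (f g h b : V -> int) (A W Z : {set V}).

Local Notation cong := (cong m).
Local Notation mdist := (mdist m).

Definition inside W (e : V * V) := (e.1 \in W) && (e.2 \in W).

Definition fsum f A : int := \sum_(v in A) f v.
Definition fadd f g v : int := f v + g v.

(** The state of the induction for the orientation theorem.  The edges in es
have to be oriented with net degree b; besides them each vertex v has [h v]
half-edges that are already oriented, with net degree [g v].  The charge of a
set A is the sum of b + g over A: it is the residue of the number of edges and
half-edges leaving A minus the number of those entering it.  By [adm_cut]
there are many of them when the charge is far from 0 mod 2m.  Only Z may
violate this: Z is empty or consists of one vertex of charge 0 mod 2m.  The bound
[adm_tot] on all half-edges makes up for the missing cut condition for W. *)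
Record admissible W es h g b Z : Prop := Admissible {
  adm_in : all (inside W) es;
  adm_g : forall v, v \in W -> `|g v| <= h v /\ (2 %| h v - g v)%Z;
  adm_b : forall v, v \in W -> (2 %| cross_num es [set v] - b v)%Z;
  adm_sum : cong (fsum b W) 0;
  adm_Z : Z = set0 \/ exists v, [/\ v \in W, Z = [set v] & mdist (b v + g v) = 0];
  adm_tot : fsum h W <= 2 * m - 2 + mdist (fsum (fadd b g) W);
  adm_cut : forall A, A \subset W -> A != set0 -> A != W -> A != Z ->
    2 * m - 2 + mdist (fsum (fadd b g) A) <= cross_num es A + fsum h A }.

Definition solvable W es b := exists f, net es f /\ forall v, v \in W -> cong (f v) (b v).

Lemma fsumD f g A : fsum (fadd f g) A = fsum f A + fsum g A.
Proof. by rewrite /fsum big_split. Qed.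
Lemma eq_fsum f g A : (forall v, v \in A -> f v = g v) -> fsum f A = fsum g A.
Proof. by move=> h; apply: eq_bigr. Qed.
Lemma fsum1 f v : fsum f [set v] = f v.
Proof. by rewrite /fsum big_set1. Qed.

Lemma cross_num0 es A : (forall e, e \in es -> ~~ crosses A e) -> cross_num es A = 0.
Proof.
move=> h; rewrite /cross_num; suff -> : count (crosses A) es = 0%N by [].
by apply/eqP; rewrite -leqn0 leqNgt -has_count; apply/hasPn.
Qed.

Lemma cross_num_points es A : (forall e, e \in es -> ~~ inside A e) ->
  \sum_(v in A) cross_num es [set v] = cross_num es A.
Proof.
elim: es => [|e es IH] h; first by rewrite big1.
under eq_bigr => v _ do rewrite cross_num_cons.
rewrite big_split /= IH ?cross_num_cons; last by move=> e' e'es; apply: h; rewrite inE e'es orbT.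
congr (_ + _); have := h e (mem_head _ _); rewrite /inside negb_and.
have pt x y : x != y -> (x \in A) && (y \in A) = false ->
    \sum_(v in A) (crosses [set v] (x, y))%:Z = (crosses A (x, y))%:Z.
  move=> xy nA.
  have one z : \sum_(v in A) (v == z)%:Z = (z \in A)%:Z.
    case: (boolP (z \in A)) => xA.
      by rewrite (bigD1 z) //= eqxx big1 ?addr0 // => v /andP[_ /negbTE ->].
    by rewrite big1 // => v vA; case: eqP => // vx; rewrite vx (negbTE xA) in vA.
  rewrite (eq_bigr (fun v => (v == x)%:Z + (v == y)%:Z)) => [|v _].
    by rewrite big_split /= !one /crosses /=; move: nA; do 2 case: (_ \in A).
  rewrite /crosses !inE /= ![_ == v]eq_sym; case: (eqVneq v x) => [->|_] //=.
    by rewrite (negbTE xy).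
  by case: (v == y).
move=> nA; case: (eqVneq e.1 e.2) => [e12|e12]; last first.
  by rewrite [e]surjective_pairing; apply: pt => //; apply/negbTE; rewrite negb_and.
rewrite /crosses e12 eqxx big1 // => v _; by rewrite eqxx.
Qed.

(** Both sides of the cut condition have the same parity; so a cut condition
that is not tight holds with slack 2, see [adm_slack]. *)
Lemma adm_par W es h g b Z A : admissible W es h g b Z -> A \subset W ->
  (2 %| cross_num es A + fsum h A - mdist (fsum (fadd b g) A))%Z.
Proof.
move=> G /subsetP AW; have h1 := cross_num_par es A.
rewrite -/(fsum (fun v => cross_num es [set v]) A) in h1.
have h2 : (2 %| fsum (fun v => cross_num es [set v]) A - fsum b A)%Z.
  by rewrite /fsum -sumrB; apply: rpred_sum => v /AW; apply: (adm_b G).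
have h3 : (2 %| fsum h A - fsum g A)%Z.
  by rewrite /fsum -sumrB; apply: rpred_sum => v /AW /(adm_g G) [].
have := mdist_par m2 (fsum (fadd b g) A); rewrite fsumD; lia.
Qed.

Lemma adm_slack W es h g b Z A : admissible W es h g b Z ->
  A \subset W -> A != set0 -> A != W -> A != Z ->
  ~ (cross_num es A + fsum h A <= 2 * m - 2 + mdist (fsum (fadd b g) A)) ->
  2 * m + mdist (fsum (fadd b g) A) <= cross_num es A + fsum h A.
Proof. by move=> G AW A0 AT AZ; have := adm_par G AW; have := adm_cut G AW A0 AT AZ; lia. Qed.

Definition solvable_below_card W := forall W' es h g b Z, (#|W'| < #|W|)%N ->
  admissible W' es h g b Z -> solvable W' es b.

(** When the edges that are not inside A have been oriented correctly, they
count as half-edges for A.  This changes neither the charges of the subsets of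
A nor their cuts, and the tightness of A is the required bound on the number
of half-edges. *)
Lemma solve_inside W es h g b Z A fr : solvable_below_card W -> admissible W es h g b Z ->
  A \subset W -> (#|A| < #|W|)%N ->
  cross_num es A + fsum h A <= 2 * m - 2 + mdist (fsum (fadd b g) A) ->
  net [seq e <- es | ~~ inside A e] fr ->
  cong (fsum fr A) (fsum b A) ->
  (forall v, v \in W -> v \notin A -> cong (fr v) (b v)) ->
  solvable W es b.
Proof.
move=> IH G AW ltA tight nfr sfr ofr; have /subsetP sAW := AW.
set es2 := [seq e <- es | _] in nfr; pose es1 := [seq e <- es | inside A e].
have p : perm_eq (es1 ++ es2) es by rewrite perm_filterC.
have bdE B : cross_num es B = cross_num es1 B + cross_num es2 B by rewrite -(cross_num_perm _ p) cross_num_cat.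
have in1 e : e \in es1 -> inside A e by rewrite mem_filter => /andP[].
have out2 e : e \in es2 -> ~~ inside A e by rewrite mem_filter => /andP[].
have sum2 (B : {set V}) : B \subset A -> fsum (fun v => cross_num es2 [set v]) B = cross_num es2 B.
  move=> /subsetP BA; apply: cross_num_points => e /out2; apply: contra.
  by rewrite /inside => /andP[/BA -> /BA ->].
have bd1A : cross_num es1 A = 0.
  by apply: cross_num0 => e /in1 /andP[]; rewrite /crosses => -> ->.
pose b' v := b v - fr v; pose g' := fadd g fr.
pose h' := fadd h (fun v => cross_num es2 [set v]).
have cE (B : {set V}) : fsum (fadd b' g') B = fsum (fadd b g) B.
  by apply: eq_fsum => v _; rewrite /fadd /b' /g' /fadd; ring.
have [|f1 [nf1 f1A]] := IH A es1 h' g' b' (Z :&: A) ltA.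
  split.
  - by apply/allP => e /in1.
  - move=> v vA; have [h1 h2] := adm_g G (sAW _ vA).
    by have [] := net_cross_num1 v nfr; rewrite /h' /g' /fadd; lia.
  - move=> v vA; have := adm_b G (sAW _ vA); rewrite bdE /b'.
    by have [] := net_cross_num1 v nfr; lia.
  - have -> : fsum b' A = fsum b A - fsum fr A by rewrite /fsum sumrB.
    by rewrite /cong subr0; have := cong_sym sfr; rewrite /cong.
  - case: (adm_Z G) => [->|[v [vW -> cv]]]; first by left; rewrite set0I.
    case: (boolP (v \in A)) => vA; last first.
      left; apply/setP => w; rewrite !inE; case: eqP => // ->; exact: negbTE.
    right; exists v; split=> //; first by apply/setIidPl; rewrite sub1set.
    by rewrite (_ : _ + _ = b v + g v) // /b' /g' /fadd; ring.
  - by rewrite cE /h' [fsum (fadd h _) _]fsumD sum2 //; move: tight; rewrite bdE bd1A; lia.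
  - move=> B BA B0 BnA BZ; rewrite cE /h' [fsum (fadd h _) _]fsumD sum2 //.
    have BW := subset_trans BA AW.
    have := adm_cut G BW B0; rewrite bdE.
    have -> : B != W.
      by apply: contraTneq ltA => <-; rewrite -leqNgt subset_leq_card.
    have -> : B != Z.
      by apply: contraNneq BZ => <-; exact/eqP/esym/setIidPl.
    by move=> /(_ isT isT); lia.
exists (fun v => f1 v + fr v); split.
  by apply: net_perm (net_cat nf1 nfr).
move=> v vW; case: (boolP (v \in A)) => vA.
  by have := congD (f1A v vA) (cong_refl m (fr v)); rewrite /b' subrK.
have -> : f1 v = 0.
  have [] := net_cross_num1 v nf1; rewrite cross_num0; first lia.
  move=> e /in1 /andP[e1 e2]; rewrite /crosses !inE.
  case: (eqVneq e.1 v) => [ev|_]; first by rewrite -ev e1 in vA.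
  by case: (eqVneq e.2 v) => [ev|_] //; rewrite -ev e2 in vA.
by rewrite add0r; apply: ofr.
Qed.

End Orient.

(** * Contracting a tight set *)

Section Contract.
Import GRing.Theory Num.Theory Order.TTheory.
Local Open Scope ring_scope.
Variables (V : finType).
Implicit Types (es : seq (V * V)) (f g h b : V -> int) (A W Z : {set V}).

Definition map_pair (p : V -> V) (e : V * V) := (p e.1, p e.2).

Lemma net_lift (p : V -> V) es f : net (map (map_pair p) es) f ->
  exists f', net es f' /\ forall v, fsum f' [set u | p u == v] = f v.
Proof.
have dvE e v : \sum_(u in [set u | p u == v]) arc_net e u = arc_net (map_pair p e) v.
  by rewrite sum_arc_net /arc_net !inE ![v == _]eq_sym.
elim: es f => [|e es IH] f /=.
  by move=> h; exists (fun=> 0); split=> // v; rewrite /fsum big1.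
case=> f1 [/IH [f' [h1 h2]] [] h].
  exists (fun v => f' v + arc_net e v); split; first by exists f'; split=> //; left.
  by move=> v; rewrite /fsum big_split /= dvE -/(fsum f' _) h2 h.
exists (fun v => f' v - arc_net e v); split; first by exists f'; split=> //; right.
by move=> v; rewrite /fsum sumrB /= dvE -/(fsum f' _) h2 h.
Qed.

Variable (m : int).
Hypothesis m2 : 2 <= m.
Local Notation cong := (cong m).
Local Notation mdist := (mdist m).

(** Contract A to the vertex a0 and solve the smaller problem; its solution
orients the edges that are not inside A as needed in [solve_inside]. *)
Lemma solve_contract W es h g b Z A : solvable_below_card m W -> admissible m W es h g b Z ->
  A \subset W -> (1 < #|A|)%N -> (#|A| < #|W|)%N ->
  cross_num es A + fsum h A <= 2 * m - 2 + mdist (fsum (fadd b g) A) ->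
  solvable m W es b.
Proof.
move=> IH G AW A1 AltW tight; have /subsetP sAW := AW.
have [a0 [a1 [a0A a1A a01]]] := card_gt1P A1.
pose p v := if v \in A then a0 else v.
pose fib f v := fsum f [set u in W | p u == v].
pose pre (B : {set V}) := [set u in W | p u \in B].
have fibE f B : fsum (fib f) B = fsum f (pre B).
  rewrite /fsum [RHS](partition_big p (mem B)) /=; last by move=> u; rewrite inE => /andP[].
  apply: eq_bigr => v vB; apply: eq_bigl => u; rewrite !inE.
  by case: (eqVneq (p u) v) => [->|_]; rewrite ?vB ?andbF ?andbT.
set es2 := [seq e <- es | ~~ inside A e].
have pA v : v \in A -> p v = a0 by rewrite /p => ->.
have pnA v : v \notin A -> p v = v by rewrite /p => /negbTE ->.
have es2W e : e \in es2 -> (e.1 \in W) /\ (e.2 \in W).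
  by rewrite mem_filter => /andP[_ /(allP (adm_in G)) /andP[]].
have bdE (B : {set V}) : cross_num (map (map_pair p) es2) B = cross_num es (pre B).
  have -> : cross_num es (pre B) = cross_num es2 (pre B).
    have q : perm_eq ([seq e <- es | inside A e] ++ es2) es by rewrite perm_filterC.
    rewrite -(cross_num_perm _ q) cross_num_cat cross_num0 ?add0r // => e.
    rewrite mem_filter => /andP[/andP[e1 e2] _].
    by rewrite /crosses !inE !pA // !sAW // eqxx.
  rewrite /cross_num count_map; congr Posz; apply: eq_in_count => e /es2W [e1 e2] /=.
  by rewrite /crosses !inE e1 e2.
pose W' := p @: W.
have fib1 f v : v \notin A -> v \in W -> fib f v = f v.
  move=> vA vW; rewrite /fib -(fsum1 f v); congr fsum; apply/setP => u; rewrite !inE.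
  apply/andP/eqP => [[uW]|->]; last by rewrite pnA // eqxx.
  by rewrite /p; case: ifP => [_ /eqP e|_ /eqP //]; rewrite -e a0A in vA.
have fibA f : fib f a0 = fsum f A.
  congr fsum; apply/setP => u; rewrite !inE /p; case: ifP => uA; first by rewrite eqxx sAW.
  by apply/negP => /andP[_ /eqP e]; rewrite e a0A in uA.
have preW' : pre W' = W.
  by apply/setP => u; rewrite inE; case: (boolP (u \in W)) => //= uW; rewrite imset_f.
pose Z' := if Z \subset A then set0 else Z.
have [||f' [nf' f'E]] := IH W' (map (map_pair p) es2) (fib h) (fib g) (fib b) Z'.
- apply: (@leq_ltn_trans #|W :\ a1|); last by rewrite (cardsD1 a1 W) sAW.
  apply/subset_leq_card/subsetP => _ /imsetP[u uW ->]; rewrite !inE /p.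
  case: ifP => uA; first by rewrite a01 sAW.
  by rewrite uW andbT; apply: contraFneq uA => ->.
- split.
  - by apply/allP => _ /mapP[e /es2W [e1 e2] ->]; rewrite /inside /= !imset_f.
  - move=> v vW'; split.
      rewrite /fib; apply: (le_trans (ler_norm_sum _ _ _)); apply: ler_sum => u.
      by rewrite inE => /andP[/(adm_g G) []].
    rewrite /fib /fsum -sumrB; apply: rpred_sum => u.
    by rewrite inE => /andP[/(adm_g G) []].
  - move=> v vW'; rewrite -(fsum1 (fib b)) fibE bdE.
    have h1 := cross_num_par es (pre [set v]).
    rewrite -/(fsum (fun v => cross_num es [set v]) _) in h1.
    have h2 : (2 %| fsum (fun v => cross_num es [set v]) (pre [set v]) - fsum b (pre [set v]))%Z.
      rewrite /fsum -sumrB; apply: rpred_sum => u; rewrite inE => /andP[uW _].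
      exact: (adm_b G).
    lia.
  - by rewrite fibE preW'; apply: (adm_sum G).
  - rewrite /Z'; case: ifP => ZA; first by left.
    right; case: (adm_Z G) => [Z0|[v [vW Zv nv]]]; first by rewrite Z0 sub0set in ZA.
    have vA : v \notin A by rewrite Zv sub1set in ZA; rewrite ZA.
    exists v; split=> //; last by rewrite !fib1.
    by rewrite -(pnA v vA) imset_f.
  - by rewrite fsumD !fibE preW' -fsumD; apply: (adm_tot G).
  move=> B BW' B0 BT BZ; rewrite fsumD !fibE -fsumD bdE; have /subsetP sBW' := BW'.
  have BE : B = p @: pre B.
    apply/setP => v; apply/idP/imsetP => [vB|[u]]; last by rewrite inE => /andP[_ uB] ->.
    by have /imsetP[u uW vE] := sBW' _ vB; exists u; rewrite // inE uW -vE.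
  apply: (adm_cut G).
  - by apply/subsetP => u; rewrite inE => /andP[].
  - by apply: contraNneq B0 => e; rewrite BE e imset0.
  - by apply: contraNneq BT => e; rewrite BE e.
  apply: contraNneq BZ => e; rewrite /Z'.
  case: (adm_Z G) => [Z0|[v [vW Zv nv]]].
    by rewrite Z0 sub0set BE e Z0 imset0.
  case: ifP => ZA; last by rewrite BE e Zv imset_set1 pnA // ; rewrite Zv sub1set in ZA; rewrite ZA.
  have vA : v \in A by rewrite Zv sub1set in ZA.
  have Ba0 : B = [set a0] by rewrite BE e Zv imset_set1 pA.
  have : a0 \in pre B by rewrite inE sAW // Ba0 pA // set11.
  have : a1 \in pre B by rewrite inE sAW // Ba0 pA // set11.
  by rewrite e Zv !inE => /eqP a1v /eqP a0v; rewrite a0v a1v eqxx in a01.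
have [fr [nfr frE]] := net_lift nf'.
apply: (solve_inside m2 IH G AW AltW tight nfr).
  have -> : A = [set u | p u == a0].
    apply/setP => u; rewrite inE /p; case: ifP => uA; first by rewrite eqxx.
    by apply/esym; apply: contraFF uA => /eqP ->.
  rewrite frE; have -> : [set u | p u == a0] = A.
    apply/setP => u; rewrite inE /p; case: ifP => uA; first by rewrite eqxx.
    by apply: contraFF uA => /eqP ->.
  rewrite -fibA; apply: f'E.
  by apply/imsetP; exists a0; rewrite ?sAW // pA.
move=> v vW vA; have -> : fr v = f' v.
  rewrite -frE -(fsum1 fr v); congr fsum; apply/setP => u; rewrite !inE.
  apply/eqP/eqP => [->|]; first by rewrite pnA.
  by rewrite /p; case: ifP => [_ e|_ //]; rewrite -e a0A in vA.
rewrite -(fib1 b v vA vW); apply: f'E.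
by apply/imsetP; exists v; rewrite ?pnA.
Qed.
End Contract.

(** * Lifting edges at a vertex *)

Section Zero.
Import GRing.Theory Num.Theory Order.TTheory.
Local Open Scope ring_scope.
Variables (V : finType) (m : int).
Hypothesis m2 : 2 <= m.
Implicit Types (es : seq (V * V)) (f g h b : V -> int) (A W Z : {set V}).
Local Notation cong := (cong m).
Local Notation mdist := (mdist m).
Local Notation admissible := (admissible m).
Local Notation solvable := (solvable m).

(** Arises by reordering the list and swapping the ends of edges; solutions are
transported from es' back to es. *)
Definition arcs_eqv es es' : Prop :=
  [/\ forall f, net es' f -> net es f, forall A, cross_num es A = cross_num es' A,
      size es = size es' & forall W, all (inside W) es = all (inside W) es'].

Lemma adm_eqv W es es' h g b Z : arcs_eqv es es' -> admissible W es h g b Z -> admissible W es' h g b Z.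
Proof.
move=> [_ bdE _ inE] G; split; try by case: G.
- by rewrite -inE; apply: adm_in G.
- by move=> v vW; rewrite -bdE; apply: (adm_b G).
- by move=> A *; rewrite -bdE; apply: (adm_cut G).
Qed.

Lemma solvable_eqv W es es' b : arcs_eqv es es' -> solvable W es' b -> solvable W es b.
Proof. by case=> nE _ _ _ [f [nf fb]]; exists f; split=> //; apply: nE. Qed.

Lemma eqv_trans es2 es1 es3 : arcs_eqv es1 es2 -> arcs_eqv es2 es3 -> arcs_eqv es1 es3.
Proof.
case=> a1 a2 a3 a4 [b1 b2 b3 b4]; split; last by move=> W; rewrite a4.
- by move=> f /b1 /a1.
- by move=> A; rewrite a2.
- by rewrite a3.
Qed.

Lemma eqv_perm es es' : perm_eq es es' -> arcs_eqv es es'.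
Proof.
move=> p; split; [|by move=> A; apply: cross_num_perm| exact: perm_size| by move=> W; apply: perm_all].
by move=> f; apply: net_perm; rewrite perm_sym.
Qed.

Lemma eqv_swap x y es : arcs_eqv ((x, y) :: es) ((y, x) :: es).
Proof.
split=> // [f|A|W]; first exact: net_swap.
  by rewrite !cross_num_cons /crosses /= eq_sym.
by rewrite /= /inside /= [(x \in W) && (y \in W)]andbC.
Qed.

Lemma eqv_cons e es es' : arcs_eqv es es' -> arcs_eqv (e :: es) (e :: es').
Proof.
case=> a1 a2 a3 a4; split; [|by move=> A; rewrite !cross_num_cons a2|by rewrite /= a3|by move=> W; rewrite /= a4].
by move=> f [f' [/a1 h1 h2]]; exists f'.
Qed.

Lemma pick_edge es v e : e \in es -> crosses [set v] e ->
  exists y es', [/\ y != v, inside [set v; y] e & arcs_eqv es ((v, y) :: es')].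
Proof.
move=> ees; have p : arcs_eqv es (e :: rem e es) by apply/eqv_perm/perm_to_rem.
rewrite /crosses !inE; case: e p {ees} => x y /= p.
case: (eqVneq x v) p => [->|xv] p; case: (eqVneq y v) p => [-> //|yv] p // _.
  by exists y, (rem (v, y) es); rewrite /inside !inE !eqxx orbT.
exists x, (rem (x, v) es); split=> //; first by rewrite /inside !inE !eqxx orbT.
apply: eqv_trans p _; exact: eqv_swap.
Qed.

Definition point_fun (x : V) (d : int) (v : V) : int := if v == x then d else 0.

Lemma fsum_upd x d A : fsum (point_fun x d) A = if x \in A then d else 0.
Proof.
rewrite /fsum; case: ifP => xA.
  by rewrite (bigD1 x) //= /point_fun eqxx big1 ?addr0 // => v /andP[_ /negbTE ->].
by rewrite big1 // /point_fun => v vA; case: eqP => // vx; rewrite vx xA in vA.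
Qed.

Lemma set_cases W A : A \subset W -> A != set0 -> A != W ->
  (exists2 x, x \in W & A = [set x]) \/ (1 < #|A| < #|W|)%N.
Proof.
move=> AW A0 AT; case: (ltngtP 1 #|A|) => [A1|A1|A1].
- right; apply/andP; split=> //; apply: proper_card; rewrite properEneq AT //.
- by rewrite ltnS leqn0 cards_eq0 (negbTE A0) in A1.
have /cards1P[x xA] : #|A| == 1%N by rewrite -A1.
by left; exists x => //; rewrite -sub1set -xA.
Qed.

Definition slack W es h g b := forall A, A \subset W -> (1 < #|A| < #|W|)%N ->
  2 * m + mdist (fsum b A + fsum g A) <= cross_num es A + fsum h A.

Definition solvable_below_size W es := forall es' h g b Z, (size es' < size es)%N ->
  admissible W es' h g b Z -> solvable W es' b.

(** A part without outgoing edges and its complement both satisfy the cut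
condition; as [mdist] is subadditive, there would be too many half-edges in
W. *)
Lemma no_isolated_part W es h g b Z A : admissible W es h g b Z -> A \subset W ->
  A != set0 -> A != W -> A != Z -> W :\: A != Z -> cross_num es A = 0 -> False.
Proof.
move=> G AW A0 AT AZ AZ' bA.
have bA' : cross_num es (W :\: A) = 0.
  rewrite -bA -(cross_numC es A) /cross_num; congr Posz; apply: eq_in_count => e /(allP (adm_in G)).
  by rewrite /inside /crosses !inE => /andP[-> ->]; rewrite !andbT.
have := adm_cut G AW A0 AT AZ; rewrite bA.
have := adm_cut G (subsetDl W A) _ _ AZ'; rewrite bA'.
have split f : fsum f W = fsum f A + fsum f (W :\: A).
  by rewrite /fsum (big_setID A) /= (setIidPr AW).
have := adm_tot G; rewrite !split; have := mdistD m2 (fsum (fadd b g) A) (fsum (fadd b g) (W :\: A)).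
rewrite setD_eq0; have -> : (W \subset A) = false.
  by apply: contraNF AT => WA; rewrite eqEsubset AW WA.
have -> : W :\: A != W.
  apply: contraNneq A0 => e; rewrite -subset0; apply/subsetP => x xA.
  by have := subsetP AW _ xA; rewrite -e inE xA.
move=> h1 h2 /(_ isT isT); lia.
Qed.

Section Lift.
Variables (W : {set V}) (es : seq (V * V)) (h g b : V -> int) (v0 y : V) (s : int).
Hypotheses (yv : y != v0) (G : admissible W ((v0, y) :: es) h g b [set v0]).
Hypotheses (v0W : v0 \in W) (sl : slack W ((v0, y) :: es) h g b).
Hypotheses (s1 : s = 1 \/ s = -1) (gs : `|g v0 + s| <= h v0 - 1).

Let h' := fadd h (fadd (point_fun v0 (-1)) (point_fun y 1)).
Let g' := fadd g (fadd (point_fun v0 s) (point_fun y (- s))).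
Let b' := fadd b (fadd (point_fun v0 (- s)) (point_fun y s)).

(** Lifting a half-edge at v0 together with the edge from v0 to y: the edge is
oriented, and the half-edge moves on to y.  A set containing v0 but not y
loses two from its cut, which is affordable if it has slack; for [set v0]
alone no condition is required. *)
Lemma adm_half : admissible W es h' g' b' [set v0].
Proof.
have yW : y \in W by have := adm_in G; rewrite /= /inside /= => /andP[/andP[]].
have yv' := negbTE yv; have vy' : (v0 == y) = false by rewrite eq_sym.
have sh A : fsum h' A = fsum h A - (v0 \in A)%:Z + (y \in A)%:Z.
  by rewrite /h' !fsumD !fsum_upd; do 2 case: (_ \in A); lia.
have sb A : fsum b' A + fsum g' A = fsum b A + fsum g A.
  by rewrite /b' /g' !fsumD !fsum_upd; do 2 case: (_ \in A); lia.
have sbW : fsum b' W = fsum b W.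
  by rewrite /b' !fsumD !fsum_upd v0W yW; lia.
split.
- by have := adm_in G => /= /andP[].
- move=> v vW; have := adm_g G vW; rewrite /h' /g' /fadd /point_fun.
  case: (eqVneq v v0) => [->|_]; rewrite ?vy'; first by lia.
  by case: (eqVneq v y) => [->|_]; lia.
- move=> v vW; have := adm_b G vW; rewrite cross_num_cons /crosses !inE ![_ == v]eq_sym /b' /fadd /point_fun.
  case: (eqVneq v v0) => [->|_]; rewrite ?vy' /=; first by lia.
  by case: (eqVneq v y) => [->|_] /=; lia.
- by rewrite sbW; apply: (adm_sum G).
- right; exists v0; split=> //.
  have := sb [set v0]; rewrite !fsum1 => ->; case: (adm_Z G) => [/setP/(_ v0)|[v [_ /set1_inj -> //]]].
  by rewrite !inE eqxx.
- rewrite fsumD sb sh v0W yW -fsumD; have := adm_tot G; lia.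
move=> A AW A0 AT AZ; rewrite fsumD sb sh -fsumD.
have := adm_cut G AW A0 AT AZ; rewrite cross_num_cons /crosses /=.
case: (set_cases AW A0 AT) => [[x xW Ax]|/(sl AW)].
  rewrite Ax !inE; have vx : x != v0 by apply: contraNneq AZ => <-; rewrite Ax.
  by rewrite [v0 == x]eq_sym (negbTE vx); case: (y == x) => /=; lia.
rewrite cross_num_cons /crosses /= -fsumD; do 2 case: (_ \in A) => /=; lia.
Qed.

Lemma solvable_half : solvable W es b' -> solvable W ((v0, y) :: es) b.
Proof.
have vy' : (v0 == y) = false by rewrite eq_sym; apply: negbTE.
case=> f' [nf f'b]; exists (fun v => f' v + s * arc_net (v0, y) v); split.
  exists f'; split=> //; case: s1 => ->; [left|right] => v; lia.
move=> v vW; have := f'b v vW; rewrite /cong /b' /fadd /point_fun /arc_net /=.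
congr (_ %| _)%Z; case: (eqVneq v v0) => [->|_]; rewrite ?vy'; first by lia.
by case: (eqVneq v y) => [->|_]; lia.
Qed.

End Lift.

(** Parallel edges in even number are oriented half in each direction. *)
Lemma net_star0 es v y : (forall e, e \in es -> crosses [set v] e -> inside [set v; y] e) ->
  (forall e, e \in es -> ~~ crosses [set v] e -> e.1 = e.2) ->
  v != y -> (2 %| cross_num es [set v])%Z -> net es (fun=> 0).
Proof.
move=> h1 h2 vy.
suff : exists d : bool, exists f, [/\ net es f, (2 %| cross_num es [set v] - d%:Z)%Z &
    forall u, f u = if d then arc_net (v, y) u else 0].
  case=> -[[f [n1 n2 n3]] n4|[f [n1 _ n3] _]]; first by lia.
  by apply: net_ext n1 => u; rewrite n3.
elim: es h1 h2 => [|e es IH] h1 h2; first by exists false, (fun=> 0).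
have [||d [f [nf df fE]]] := IH.
- by move=> e' e'es; apply: h1; rewrite inE e'es orbT.
- by move=> e' e'es; apply: h2; rewrite inE e'es orbT.
have := h1 e (mem_head _ _); have := h2 e (mem_head _ _); rewrite cross_num_cons.
case: (boolP (crosses [set v] e)) => [ce _ /(_ isT) ie|ne /(_ isT) e12 _]; last first.
  exists d, f; split=> //.
  by exists f; split=> //; left => u; rewrite /arc_net e12 subrr addr0.
have edv : arc_net e =1 arc_net (v, y) \/ arc_net e =1 (fun u => - arc_net (v, y) u).
  move: ce ie; rewrite /crosses /inside /arc_net !inE /=.
  case: (eqVneq e.1 v) => [->|] /=; case: (eqVneq e.2 v) => [->|] //=.
    by move=> _ _ /eqP ->; left.
  by move=> _ _; rewrite andbT => /eqP ->; right => u; lia.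
exists (~~ d); case: d df fE => df fE.
  exists (fun=> 0); split=> //; last by move: df; lia.
  by exists f; split=> //; case: edv => ee; [right|left] => u; rewrite ee fE; lia.
exists (arc_net (v, y)); split=> //; last by move: df; lia.
by exists f; split=> //; case: edv => ee; [left|right] => u; rewrite ee fE; lia.
Qed.

End Zero.

(** * A vertex of charge zero *)

Section SolveZero.
Import GRing.Theory Num.Theory Order.TTheory.
Local Open Scope ring_scope.
Variables (V : finType) (m : int).
Hypothesis m2 : 2 <= m.
Implicit Types (es : seq (V * V)) (f g h b : V -> int) (A W Z : {set V}).
Local Notation cong := (cong m).
Local Notation mdist := (mdist m).
Local Notation admissible := (admissible m).
Local Notation solvable := (solvable m).

Lemma adm_zero W es h g b v0 : admissible W es h g b [set v0] ->
  v0 \in W /\ mdist (b v0 + g v0) = 0.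
Proof.
move=> G; case: (adm_Z G) => [/setP/(_ v0)|[v [vW /set1_inj -> nv]]] //.
by rewrite !inE eqxx.
Qed.

(** The edges at v0 are even in number because b v0 is, so by [net_star0] they
can be oriented without effect on v0 or y.  A cut of the smaller problem that
contains y is compared with the cut that contains v0 too. *)
Lemma remove_zero W es h g b v0 y : solvable_below_card m W -> admissible W es h g b [set v0] ->
  h v0 = 0 -> y != v0 ->
  (forall e, e \in es -> crosses [set v0] e -> inside [set v0; y] e) ->
  solvable W es b.
Proof.
move=> IH G h0 yv0 hy; have [v0W c0] := adm_zero G.
have g0 : g v0 = 0 by have [] := adm_g G v0W; lia.
rewrite g0 addr0 in c0; pose W1 := W :\ v0.
pose es1 := [seq e <- es | inside W1 e]; pose es2 := [seq e <- es | ~~ inside W1 e].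
have p : perm_eq (es1 ++ es2) es by rewrite perm_filterC.
have bdE A : cross_num es A = cross_num es1 A + cross_num es2 A by rewrite -(cross_num_perm _ p) cross_num_cat.
have in1 e : e \in es1 -> inside W1 e by rewrite mem_filter => /andP[].
have out2 e : e \in es2 -> e.1 = e.2 \/ (crosses [set v0] e /\ inside [set v0; y] e).
  rewrite mem_filter => /andP[h1 ees].
  case: (boolP (crosses [set v0] e)) => ce; first by right; split=> //; exact: hy.
  left; move: h1 ce; have := allP (adm_in G) _ ees.
  rewrite /inside /crosses !inE => /andP[-> ->]; rewrite !andbT.
  by case: (eqVneq e.1 v0) => [->|]; case: (eqVneq e.2 v0) => [->|].
have bd2 A : (v0 \in A) = (y \in A) -> cross_num es2 A = 0.
  move=> vy; apply: cross_num0 => e /out2[e12|[]]; first by rewrite /crosses e12 eqxx.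
  rewrite /crosses /inside !inE.
  case: (eqVneq e.1 v0) => [->|] /=; case: (eqVneq e.2 v0) => [->|] //=.
    by move=> _ _ /eqP ->; rewrite vy eqxx.
  by move=> _ _; rewrite andbT => /eqP ->; rewrite vy eqxx.
have bd1v0 : cross_num es1 [set v0] = 0.
  apply: cross_num0 => e /in1; rewrite /inside /crosses !inE => /andP[].
  by case: (e.1 == v0); case: (e.2 == v0).
have bd2v0 : (2 %| cross_num es2 [set v0])%Z.
  have := adm_b G v0W; have := mdist_par m2 (b v0); rewrite c0 bdE bd1v0; lia.
have vy0 : (v0 == y) = false by rewrite eq_sym; apply: negbTE.
have bd2y : cross_num es2 [set y] = cross_num es2 [set v0].
  congr Posz; apply: eq_in_count => e /out2[e12|[]]; first by rewrite /crosses e12 !eqxx.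
  rewrite /crosses /inside !inE.
  case: (eqVneq e.1 v0) => [->|] /=; case: (eqVneq e.2 v0) => [->|] //=.
    by move=> _ _ /eqP ->; rewrite eqxx vy0.
  by move=> _ _; rewrite andbT => /eqP ->; rewrite eqxx vy0.
have split1 f A : v0 \notin A -> fsum f (v0 |: A) = f v0 + fsum f A.
  by move=> v0A; rewrite /fsum big_setU1.
have W1W : v0 |: W1 = W by rewrite setD1K.
have v0W1 : v0 \notin W1 by rewrite !inE eqxx.
have cgb0 := mdist_eq0 m2 c0.
have [||f1 [nf1 f1b]] := IH W1 es1 h g b set0.
- by rewrite (cardsD1 v0 W) v0W.
- split.
  - by apply/allP.
  - by move=> v /setD1P[_ vW]; apply: (adm_g G).
  - move=> v /setD1P[vv0 vW]; have := adm_b G vW; rewrite bdE.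
    case: (eqVneq v y) => [->|vy]; first by rewrite bd2y; lia.
    by rewrite bd2 ?addr0 // !inE eq_sym (negbTE vv0) eq_sym (negbTE vy).
  - have := adm_sum G; rewrite -W1W split1 // => h1.
    by have := congB h1 cgb0; rewrite subrr addrC addKr.
  - by left.
  - have := adm_tot G; rewrite -W1W !split1 // h0 add0r /fadd g0 addr0.
    by rewrite (mdist_cong m2 (congD cgb0 (cong_refl m _))) add0r.
  move=> A AW1 A0 AT _; have v0A : v0 \notin A.
    by apply: contra v0W1; apply: (subsetP AW1).
  have AW : A \subset W by apply: subset_trans AW1 (subD1set _ _).
  case: (boolP (y \in A)) => yA; last first.
    have := adm_cut G AW A0; rewrite bdE bd2 ?addr0; last by rewrite (negbTE v0A) (negbTE yA).
    apply; last by apply: contraNneq v0A => ->; rewrite set11.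
    by apply: contraNneq v0A => ->.
  have := adm_cut G (A := v0 |: A); rewrite bdE bd2 ?addr0; last by rewrite !inE eqxx yA orbT.
  have -> : cross_num es1 (v0 |: A) = cross_num es1 A.
    congr Posz; apply: eq_in_count => e /in1; rewrite /inside /crosses !inE => /andP[].
    by case: (e.1 == v0); case: (e.2 == v0).
  rewrite !split1 // h0 add0r /fadd g0 addr0.
  rewrite (mdist_cong m2 (congD cgb0 (cong_refl m _))) add0r.
  apply.
  - by rewrite subUset sub1set v0W.
  - by apply/set0Pn; exists v0; rewrite !inE eqxx.
  - apply: contraNneq AT => e; rewrite eqEsubset AW1; apply/subsetP => v /setD1P[vv0].
    by rewrite -e !inE (negbTE vv0).
  - apply: contraNneq yv0 => e; have : y \in v0 |: A by rewrite !inE yA orbT.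
    by rewrite e inE.
have n2 : net es2 (fun=> 0).
  apply: (net_star0 m2 (v := v0) (y := y)) => //; last by rewrite eq_sym.
    move=> e; rewrite mem_filter => /andP[_]; exact: hy.
  by move=> e /out2[//|[-> //]].
exists (fun v => f1 v + 0); split; first exact: net_perm (net_cat nf1 n2).
move=> v vW; rewrite addr0; case: (eqVneq v v0) => [->|vv0].
  have [] := net_cross_num1 v0 nf1; rewrite bd1v0 => h1 _.
  by rewrite (_ : f1 v0 = 0) ?(cong_sym cgb0) //; lia.
by apply: f1b; rewrite !inE vv0.
Qed.

(** If v0 has edges to two different vertices y and z, these two edges are
replaced by an edge from y to z; if v0 has a half-edge and an edge, they are
lifted by [adm_half]; otherwise v0 can be removed.  None of this hurts a set
with slack. *)
Lemma solve_zero W es h g b v0 : solvable_below_card m W -> solvable_below_size m W es ->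
  admissible W es h g b [set v0] -> (1 < #|W|)%N -> slack m W es h g b ->
  solvable W es b.
Proof.
move=> IHW IHE G W1 sl; have [v0W c0] := adm_zero G.
case: (boolP (has (crosses [set v0]) es)) => [/hasP[e ees ce]|/hasPn nc]; last first.
  have [y /andP[yv0 yW]] : exists y, (y != v0) && (y \in W).
    have /card_gt1P[x [y [xW yW xy]]] := W1.
    case: (eqVneq x v0) xy => [->|xv0 _]; last by exists x; rewrite xv0.
    by exists y; rewrite eq_sym; apply/andP.
  apply: (remove_zero IHW G _ yv0); last by move=> e /nc /negbTE ->.
  have := adm_cut G (subsetDl W [set v0]); rewrite -/(W :\ v0).
  have -> : cross_num es (W :\ v0) = 0.
    apply: cross_num0 => e ees; have := nc e ees; have := allP (adm_in G) _ ees.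
    by rewrite /inside /crosses !inE => /andP[-> ->]; rewrite !andbT; do 2 case: (_ == v0).
  have split1 f : fsum f W = f v0 + fsum f (W :\ v0) by rewrite /fsum (big_setD1 v0).
  have := adm_tot G; rewrite !split1 /fadd.
  rewrite -/(fadd b g); have h1 := mdistD m2 (b v0 + g v0) (fsum (fadd b g) (W :\ v0)).
  have [h2 _] := adm_g G v0W.
  move=> h3 /(_ _ _ _); have -> : W :\ v0 != set0 by apply/set0Pn; exists y; rewrite !inE yv0.
  have -> : W :\ v0 != W by apply: contraTneq v0W => <-; rewrite !inE eqxx.
  have -> : W :\ v0 != [set v0].
    by apply: contraTneq (set11 v0) => <-; rewrite !inE eqxx.
  move=> /(_ isT isT isT); move: h1; rewrite c0; lia.
have [y [es1 [yv0 _ E]]] := pick_edge ees ce.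
apply: (solvable_eqv E); have G1 := adm_eqv E G; case: (E) => _ bdE szE _.
have sl1 : slack m W ((v0, y) :: es1) h g b by move=> A *; rewrite -bdE; apply: sl.
have [hg hgp] := adm_g G v0W.
case: (ltrP 0 (h v0)) => hv0; last first.
  have h0 : h v0 = 0 by lia.
  case: (boolP (has (fun e => crosses [set v0] e && ~~ inside [set v0; y] e) es1)).
    case/hasP => e' e'es /andP[ce' ne'].
    have [z [es2 [zv0 ie E2]]] := pick_edge e'es ce'.
    have zy : z != y by apply: contraNneq ne' => <-.
    have E3 := eqv_cons (v0, y) E2.
    apply: (solvable_eqv E3); have {G1} G1 := adm_eqv E3 G1.
    have {}sl1 : slack m W [:: (v0, y), (v0, z) & es2] h g b.
      by case: (E3) => _ bdE3 _ _ A *; rewrite -bdE3; apply: sl1.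
    have [f [nf fb]] : solvable W ((y, z) :: es2) b.
      apply: (IHE _ h g b [set v0]).
        by case: E3; rewrite szE => _ _ -> _.
      have := adm_in G1; rewrite /= {1 2}/inside /= => /and3P[/andP[_ yW] /andP[_ zW] al].
      split=> //; try by case: G1.
      - by rewrite /= /inside /= yW zW.
      - move=> v vW; have := adm_b G1 vW; rewrite !cross_num_cons /crosses !inE /= ![_ == v]eq_sym.
        move: (cross_num es2 _) (b v) => c d; clear.
        by case: (v == v0); case: (v == y); case: (v == z) => /=; lia.
      move=> A AW A0 AT AZ; have := adm_cut G1 AW A0 AT AZ.
      case: (set_cases AW A0 AT) => [[x xW Ax]|/(sl1 A AW)].
        have vx : x != v0 by apply: contraNneq AZ => <-; rewrite Ax.
        rewrite Ax !cross_num_cons /crosses /= !inE [v0 == x]eq_sym (negbTE vx).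
        case: (eqVneq y x) => [yx|_]; last by clear; lia.
        by rewrite -yx (negbTE zy); clear; lia.
      rewrite fsumD !cross_num_cons /crosses /=.
      move: (mdist _) (cross_num es2 A) (fsum h A) => c1 c2 c3; clear.
      by case: (v0 \in A); case: (y \in A); case: (z \in A) => /=; lia.
    exists f; split=> //; case: nf => f1 [nf1 [] hf].
      exists (fun v => f1 v + arc_net (v0, z) v); split; first by exists f1; split=> //; left.
      by right => v; rewrite hf /arc_net /=; ring.
    exists (fun v => f1 v - arc_net (v0, z) v); split; first by exists f1; split=> //; right.
    by left => v; rewrite hf /arc_net /=; ring.
  move/hasPn => hn; apply: (remove_zero IHW G1 h0 yv0) => e'.
  rewrite inE => /orP[/eqP -> _|/hn]; first by rewrite /inside !inE !eqxx orbT.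
  by move=> + ce'; rewrite ce' /= negbK.
have yW : y \in W by have := adm_in G1; rewrite /= /inside /= => /andP[/andP[]].
have [s [s1 gs]] : exists s, (s = 1 \/ s = -1) /\ `|g v0 + s| <= h v0 - 1.
  case: (ltrP (g v0) (h v0)) => hgl; [exists 1 | exists (-1)]; split; lia.
apply: (solvable_half m2 yv0 v0W s1 gs).
apply: IHE (adm_half m2 yv0 G1 v0W sl1 s1 gs).
by rewrite szE.
Qed.

End SolveZero.

(** * No vertex of charge zero *)

Section SolveNonzero.
Import GRing.Theory Num.Theory Order.TTheory.
Local Open Scope ring_scope.
Variables (V : finType) (m : int).
Hypothesis m2 : 2 <= m.
Implicit Types (es : seq (V * V)) (f g h b : V -> int) (A W Z : {set V}).
Local Notation cong := (cong m).
Local Notation mdist := (mdist m).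
Local Notation admissible := (admissible m).
Local Notation solvable := (solvable m).

(** All edges that are not loops at v have v as an end, so each can be given
either sign. *)
Lemma net_star es v t : (forall e, e \in es -> ~~ crosses [set v] e -> e.1 = e.2) ->
  `|t| <= cross_num es [set v] -> (2 %| cross_num es [set v] - t)%Z ->
  exists f, net es f /\ f v = t.
Proof.
elim: es t => [|e es IH] t hl ht pt.
  by exists (fun=> 0); split=> //; move: ht; rewrite /cross_num /=; lia.
have {}IH t' := IH t' (fun e' e'es => hl e' (mem_behead (s := e :: es) e'es)).
have := hl e (mem_head _ _); rewrite cross_num_cons in ht pt.
case: (boolP (crosses [set v] e)) ht pt => [ce|ne] ht pt; last first.
  move=> /(_ isT) e12; have [||f [nf ft]] := IH t; try lia.
  by exists f; split=> //; exists f; split=> //; left => u; rewrite /arc_net e12 subrr addr0.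
have bdge : 0 <= cross_num es [set v] by [].
move=> _; have dve : arc_net e v = 1 \/ arc_net e v = -1.
  by move: ce; rewrite /crosses /arc_net !inE ![v == _]eq_sym; case: (_ == v); case: (_ == v) => //= _; solve [by left | by right].
case: (lerP 1 t) => t0.
  have [||f [nf ft]] := IH (t - 1); try lia.
  case: dve => de.
    by exists (fun u => f u + arc_net e u); split; [exists f; split=> //; left | lia].
  by exists (fun u => f u - arc_net e u); split; [exists f; split=> //; right | lia].
have [||f [nf ft]] := IH (t + 1); try lia.
case: dve => de.
  by exists (fun u => f u - arc_net e u); split; [exists f; split=> //; right | lia].
by exists (fun u => f u + arc_net e u); split; [exists f; split=> //; left | lia].
Qed.

Definition solvable_below_weight W es h := forall h' g' b' Z, fsum h' W < fsum h W ->
  admissible W es h' g' b' Z -> solvable W es b'.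

Lemma has_edge W es h g b x : admissible W es h g b set0 -> (1 < #|W|)%N -> x \in W ->
  exists2 e, e \in es & crosses [set x] e.
Proof.
move=> G W1 xW; case: (boolP (has (crosses [set x]) es)) => [/hasP //|/hasPn nc].
exfalso; apply: (no_isolated_part m2 G (A := [set x])); last exact: cross_num0.
- by rewrite sub1set.
- by apply/set0Pn; exists x; rewrite inE.
- by apply: contraTneq W1 => <-; rewrite cards1.
- by apply/set0Pn; exists x; rewrite inE.
rewrite setD_eq0; apply: contraL W1 => /subset_leq_card; by rewrite cards1 -leqNgt.
Qed.

Lemma solvable_delete W es b x y : x != y ->
  solvable W es (fadd b (fadd (point_fun x (-1)) (point_fun y 1))) -> solvable W ((x, y) :: es) b.
Proof.
move=> xy; have yx : (y == x) = false by rewrite eq_sym; apply: negbTE.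
case=> f' [nf f'b]; exists (fun v => f' v + arc_net (x, y) v); split.
  by exists f'; split=> //; left.
move=> v vW; have := f'b v vW; rewrite /cong /fadd /point_fun /arc_net /=.
congr (_ %| _)%Z; case: (eqVneq v x) => [->|_]; rewrite ?(negbTE xy); first by lia.
by case: (eqVneq v y) => [->|_]; lia.
Qed.

(** Orienting the edge from x to y decreases the charge of x and increases that
of y.  The cut conditions can break only for [set x] and [set y], as larger
sets have slack. *)
Lemma adm_delete W es h g b x y : x != y ->
  admissible W ((x, y) :: es) h g b set0 -> slack m W ((x, y) :: es) h g b ->
  2 * m - 2 + mdist (b x + g x - 1) <= cross_num ((x, y) :: es) [set x] + h x - 1 ->
  2 * m - 2 + mdist (b y + g y + 1) <= cross_num ((x, y) :: es) [set y] + h y - 1 ->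
  admissible W es h g (fadd b (fadd (point_fun x (-1)) (point_fun y 1))) set0.
Proof.
move=> xy G sl hx hy; have yx : (y == x) = false by rewrite eq_sym; apply: negbTE.
have [xW yW] : x \in W /\ y \in W by have := adm_in G; rewrite /= /inside /= => /andP[/andP[]].
have sb A : fsum (fadd b (fadd (point_fun x (-1)) (point_fun y 1))) A =
    fsum b A - (if x \in A then 1 else 0) + (if y \in A then 1 else 0).
  by rewrite !fsumD !fsum_upd; do 2 case: (_ \in A); lia.
have sbW : fsum (fadd b (fadd (point_fun x (-1)) (point_fun y 1))) W = fsum b W.
  by rewrite sb xW yW; lia.
split.
- by have := adm_in G => /= /andP[].
- exact: (adm_g G).
- move=> v vW; have := adm_b G vW; rewrite cross_num_cons /crosses !inE ![_ == v]eq_sym /fadd /point_fun.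
  case: (eqVneq v x) => [->|_]; rewrite ?(negbTE xy) /=; first by lia.
  by case: (eqVneq v y) => [->|_] /=; lia.
- by rewrite sbW; apply: (adm_sum G).
- by left.
- by rewrite fsumD sbW -fsumD; apply: (adm_tot G).
move=> A AW A0 AT _; rewrite fsumD sb.
case: (set_cases AW A0 AT) => [[z zW Az]|/(sl A AW)].
  rewrite Az !fsum1 !inE; case: (eqVneq x z) => [<-|xz].
    move: hx; rewrite cross_num_cons /crosses !inE eqxx yx /= => hx.
    by rewrite (_ : b x - _ + _ + g x = b x + g x - 1); lia.
  case: (eqVneq y z) => [<-|yz].
    move: hy; rewrite cross_num_cons /crosses !inE eqxx (negbTE xy) /= => hy.
    by rewrite (_ : b y - _ + _ + g y = b y + g y + 1); lia.
  have := adm_cut G AW A0 AT A0; rewrite Az fsumD !fsum1 cross_num_cons /crosses !inE (negbTE xz) (negbTE yz).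
  by rewrite subr0 addr0; lia.
rewrite cross_num_cons /crosses /=; set c := fsum b A + fsum g A.
have n1 := mdist_step m2 c; have n2 := mdist_stepN m2 c.
have cE (i j : int) : fsum b A - i + j + fsum g A = c - i + j by rewrite /c; ring.
rewrite cE; case: (x \in A); case: (y \in A) => /= h1.
- by rewrite subrK; clear -h1; lia.
- by rewrite addr0; clear -h1 n2; case: n2 => ->; lia.
- by rewrite subr0; clear -h1 n1; case: n1 => ->; lia.
by rewrite subr0 addr0; clear -h1; lia.
Qed.

(** What is left if no edge can be removed by [adm_delete]: the cut condition
of every vertex is tight, and increasing its charge by 1 moves it away from
the multiples of 2m. *)
Definition tight W es h g b := forall v, v \in W ->
  [/\ cross_num es [set v] + h v = 2 * m - 2 + mdist (b v + g v),
      mdist (b v + g v + 1) = mdist (b v + g v) + 1,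
      mdist (b v + g v - 1) = mdist (b v + g v) - 1 & 0 < mdist (b v + g v)].

(** The vertex x has at least 2m - 2 edges and thus enough of them to attain
the residue of b x.  After their orientation the rest of W is handled by
[solve_inside], since its cut is that of x. *)
Lemma solve_tight_h0 W es h g b : solvable_below_card m W -> admissible W es h g b set0 -> (1 < #|W|)%N ->
  tight W es h g b -> fsum h W = 0 -> solvable W es b.
Proof.
move=> IH G W1 T hW.
have [x xW] : exists x, x \in W by apply/set0Pn; rewrite -card_gt0; exact: ltnW.
have h0 v : v \in W -> h v = 0.
  move=> vW; have : h v <= fsum h W.
    rewrite /fsum (bigD1 v) //= lerDl; apply: sumr_ge0 => u /andP[uW _].
    by have [] := adm_g G uW; lia.
  by have [] := adm_g G vW; lia.
have g0 v : v \in W -> g v = 0.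
  by move=> vW; have [] := adm_g G vW; have := h0 v vW; lia.
have [Tx _ _ c0] := T x xW; rewrite g0 // addr0 in Tx c0; rewrite h0 // addr0 in Tx.
pose A := W :\ x; have AW : A \subset W by apply: subD1set.
have WE : x |: A = W by rewrite setD1K.
have xA : x \notin A by rewrite !inE eqxx.
pose es1 := [seq e <- es | inside A e]; pose es2 := [seq e <- es | ~~ inside A e].
have p : perm_eq (es1 ++ es2) es by rewrite perm_filterC.
have bdx : cross_num es2 [set x] = cross_num es [set x].
  rewrite -(cross_num_perm _ p) cross_num_cat [cross_num es1 _]cross_num0 ?add0r // => e.
  rewrite mem_filter /inside /crosses !inE => /andP[/andP[]].
  by do 2 case: (_ == x).
have [q [qb qe]] := mdist_ex m2 (b x).
have bpar := adm_b G xW.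
have [t [tb ct]] : exists t, `|t| = mdist (b x) /\ cong t (b x).
  case: qe => qe; [exists (mdist (b x)) | exists (- mdist (b x))]; split; try lia;
  by apply/cong_sym/congP; exists q; lia.
have tp := cong_par ct.
have [|||fr [nfr frx]] := @net_star es2 x t; try by (rewrite ?bdx; lia).
  move=> e; rewrite mem_filter => /andP[h1 ees]; move: h1; have := allP (adm_in G) _ ees.
  rewrite /inside /crosses !inE => /andP[-> ->]; rewrite !andbT.
  by case: (eqVneq e.1 x) => [->|]; case: (eqVneq e.2 x) => [->|].
have split1 f : fsum f W = f x + fsum f A by rewrite -WE /fsum big_setU1.
have sfr : fsum fr W = 0.
  have [h1 _] := net_cross_num W nfr; move: h1; rewrite -/(fsum fr W) [cross_num _ _]cross_num0; first lia.
  move=> e; rewrite mem_filter => /andP[_ ees]; have := allP (adm_in G) _ ees.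
  by rewrite /inside /crosses => /andP[-> ->].
have cbA : cong (fsum b A) (- b x).
  have := adm_sum G; rewrite -/(fsum b W) split1 => h1.
  by have := congB h1 (cong_refl m (b x)); rewrite sub0r addrC addKr.
have sgA : fsum g A = 0 by rewrite /fsum big1 // => v vA; apply: g0; apply: (subsetP AW).
have shA : fsum h A = 0 by rewrite /fsum big1 // => v vA; apply: h0; apply: (subsetP AW).
apply: (solve_inside m2 IH G AW _ _ nfr).
- by rewrite (cardsD1 x W) xW.
- rewrite shA addr0 fsumD sgA addr0 (mdist_cong m2 cbA) mdistN //.
  rewrite -Tx; suff -> : cross_num es A = cross_num es [set x] by [].
  congr Posz; apply: eq_in_count => e /(allP (adm_in G)).
  rewrite /inside /crosses !inE => /andP[-> ->]; rewrite !andbT.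
  by do 2 case: (_ == x).
- have := split1 fr; rewrite sfr frx => h1.
  have -> : fsum fr A = - t by lia.
  exact: cong_trans (congN ct) (cong_sym cbA).
move=> v vW; rewrite !inE vW andbT negbK => /eqP ->; by rewrite frx.
Qed.

(** A half-edge leaving x is dropped; the cut condition of [set x] allows it
because the charge of x moves towards the multiples of 2m. *)
Lemma solve_tight_dec W es h g b x : solvable_below_weight W es h -> admissible W es h g b set0 ->
  slack m W es h g b -> tight W es h g b -> x \in W -> - h x < g x -> solvable W es b.
Proof.
move=> IH G sl T xW gx; have [Tx _ c1 c0] := T x xW.
have [hg hgp] := adm_g G xW.
apply: (IH (fadd h (point_fun x (-1))) (fadd g (point_fun x (-1))) b set0).
  by rewrite fsumD fsum_upd xW; lia.
split; try by case: G.
- move=> v vW; have := adm_g G vW; rewrite /fadd /point_fun.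
  by case: (eqVneq v x) => [->|_]; lia.
- by left.
- have := adm_tot G; rewrite !fsumD !fsum_upd xW => h1; rewrite addrA.
  by case: (mdist_stepN m2 (fsum b W + fsum g W)) => ->; clear -h1; lia.
move=> A AW A0 AT _; rewrite !fsumD !fsum_upd; case: ifP => xA; last first.
  by have := adm_cut G AW A0 AT A0; rewrite fsumD !addr0.
rewrite !addrA; case: (set_cases AW A0 AT) => [[z zW Az]|/(sl A AW)].
  by move: xA; rewrite Az inE => /eqP xz; rewrite !fsum1 -xz c1 Tx; clear; lia.
by move=> h1; case: (mdist_stepN m2 (fsum b A + fsum g A)) => ->; clear -h1; lia.
Qed.

(** All half-edges enter their vertices.  Some edge between x and y is
oriented towards x, and the net degree of the half-edges at x is raised by m,
at the cost of m - 2 more half-edges.  As adding m turns [mdist] into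
m - [mdist], the sets containing x need a cut of size 2m - 2 + m - [mdist]
now, while they have gained m - 2; this is enough because they had slack, and
for [set x] because its charge was not 0. *)
Lemma solve_tight_flip W es h g b x : solvable_below_size m W es -> admissible W es h g b set0 -> (1 < #|W|)%N ->
  slack m W es h g b -> tight W es h g b -> (forall v, v \in W -> g v = - h v) ->
  x \in W -> 0 < h x -> solvable W es b.
Proof.
move=> IH G W1 sl T gh xW hx; have [Tx cx1 _ cx0] := T x xW.
have [e ees ce] := has_edge G W1 xW.
have [y [es1 [yx _ E0]]] := pick_edge ees ce.
have E := eqv_trans E0 (eqv_swap x y es1).
apply: (solvable_eqv E); have {}G := adm_eqv E G; case: (E) => _ bdE szE _.
have {}sl : slack m W ((y, x) :: es1) h g b by move=> A *; rewrite -bdE; apply: sl.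
have yW : y \in W by have := adm_in G; rewrite /= /inside /= => /andP[/andP[]].
have [Ty _ cy1 cy0] := T y yW.
have xy : (x == y) = false by rewrite eq_sym; apply: negbTE.
apply: solvable_delete => //.
set b' := fadd b _; pose h' := fadd h (point_fun x (m - 2)); pose g' := fadd g (point_fun x m).
apply: (IH _ h' g' b' set0); first by rewrite szE.
have sb A : fsum b' A = fsum b A + (if x \in A then 1 else 0) - (if y \in A then 1 else 0).
  by rewrite /b' !fsumD !fsum_upd; do 2 case: (_ \in A); lia.
have sbW : fsum b' W = fsum b W by rewrite sb xW yW; lia.
have sgW : fsum g W = - fsum h W by rewrite /fsum -sumrN; apply: eq_bigr => v /gh.
split.
- by have := adm_in G => /= /andP[].
- move=> v vW; have [] := adm_g G vW; rewrite /h' /g' /fadd /point_fun.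
  by case: (eqVneq v x) => [->|_]; have := gh v vW; rewrite ?gh //; lia.
- move=> v vW; have := adm_b G vW; rewrite cross_num_cons /crosses !inE ![_ == v]eq_sym /b' /fadd /point_fun.
  case: (eqVneq v y) => [->|_]; rewrite ?(negbTE yx) /=; first by lia.
  by case: (eqVneq v x) => [->|_] /=; lia.
- by rewrite sbW; apply: (adm_sum G).
- by left.
- rewrite fsumD sbW /g' /h' !fsumD !fsum_upd xW [fsum b W + _]addrA mdist_shift //.
  (* the total charge is minus the number n of half-edges, and n + mdist n is
     at most 2m because n <= 2m - 2 + mdist n *)
  have cW : cong (fsum b W + fsum g W) (- fsum h W).
    by have := congD (adm_sum G) (cong_refl m (fsum g W)); rewrite add0r sgW.
  have := adm_tot G; rewrite fsumD (mdist_cong m2 cW) mdistN //.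
  have := mdist_abs m2 (fsum h W); have := mdist_le m2 (fsum h W) 1.
  have : 0 <= fsum h W by apply: sumr_ge0 => v vW; have [] := adm_g G vW; lia.
  lia.
move=> A AW A0 AT _; rewrite fsumD sb /g' /h' !fsumD !fsum_upd.
case: (set_cases AW A0 AT) => [[z zW Az]|/(sl A AW)].
  rewrite Az !fsum1 !inE; case: (eqVneq x z) => [xz|xz].
    rewrite -xz (negbTE yx).
    have -> : b x + 1 - 0 + (g x + m) = b x + g x + 1 + m by clear; ring.
    rewrite mdist_shift // cx1; move: Tx; rewrite bdE cross_num_cons /crosses !inE eqxx (negbTE yx) /=.
    by clear -cx0; lia.
  case: (eqVneq y z) => [yz|yz].
    rewrite -yz; have -> : b y + 0 - 1 + (g y + 0) = b y + g y - 1 by clear; ring.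
    rewrite cy1; move: Ty; rewrite bdE cross_num_cons /crosses !inE eqxx xy /=; clear; lia.
  have := adm_cut G AW A0 AT A0; rewrite Az fsumD !fsum1 cross_num_cons /crosses !inE (negbTE xz) (negbTE yz).
  by rewrite !(subr0, addr0); clear; lia.
rewrite cross_num_cons /crosses /=; set c := fsum b A + fsum g A.
have nb := mdist_bound m2 c; have nb1 := mdist_bound m2 (c + 1).
have n1 := mdist_step m2 c; have n2 := mdist_stepN m2 c.
have cE (i j k : int) : fsum b A + i - j + (fsum g A + k) = c + (i - j + k) by rewrite /c; ring.
rewrite cE; case: (x \in A); case: (y \in A) => /= h1.
- rewrite subrr add0r mdist_shift //; clear -h1 nb; lia.
- rewrite subr0 addrA mdist_shift //; clear -h1 n1 nb nb1; move: nb1; case: n1 => ->; lia.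
- rewrite sub0r addr0 addr0; clear -h1 n2; case: n2 => ->; lia.
by rewrite subr0 !addr0; clear -h1; lia.
Qed.

Lemma solve_tight W es h g b : solvable_below_card m W -> solvable_below_size m W es -> solvable_below_weight W es h ->
  admissible W es h g b set0 -> (1 < #|W|)%N -> slack m W es h g b ->
  tight W es h g b -> solvable W es b.
Proof.
move=> IHW IHE IHH G W1 sl T.
have hge v : v \in W -> 0 <= h v by move=> vW; have [] := adm_g G vW; lia.
case: (boolP [exists x in W, - h x < g x]) => [/exists_inP[x xW]|/exists_inPn gh].
  exact: (solve_tight_dec IHH G sl T xW).
case: (boolP [exists x in W, 0 < h x]) => [/exists_inP[x xW hx]|/exists_inPn h0].
  apply: (solve_tight_flip IHE G W1 sl T _ xW hx) => v vW.
  by have := gh v vW; have [] := adm_g G vW; lia.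
apply: (solve_tight_h0 IHW G W1 T); rewrite /fsum big1 // => v vW.
by have := h0 v vW; have := hge v vW; lia.
Qed.

Lemma other_end W e v y : crosses [set v] e -> inside [set v; y] e -> y != v ->
  inside W e -> y \in W /\ crosses [set y] e.
Proof.
rewrite /crosses /inside !inE => + + yv; have vy : (v == y) = false.
  by rewrite eq_sym; apply: negbTE.
case: (eqVneq e.1 v) => [->|] /=; case: (eqVneq e.2 v) => [->|] //=.
  by move=> _ _ /eqP -> /andP[_ ->]; rewrite vy eqxx.
by move=> _ _; rewrite andbT => /eqP -> /andP[-> _]; rewrite vy eqxx.
Qed.

Definition fopp f v : int := - f v.

Lemma fsum_opp f A : fsum (fopp f) A = - fsum f A.
Proof. by rewrite /fsum sumrN. Qed.

Lemma adm_opp W es h g b Z : admissible W es h g b Z -> admissible W es h (fopp g) (fopp b) Z.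
Proof.
move=> G; have sE A : mdist (fsum (fadd (fopp b) (fopp g)) A) = mdist (fsum (fadd b g) A).
  by rewrite fsumD !fsum_opp -opprD mdistN // -fsumD.
split.
- exact: (adm_in G).
- by move=> v vW; rewrite /fopp; have := adm_g G vW; lia.
- by move=> v vW; rewrite /fopp; have := adm_b G vW; lia.
- by rewrite fsum_opp; have := congN (adm_sum G); rewrite oppr0.
- case: (adm_Z G) => [->|[v [vW -> cv]]]; first by left.
  by right; exists v; rewrite /fopp -opprD mdistN.
- by rewrite sE; apply: (adm_tot G).
by move=> *; rewrite sE; apply: (adm_cut G).
Qed.

Lemma solvable_opp W es b : solvable W es (fopp b) -> solvable W es b.
Proof.
case=> f [nf fb]; exists (fun v => - f v); split; first exact: net_opp.
by move=> v /fb /congN; rewrite /fopp opprK.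
Qed.

Lemma slack_opp W es h g b : slack m W es h g b -> slack m W es h (fopp g) (fopp b).
Proof. by move=> sl A AW hA; rewrite !fsum_opp -opprD mdistN //; apply: sl. Qed.

(** Say that x can emit if its cut condition survives the loss of one edge
leaving x, and that it can absorb if it survives the loss of an edge entering
x.  Since no charge is 0, each vertex can do one of the two.  If an edge joins
a vertex that can emit to one that can absorb, [adm_delete] applies.
Otherwise no vertex can do both, and adjacent vertices are of the same kind;
by [no_isolated_part] all vertices are of the same kind.  Reversing all
orientations exchanges the two kinds, and [solve_tight] concludes. *)
Lemma solve_nonzero W es h g b : solvable_below_card m W -> solvable_below_size m W es -> solvable_below_weight W es h ->
  admissible W es h g b set0 -> (1 < #|W|)%N -> slack m W es h g b ->
  (forall v, v \in W -> mdist (b v + g v) != 0) -> solvable W es b.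
Proof.
move=> IHW IHE IHH G W1 sl nz.
pose emit v := 2 * m - 2 + mdist (b v + g v - 1) <= cross_num es [set v] + h v - 1.
pose absorb v := 2 * m - 2 + mdist (b v + g v + 1) <= cross_num es [set v] + h v - 1.
have cut1 v : v \in W -> 2 * m - 2 + mdist (b v + g v) <= cross_num es [set v] + h v.
  move=> vW; have := adm_cut G (A := [set v]); rewrite !fsum1; apply.
  - by rewrite sub1set.
  - by apply/set0Pn; exists v; rewrite inE.
  - by apply: contraTneq W1 => <-; rewrite cards1.
  - by apply/set0Pn; exists v; rewrite inE.
have par1 v : v \in W -> (2 %| cross_num es [set v] + h v - mdist (b v + g v))%Z.
  by move=> vW; have := adm_par m2 G (A := [set v]); rewrite !fsum1; apply; rewrite sub1set.
have ea v : v \in W -> emit v \/ absorb v.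
  move=> vW; rewrite /emit /absorb; have := mdist_dec m2 (nz v vW); have := cut1 v vW; lia.
have del x y e : e \in es -> crosses [set x] e -> inside [set x; y] e -> x != y ->
    emit x -> absorb y -> solvable W es b.
  move=> ees ce ie xy ex ay.
  have [z [es1 [zx ie' E]]] := pick_edge ees ce.
  have zy : z = y.
    move: ce ie ie'; rewrite /crosses /inside !inE.
    case: (eqVneq e.1 x) => [->|] /=; case: (eqVneq e.2 x) => [->|] //=.
      by move=> _ _ /eqP -> /eqP ->.
    by move=> _ _; rewrite !andbT => /eqP -> /eqP ->.
  rewrite {z ie' zx}zy in E.
  apply: (solvable_eqv E); have G1 := adm_eqv E G; case: (E) => _ bdE szE _.
  apply: solvable_delete => //; apply: (IHE _ h g _ set0); first by rewrite szE.
  apply: adm_delete => //; rewrite -?bdE //.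
  by move=> A *; rewrite -bdE; apply: sl.
case: (boolP [exists e in es, [exists x, [exists y,
   [&& crosses [set x] e, inside [set x; y] e, x != y, emit x & absorb y]]]]).
  case/exists_inP=> e ees /existsP[x /existsP[y /and5P[ce ie xy ex ay]]].
  exact: (del x y e).
move/exists_inPn => nodel0.
have nodel e x y : e \in es -> crosses [set x] e -> inside [set x; y] e -> x != y ->
    emit x -> absorb y -> False.
  move=> ees ce ie xy ex ay; have /existsPn/(_ x)/existsPn/(_ y) := nodel0 e ees.
  by rewrite ce ie xy ex ay.
pose P := [set v in W | emit v].
have PW : P \subset W by apply/subsetP => v; rewrite inE => /andP[].
have bdP : cross_num es P = 0.
  apply: cross_num0 => e ees; apply/negP => ce.
  have /andP[e1W e2W] := allP (adm_in G) _ ees.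
  have e12 : e.1 != e.2 by apply: contraTneq ce => e12; rewrite /crosses e12 eqxx.
  have e21 : (e.2 == e.1) = false by rewrite eq_sym; apply: negbTE.
  have c1 : crosses [set e.1] e by rewrite /crosses !inE eqxx e21.
  have c2 : crosses [set e.2] e by rewrite /crosses !inE eqxx (negbTE e12).
  move: ce; rewrite /crosses !inE e1W e2W /=.
  case: (boolP (emit e.1)) => ex; case: (boolP (emit e.2)) => ey // _.
    apply: (nodel e e.1 e.2) => //; first by rewrite /inside !inE !eqxx orbT.
    by case: (ea e.2 e2W) => //; rewrite (negbTE ey).
  apply: (nodel e e.2 e.1) => //; [by rewrite /inside !inE !eqxx orbT|by rewrite eq_sym|].
  by case: (ea e.1 e1W) => //; rewrite (negbTE ex).
have nea v : v \in W -> emit v -> absorb v -> False.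
  move=> vW ev av; have [e ees ce] := has_edge G W1 vW.
  have [y [es1 [yv ie _]]] := pick_edge ees ce.
  have [yW cy] := other_end ce ie yv (allP (adm_in G) _ ees).
  have vy : v != y by rewrite eq_sym.
  case: (ea y yW) => [ey|]; last exact: (nodel e v y).
  by apply: (nodel e y v) => //; rewrite setUC.
have [PE|PnW] := eqVneq P W.
  apply: (solve_tight IHW IHE IHH G W1 sl) => v vW.
  have ev : emit v by have := vW; rewrite -{1}PE inE vW.
  have na : ~ absorb v by exact: nea.
  move: (cut1 v vW) (par1 v vW) (nz v vW) na ev; rewrite /absorb /emit => h1 h2 h3 h4 h5.
  have h6 := mdist_step m2 (b v + g v); have h7 := mdist_stepN m2 (b v + g v).
  have h8 := mdist_dec m2 h3; have h9 := mdist_bound m2 (b v + g v).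
  move: (mdist (b v + g v)) (mdist (b v + g v + 1)) (mdist (b v + g v - 1)) (cross_num es _) (h v)
    h1 h2 h3 h4 h5 h6 h7 h8 h9 => c1 c2 c3 c4 c5; clear; split; lia.
have P0 : P = set0.
  case: (eqVneq P set0) => // P0; exfalso.
  apply: (no_isolated_part m2 G PW P0 PnW P0) bdP.
  rewrite setD_eq0; apply: contra PnW => WP; by rewrite eqEsubset PW.
have av v : v \in W -> absorb v /\ ~ emit v.
  move=> vW; have ne : ~ emit v.
    by move=> ev; have : v \in P; [rewrite inE vW | rewrite P0 inE].
  by case: (ea v vW).
apply: solvable_opp; apply: (solve_tight IHW IHE _ (adm_opp G) W1 (slack_opp sl)) => //.
move=> v vW; have [] := av v vW; rewrite /absorb /emit /fopp.
have -> : - b v + - g v = - (b v + g v) by ring.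
have -> : - (b v + g v) + 1 = - (b v + g v - 1) by ring.
have -> : - (b v + g v) - 1 = - (b v + g v + 1) by ring.
rewrite !mdistN // => h4 h5; move: (cut1 v vW) (par1 v vW) (nz v vW) => h1 h2 h3.
have h6 := mdist_step m2 (b v + g v); have h7 := mdist_stepN m2 (b v + g v).
have h8 := mdist_dec m2 h3; have h9 := mdist_bound m2 (b v + g v).
move: (mdist (b v + g v)) (mdist (b v + g v + 1)) (mdist (b v + g v - 1)) (cross_num es _) (h v)
  h1 h2 h3 h4 h5 h6 h7 h8 h9 => c1 c2 c3 c4 c5; clear; split; lia.
Qed.

End SolveNonzero.

(** * The orientation theorem *)

Section Main.
Import GRing.Theory Num.Theory Order.TTheory.
Local Open Scope ring_scope.
Variables (V : finType) (m : int).
Hypothesis m2 : 2 <= m.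
Implicit Types (es : seq (V * V)) (f g h b : V -> int) (A W Z : {set V}).
Local Notation cong := (cong m).
Local Notation mdist := (mdist m).
Local Notation admissible := (admissible m).
Local Notation solvable := (solvable m).

Lemma net_exists es : exists f, net es f.
Proof.
elim: es => [|e es [f nf]]; first by exists (fun=> 0).
by exists (fun v => f v + arc_net e v), f; split=> //; left.
Qed.

Lemma solve_small W es h g b Z : admissible W es h g b Z -> (#|W| <= 1)%N -> solvable W es b.
Proof.
move=> G W1; have [f nf] := net_exists es; exists f; split=> // v vW.
have WE : W = [set v].
  apply/eqP; rewrite eq_sym eqEcard sub1set vW cards1 //.
have [h1 _] := net_cross_num1 v nf; rewrite cross_num0 in h1; last first.
  move=> e /(allP (adm_in G)); rewrite /inside /crosses WE => /andP[-> ->] //.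
have -> : f v = 0 by clear -h1; lia.
by have := adm_sum G; rewrite WE fsum1 => /cong_sym.
Qed.

(** Induction on the size of W, then on the number of edges, then on the number
of half-edges. *)
Lemma mod_orientation W es h g b Z : admissible W es h g b Z -> solvable W es b.
Proof.
have [w] := ubnP #|W|; elim: w W es h g b Z => // w IHw W es h g b Z.
have [s] := ubnP (size es); elim: s es h g b Z => // s IHs es h g b Z.
have [k] := ubnP (absz (fsum h W)); elim: k h g b Z => // k IHk h g b Z.
rewrite !ltnS => hk hs hw G.
have IHW : solvable_below_card m W by move=> W' es' h' g' b' Z' lt; apply: IHw; apply: leq_trans lt _.
have IHE : solvable_below_size m W es.
  by move=> es' h' g' b' Z' lt; apply: IHs => //; apply: leq_trans lt _.
have h0 h' g' b' Z' : admissible W es h' g' b' Z' -> 0 <= fsum h' W.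
  by move=> G'; apply: sumr_ge0 => v vW; have [h1 _] := adm_g G' vW; clear -h1; lia.
have IHH : solvable_below_weight m W es h.
  move=> h' g' b' Z' lt G'; apply: (IHk h' g' b' Z') => //.
  have := h0 _ _ _ _ G; have := h0 _ _ _ _ G'; clear -lt hk; lia.
case: (leqP #|W| 1) => W1; first exact: solve_small G W1.
case: (boolP [exists A : {set V}, [&& A \subset W, (1 < #|A| < #|W|)%N &
    cross_num es A + fsum h A <= 2 * m - 2 + mdist (fsum (fadd b g) A)]]).
  case/existsP=> A /and3P[AW /andP[A1 A2] tA].
  exact: (solve_contract m2 IHW G AW A1 A2 tA).
move/existsPn => nt.
have sl : slack m W es h g b.
  move=> A AW /andP[A1 A2]; rewrite -fsumD; apply: (adm_slack m2 G AW).
  - by rewrite -card_gt0; apply: ltnW.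
  - by apply: contraTneq A2 => ->; rewrite ltnn.
  - by case: (adm_Z G) => [->|[v [_ -> _]]]; apply: contraTneq A1 => ->; rewrite ?cards0 ?cards1.
  by move=> tA; have := nt A; rewrite AW A1 A2 tA.
case: (adm_Z G) => [Z0|[v [_ Zv _]]]; last first.
  by rewrite Zv in G; apply: (solve_zero m2 IHW IHE G W1 sl).
rewrite {}Z0 in G.
case: (boolP [exists v in W, mdist (b v + g v) == 0]) => [/exists_inP[v vW /eqP v0]|/exists_inPn nz].
  have G' : admissible W es h g b [set v].
    split; try by case: G.
      by right; exists v.
    move=> A AW A0 AT _; exact: (adm_cut G).
  exact: (solve_zero m2 IHW IHE G' W1 sl).
exact: (solve_nonzero m2 IHW IHE IHH G W1 sl nz).
Qed.

End Main.

(** * Toggling and parity *)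

Definition symdiff (T : finType) (S S' : {set T}) := (S :\: S') :|: (S' :\: S).

Lemma odd_symdiff (T : finType) (S S' : {set T}) (P : pred T) :
  odd #|[set x in symdiff S S' | P x]| =
  odd #|[set x in S | P x]| (+) odd #|[set x in S' | P x]|.
Proof.
pose A := [set x in S | P x]; pose B := [set x in S' | P x]; rewrite -/A -/B.
have -> : [set x in symdiff S S' | P x] = (A :\: B) :|: (B :\: A).
  by apply/setP => x; rewrite !inE; case: (x \in S); case: (x \in S'); case: (P x).
rewrite cardsU (_ : _ :&: _ = set0) ?cards0 ?subn0; last first.
  by apply/setP => x; rewrite !inE; case: (x \in S); case: (x \in S'); case: (P x).
rewrite -(cardsID B A) -(cardsID A B) setIC !oddD.
by do 3 case: (odd _).
Qed.

Section Toggle.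
Variables (V E : finType) (p q : E -> V).
Implicit Types (S Y : {set E}) (O : {set V}).

Definition tpar S v := odd #|[set e in S | p e == v]| (+) odd #|[set e in S | q e == v]|.
Definition toggle_rel Y : rel V := [rel x y | [exists e in Y,
  ((p e == x) && (q e == y)) || ((p e == y) && (q e == x))]].

Lemma tpar_symdiff S S' v : tpar (symdiff S S') v = tpar S v (+) tpar S' v.
Proof. by rewrite /tpar !odd_symdiff; do 4 case: (odd _). Qed.

Lemma tpar0 v : tpar set0 v = false.
Proof. by rewrite /tpar !eq_card0 // => e; rewrite !inE. Qed.

Lemma tpar1 e v : tpar [set e] v = (v == p e) (+) (v == q e).
Proof.
have h (r : E -> V) : odd #|[set x in [set e] | r x == v]| = (v == r e).
  case: (eqVneq v (r e)) => [->|ne].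
    by rewrite (_ : [set x in _ | _] = [set e]) ?cards1 //; apply/setP => x;
       rewrite !inE andb_idr // => /eqP ->.
  rewrite eq_card0 // => x; rewrite !inE; apply/negP => /andP[/eqP -> /eqP h].
  by rewrite h eqxx in ne.
by rewrite /tpar !h.
Qed.

Lemma symdiffS S S' Y : S \subset Y -> S' \subset Y -> symdiff S S' \subset Y.
Proof.
move=> /subsetP h /subsetP h'; apply/subsetP => x; rewrite !inE.
by case/orP=> /andP[_]; [exact: h | exact: h'].
Qed.

Lemma toggle_path Y x y : connect (toggle_rel Y) x y ->
  exists S, S \subset Y /\ forall v, tpar S v = (v == x) (+) (v == y).
Proof.
case/connectP=> s; elim: s x => [|z s IHs] x /= => [_ ->|].
  by exists set0; split; [exact: sub0set | move=> v; rewrite tpar0 addbb].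
case/andP=> /exists_inP[e eY he] /IHs h /h [S [SY hS]].
exists (symdiff [set e] S); split; first by rewrite symdiffS ?sub1set.
move=> v; rewrite tpar_symdiff tpar1 hS.
by case/orP: he => /andP[/eqP -> /eqP ->]; do 3 case: (v == _).
Qed.

(** The elements of O are grouped in pairs, and each pair is joined by a path
of toggles; symmetric differences add up parities. *)
Lemma toggle_parity Y O : (forall x y, x \in O -> y \in O -> connect (toggle_rel Y) x y) ->
  ~~ odd #|O| -> exists S, S \subset Y /\ forall v, tpar S v = (v \in O).
Proof.
have [n] := ubnP #|O|; elim: n O => // n IHn O; rewrite ltnS => hn hO.
case: (set_0Vmem O) => [->|[x xO]] oO.
  by exists set0; split; [exact: sub0set | move=> v; rewrite tpar0 inE].
have cx := cardsD1 x O; rewrite xO in cx.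
have [O0|[y]] := set_0Vmem (O :\ x); first by rewrite cx O0 cards0 in oO.
move=> yO; have cy := cardsD1 y (O :\ x); rewrite yO in cy.
have [|u v| |S [SY hS]] := IHn (O :\ x :\ y).
- by move: hn; rewrite cx cy !add1n => /ltnW.
- by move=> /setD1P[_ /setD1P[_ uO]] /setD1P[_ /setD1P[_ vO]]; apply: hO.
- by move: oO; rewrite cx cy /= negbK.
have [yx yO'] := setD1P yO.
have [S' [SY' hS']] := toggle_path (hO _ _ xO yO').
exists (symdiff S S'); split; first exact: symdiffS.
move=> v; rewrite tpar_symdiff hS hS' !inE.
case: (eqVneq v x) => [->|vx]; first by rewrite eq_sym (negbTE yx) xO.
by case: (eqVneq v y) => [->|vy] /=; rewrite ?yO' // addbF.
Qed.
End Toggle.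

Lemma exists_pairing (T L : finType) (l : T -> L) (Z : {set T}) :
  (forall a, ~~ odd #|[set e in Z | l e == a]|) ->
  exists s : {ffun T -> T}, forall e, e \in Z ->
    [/\ s e \in Z, l (s e) = l e, s (s e) = e & s e != e].
Proof.
have [n] := ubnP #|Z|; elim: n Z => // n IHn Z; rewrite ltnS => hn hZ.
case: (set_0Vmem Z) => [->|[x xZ]]; first by exists [ffun x => x] => e; rewrite inE.
pose Fx := [set e in Z | l e == l x].
have xF : x \in Fx by rewrite inE xZ eqxx.
have cx := cardsD1 x Fx; rewrite xF in cx.
have [O0|[y /setD1P[yx yF]]] := set_0Vmem (Fx :\ x).
  by have := hZ (l x); rewrite -/Fx cx O0 cards0.
have [yZ /eqP ly] : y \in Z /\ l y == l x by move: yF; rewrite inE => /andP[].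
have xy : x != y by rewrite eq_sym.
pose Z' := Z :\ x :\ y.
have [||s hs] := IHn Z'.
- apply: leq_trans hn; rewrite (cardsD1 x Z) xZ add1n ltnS.
  exact/subset_leq_card/subsetDl.
- move=> a; have := hZ a; case: (eqVneq a (l x)) => [->|ax].
    have -> : [set e in Z' | l e == l x] = Fx :\ x :\ y.
      by apply/setP => e; rewrite !inE -!andbA.
    rewrite -/Fx cx (cardsD1 y (Fx :\ x)) !inE yx yZ ly eqxx /= negbK //.
  have -> // : [set e in Z' | l e == a] = [set e in Z | l e == a].
  apply/setP => e; rewrite !inE; case: (eqVneq e y) => [->|_] /=.
    by rewrite ly eq_sym (negbTE ax) andbF.
  by case: (eqVneq e x) => [->|_] //=; rewrite eq_sym (negbTE ax) andbF.
exists [ffun e => if e == x then y else if e == y then x else s e] => e eZ.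
rewrite !ffunE; case: (eqVneq e x) => [->|ex].
  by rewrite (negbTE yx) eqxx.
case: (eqVneq e y) => [->|ey]; first by rewrite eqxx.
have [|sZ ls ss se] := hs e; first by rewrite !inE ex ey.
move: sZ; rewrite !inE => /and3P[sy sx sZ].
by rewrite (negbTE sy) (negbTE sx).
Qed.

(** * Pairings whose partners form a connected graph *)

Lemma even_involution (T : finType) (s : T -> T) (S : {set T}) :
  (forall x, x \in S -> [/\ s x \in S, s (s x) = x & s x != x]) -> ~~ odd #|S|.
Proof.
have [n] := ubnP #|S|; elim: n S => // n IHn S; rewrite ltnS => hn hS.
case: (set_0Vmem S) => [->|[x xS]]; first by rewrite cards0.
have [sxS ssx sx] := hS x xS.
rewrite (cardsD1 x) xS (cardsD1 (s x)) !inE sx sxS /= negbK; apply: IHn.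
  apply: leq_trans hn; rewrite (cardsD1 x S) xS add1n ltnS.
  exact/subset_leq_card/subsetDl.
move=> y; rewrite !inE => /and3P[yx yx' yS]; have [syS ssy sy] := hS y yS.
split=> //; rewrite syS andbT; apply/andP; split.
  by apply: contraNneq yx' => e; rewrite -ssy e ssx.
by apply: contraNneq yx => e; rewrite -ssy e.
Qed.

Section Pairing.
Variables (V : finType) (A : {set V}) (Z : {set V * V}).
Hypotheses (ZA : forall e, e \in Z -> e.1 \in A /\ e.2 \notin A).
Hypothesis Zsp : spanning Z.
Hypothesis Zodd2 : forall b, ~~ odd #|[set e in Z | e.2 == b]|.
Notation E := (V * V)%type.
Implicit Types (s : E -> E).

Definition pairing s := forall e, e \in Z ->
  [/\ s e \in Z, (s e).1 = e.1, s (s e) = e & s e != e].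

Definition pair_rel s : rel V := [rel x y | [exists e in Z, (e.2 == x) && ((s e).2 == y)]].

Lemma pair_rel_sym s : pairing s -> symmetric (pair_rel s).
Proof.
move=> ps; suff h x y : pair_rel s x y -> pair_rel s y x by move=> x y; apply/idP/idP; exact: h.
case/exists_inP=> e eZ /andP[/eqP ex /eqP ey].
have [sZ _ ss _] := ps e eZ.
by apply/exists_inP; exists (s e); rewrite // ss ex ey !eqxx.
Qed.

(** Otherwise s would act without fixed points on the edges of Z other than e
that end in C; but their number is odd. *)
Lemma no_bridge s e (C : {set V}) : pairing s -> e \in Z -> e.2 \in C ->
  (forall z, z \in Z -> z != e -> z != s e -> z.2 \in C -> (s z).2 \in C) ->
  (s e).2 \in C.
Proof.
move=> ps eZ eC hC; apply: contraT => sC.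
pose S := [set z in Z | z.2 \in C]; have eS : e \in S by rewrite inE eZ.
have oS : ~~ odd #|S|.
  rewrite /S -card_fibers_in; elim/big_rec: _ => // b n _.
  by rewrite oddD (negbTE (Zodd2 b)).
have : ~~ odd #|S :\ e|.
  apply: (@even_involution _ s) => z; rewrite !inE => /and3P[ze zZ zC].
  have [sZ _ ss sz] := ps z zZ.
  have zs : z != s e by apply: contraNneq sC => <-.
  rewrite sZ (hC z) //= andbT; split=> //; apply: contraNneq zs => <-; by rewrite ss.
by rewrite (cardsD1 e S) eS /= in oS; rewrite (negPn oS).
Qed.


(** Since Z connects x0 to y0, some edge of Z leaves the component of x0
together with the vertices of A adjacent to it. *)
Lemma mixed_vertex s x0 y0 : pairing s -> x0 \notin A -> y0 \notin A ->
  ~~ connect (pair_rel s) x0 y0 ->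
  exists e e', [/\ e \in Z, e' \in Z, e.1 = e'.1 & ~~ connect (pair_rel s) e.2 e'.2].
Proof.
move=> ps xA yA nxy; have cs := sym_connect_sym (pair_rel_sym ps).
pose X := [set b | connect (pair_rel s) x0 b].
pose W := [set v | if v \in A then [exists e in Z, (e.1 == v) && (e.2 \in X)] else v \in X].
case: (boolP [exists e in Z, (e.1 \in W) && (e.2 \notin X)]).
  case/exists_inP=> e eZ /andP[]; have [e1A e2A] := ZA eZ.
  rewrite inE e1A => /exists_inP[e' e'Z /andP[/eqP e1 e'X]] eX.
  exists e', e; split=> //; apply: contra eX => h.
  by move: e'X; rewrite !inE => h'; apply: connect_trans h' h.
move/exists_inPn=> hW; have cl : closed (erel Z) W.
  apply: intro_closed; first exact: connect_erel_sym.
  move=> u v; have cr e : e \in Z -> (e.1 \in W) = (e.2 \in W).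
    move=> eZ; have [e1A e2A] := ZA eZ; rewrite [RHS]inE (negbTE e2A).
    case: (boolP (e.2 \in X)) => eX.
      by rewrite inE e1A; apply/exists_inP; exists e; rewrite // eqxx.
    by have := hW e eZ; rewrite eX andbT => /negbTE.
  by case/orP => /cr /= ->.
have := closed_connect cl (Zsp x0 y0); rewrite !inE (negbTE xA) (negbTE yA) ?inE connect0.
by rewrite (negbTE nxy).
Qed.

(** The pairing s with the two pairs of e and e' exchanged: e is paired with e',
and the former partners with each other. *)
Definition cross s e e' (z : E) : E :=
  if z == e then e' else if z == e' then e else
  if z == s e then s e' else if z == s e' then s e else s z.

Section Cross.
Variables (s : E -> E) (e e' : E).
Hypotheses (ps : pairing s) (eZ : e \in Z) (e'Z : e' \in Z) (e1 : e.1 = e'.1).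
Hypothesis nee' : ~~ connect (pair_rel s) e.2 e'.2.

Let k1 (z : E) : z \in Z -> connect (pair_rel s) z.2 (s z).2.
Proof. by move=> zZ; apply: connect1; apply/exists_inP; exists z; rewrite ?eqxx. Qed.

Let cs : connect_sym (pair_rel s) := sym_connect_sym (pair_rel_sym ps).

Let ns (z z' : E) : connect (pair_rel s) e.2 z.2 -> connect (pair_rel s) e'.2 z'.2 -> z != z'.
Proof.
move=> h h'; apply: contraNneq nee' => zz; apply: connect_trans h _.
by rewrite cs zz.
Qed.

Let ee' : e != e'. Proof. by apply: ns. Qed.
Let ese' : e != s e'. Proof. by apply: ns => //; apply: k1. Qed.
Let see' : s e != e'. Proof. by apply: ns => //; apply: k1. Qed.
Let sese' : s e != s e'. Proof. by apply: ns; apply: k1. Qed.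
Let ese : e != s e. Proof. by rewrite eq_sym; have [] := ps eZ. Qed.
Let e'se' : e' != s e'. Proof. by rewrite eq_sym; have [] := ps e'Z. Qed.

Lemma cross_pairing : pairing (cross s e e').
Proof.
have [seZ s1 sse _] := ps eZ; have [se'Z s1' sse' _] := ps e'Z.
move=> z zZ; rewrite /cross.
case: (eqVneq z e) => [->|ze].
  by rewrite (negbTE (_ : e' != e)) ?eqxx 1?eq_sym.
case: (eqVneq z e') => [->|ze']; first by rewrite eqxx.
case: (eqVneq z (s e)) => [->|zse].
  rewrite s1 s1' e1; have -> : (s e' == e) = false by rewrite eq_sym; apply: negbTE.
  have -> : (s e' == e') = false by rewrite eq_sym; apply: negbTE.
  have n : (s e' == s e) = false by rewrite eq_sym; apply: negbTE.
  by rewrite n eqxx.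
case: (eqVneq z (s e')) => [->|zse'].
  rewrite s1 s1' e1; have -> : (s e == e) = false by rewrite eq_sym; apply: negbTE.
  by rewrite (negbTE see') eqxx.
have [szZ sz1 ssz sz] := ps zZ.
have h y : y \in Z -> z != s y -> s z != y.
  by move=> yZ; apply: contra_neq => <-; rewrite ssz.
rewrite (negbTE (h e eZ zse)) (negbTE (h e' e'Z zse')).
have h2 y : y \in Z -> z != y -> s z != s y.
  by move=> yZ; apply: contra_neq => szy; have [_ _ <- _] := ps yZ; rewrite -szy ssz.
by rewrite (negbTE (h2 e eZ ze)) (negbTE (h2 e' e'Z ze')).
Qed.

(** The two toggles that disappear are no bridges, because all degrees outside
A are even; they lie in different components, so losing both does not
matter. *)
Lemma cross_connect x y : connect (pair_rel s) x y -> connect (pair_rel (cross s e e')) x y.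
Proof.
have cp := cross_pairing; have cs' := sym_connect_sym (pair_rel_sym cp).
pose K0 := [rel x y | [exists z in Z, [&& z != e, z != s e, z != e', z != s e', z.2 == x & (s z).2 == y]]].
have K0K : subrel K0 (pair_rel s).
  by move=> u v /exists_inP[z zZ /and5P[_ _ _ _ h]]; apply/exists_inP; exists z.
have K0K' : subrel K0 (pair_rel (cross s e e')).
  move=> u v /exists_inP[z zZ /and5P[z1 z2 z3 z4 h]]; apply/exists_inP; exists z => //.
  by rewrite /cross (negbTE z1) (negbTE z2) (negbTE z3) (negbTE z4).
have key z z' : z \in Z -> z' \in Z -> ~~ connect (pair_rel s) z.2 z'.2 ->
    [set z; s z; z'; s z'] = [set e; s e; e'; s e'] -> connect (pair_rel (cross s e e')) z.2 (s z).2.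
  move=> zZ z'Z nzz' seteq.
  pose C := [set b | connect K0 z.2 b].
  have CK b : b \in C -> connect (pair_rel s) z.2 b.
    by rewrite inE; apply: connect_sub => u v /K0K/connect1.
  have z'C : z'.2 \notin C by apply: contra nzz' => /CK.
  have sz'C : (s z').2 \notin C.
    apply: contra nzz' => /CK h; apply: connect_trans h _; rewrite cs; exact: k1.
  suff : (s z).2 \in C by rewrite inE; apply: connect_sub => u v /K0K'/connect1.
  apply: (no_bridge ps zZ); first by rewrite inE.
  move=> u uZ uz usz; rewrite 2!inE => uC; apply: connect_trans (uC) (connect1 _).
  apply/exists_inP; exists u => //; rewrite !eqxx !andbT.
  have : u \notin [set z; s z; z'; s z'].
    rewrite !inE (negbTE uz) (negbTE usz) /=; apply/norP; split.
      by apply: contra z'C => /eqP <-; rewrite inE uC.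
    by apply: contra sz'C => /eqP <-; rewrite inE uC.
  by rewrite seteq !inE !negb_or -!andbA => /and4P[-> -> -> ->].
apply: connect_sub => {x y} x y /exists_inP[z zZ /andP[/eqP <- /eqP <-]].
have [_ _ sse _] := ps eZ; have [_ _ sse' _] := ps e'Z.
have h1 : connect (pair_rel (cross s e e')) e.2 (s e).2 by apply: (key e e').
have h2 : connect (pair_rel (cross s e e')) e'.2 (s e').2.
  apply: (key e' e) => //; first by rewrite cs.
  by apply/setP => u; rewrite !inE -!orbA orbCA; do 4 case: (u == _).
case: (eqVneq z e) => [->//|ze]; case: (eqVneq z e') => [->//|ze'].
case: (eqVneq z (s e)) => [->|zse]; first by rewrite sse cs'.
case: (eqVneq z (s e')) => [->|zse']; first by rewrite sse' cs'.
apply/connect1/K0K'/exists_inP; exists z => //.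
by rewrite ze ze' zse zse' !eqxx.
Qed.

Lemma cross_new : connect (pair_rel (cross s e e')) e.2 e'.2.
Proof. by apply/connect1/exists_inP; exists e; rewrite // /cross !eqxx. Qed.
End Cross.

(** A pairing with the largest number of connected pairs of vertices works:
otherwise [cross] at a vertex of A that touches two components would connect
them. *)
Lemma connected_pairing : (forall a, ~~ odd #|[set e in Z | e.1 == a]|) ->
  exists s, pairing s /\ forall x y, x \notin A -> y \notin A -> connect (pair_rel s) x y.
Proof.
case/exists_pairing=> s0 hs0.
have ps0 : pairing s0 by move=> e /hs0 [].
pose P (s : {ffun E -> E}) := [forall e in Z,
  [&& s e \in Z, (s e).1 == e.1, s (s e) == e & s e != e]].
have PP (s : {ffun E -> E}) : reflect (pairing s) (P s).
  apply: (iffP forall_inP) => h e eZ.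
    by have /and4P[a /eqP b /eqP c d] := h e eZ.
  by have [a b c d] := h e eZ; rewrite a b c d !eqxx.
pose N (s : {ffun E -> E}) := #|[set u : V * V | connect (pair_rel s) u.1 u.2]|.
case: (@arg_maxnP _ s0 P N); first exact/PP.
move=> s /PP ps smax; exists s; split=> // x y xA yA; apply: contraT => nxy.
have [e [e' [eZ e'Z e1 ne]]] := mixed_vertex ps xA yA nxy.
pose s' := [ffun z => cross s e e' z].
have s'E : s' =1 cross s e e' by move=> z; rewrite ffunE.
have kE : pair_rel s' =2 pair_rel (cross s e e').
  by move=> u v; apply: eq_existsb => z; rewrite s'E.
have ps' : pairing s'.
  by move=> z zZ; rewrite !s'E; apply: cross_pairing.
have /= := smax s' (introT (PP s') ps'); rewrite leqNgt => /negP; case.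
apply: proper_card; apply/properP; split.
  apply/subsetP => u; rewrite !inE => h; rewrite (eq_connect kE).
  exact: cross_connect.
exists (e.2, e'.2); rewrite inE //= (eq_connect kE); exact: cross_new.
Qed.

End Pairing.

(** * Fibers and Eulerian halves *)

Lemma leq_sum_eq (I : finType) (f g : I -> nat) :
  (forall i, f i <= g i) -> \sum_i g i <= \sum_i f i -> forall i, f i = g i.
Proof.
move=> h s i; apply/eqP; rewrite eqn_leq h /= leqNgt; apply: contraL s => lt.
rewrite -ltnNge [X in X < _](bigD1 i) //= [X in _ < X](bigD1 i) //= -addSn leq_add //.
by apply: leq_sum => j _.
Qed.

Section Fibers.
Variable E : finType.
Implicit Types X Y : {set E}.

Definition fib (W : eqType) (t : E -> W) X w := #|[set e in X | t e == w]|.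

Lemma fibD (W : eqType) (t : E -> W) X Y w : Y \subset X ->
  fib t X w = fib t Y w + fib t (X :\: Y) w.
Proof.
move=> /subsetP YX; rewrite /fib -(cardsID Y [set e in X | t e == w]); congr (_ + _);
  apply: eq_card => e; rewrite !inE; last by rewrite andbA.
by case: (boolP (e \in Y)) => [/YX ->|]; rewrite ?andbT ?andbF.
Qed.

Lemma fibS (W : eqType) (t : E -> W) X Y w : Y \subset X -> fib t Y w <= fib t X w.
Proof. by move=> YX; rewrite (fibD t w YX) leq_addr. Qed.

Lemma choose_sub (W : finType) (t : E -> W) X (n : W -> nat) :
  (forall w, n w <= fib t X w) ->
  exists Y, Y \subset X /\ forall w, fib t Y w = n w.
Proof.
move=> hn; have [|w|[]|Y [YX hY _]] := @fair_selection E W unit X t (fun=> tt) 1 n (fun=> #|X|).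
- by [].
- by rewrite mul1n; apply: hn.
- by rewrite mul1n; apply: subset_leq_card; apply/subsetP => e; rewrite inE => /andP[].
by exists Y.
Qed.

(** The edges of an Eulerian orientation that leave the left side.  Each edge
chooses its tail among its two ends, and no vertex is chosen by more than half
of its edges; then every vertex is chosen by exactly half of them. *)
Lemma euler_split (L R : finType) (l : E -> L) (r : E -> R) (F : {set E}) :
  (forall x, ~~ odd (fib l F x)) -> (forall y, ~~ odd (fib r F y)) ->
  exists U : {set E}, [/\ U \subset F, forall x, 2 * fib l U x = fib l F x &
    forall y, 2 * fib r U y = fib r F y].
Proof.
move=> el er.
pose FB := [set z : E * bool | z.1 \in F].
pose r' (z : E * bool) : L + R := if z.2 then inl (l z.1) else inr (r z.1).
pose cap (w : L + R) := (match w with inl x => fib l F x | inr y => fib r F y end)./2.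
have cardl x (S : {set E * bool}) :
    #|[set z in S | r' z == inl x]| = fib l [set e | (e, true) \in S] x.
  rewrite /fib -(card_imset _ (_ : injective (fun e : E => (e, true)))); last by move=> e1 e2 [].
  apply: eq_card => -[e b]; rewrite !inE /r' /=; apply/andP/imsetP.
    by case: b => [[eS /eqP[<-]]|[//]]; exists e; rewrite // !inE eS eqxx.
  by case=> e'; rewrite !inE => /andP[eS /eqP <-] [-> ->]; rewrite eS eqxx.
have cardr y (S : {set E * bool}) :
    #|[set z in S | r' z == inr y]| = fib r [set e | (e, false) \in S] y.
  rewrite /fib -(card_imset _ (_ : injective (fun e : E => (e, false)))); last by move=> e1 e2 [].
  apply: eq_card => -[e b]; rewrite !inE /r' /=; apply/andP/imsetP.
    by case: b => [[//]|[eS /eqP[<-]]]; exists e; rewrite // !inE eS eqxx.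
  by case=> e'; rewrite !inE => /andP[eS /eqP <-] [-> ->]; rewrite eS eqxx.
have FBe b : [set e | (e, b) \in FB] = F by apply/setP => e; rewrite !inE.
have [//|e|w|M [MF M1 M2]] := @fair_selection _ E _ FB fst r' 2 (fun e => e \in F) cap.
- case: (boolP (e \in F)) => eF; last by rewrite muln0.
  suff -> : [set z in FB | z.1 == e] = [set (e, true); (e, false)] by rewrite cards2 xpair_eqE andbF.
  apply/setP => -[e' []]; rewrite !inE /= !xpair_eqE; case: (eqVneq e' e) => [->|];
  by rewrite ?eF ?andbF.
- by rewrite /cap; case: w => [x|y]; rewrite ?cardl ?cardr mul2n FBe;
    rewrite -[X in X <= _]odd_double_half ?(negbTE (el x)) ?(negbTE (er y)).
pose U := [set e | (e, true) \in M].
have UF : U \subset F.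
  by apply/subsetP => e; rewrite inE => /(subsetP MF); rewrite inE.
have UC : [set e | (e, false) \in M] = F :\: U.
  apply/setP => e; rewrite !inE; have := M1 e.
  case: (boolP (e \in F)) => eF; last first.
    rewrite andbF => _; apply/negP => /(subsetP MF); rewrite inE /= (negbTE eF) //.
  rewrite andbT; case: (boolP ((e, true) \in M)) => t; case: (boolP ((e, false) \in M)) => f //= h.
    have : 1 < #|[set z in M | z.1 == e]|.
      by apply/card_gt1P; exists (e, true), (e, false); split; rewrite ?xpair_eqE ?andbF // inE ?t ?f /= eqxx.
    by rewrite h.
  have := h; suff -> : [set z in M | z.1 == e] = set0 by rewrite cards0.
  apply/setP => -[e' b]; rewrite !inE /=; apply/negP => /andP[+ /eqP ee].
  by rewrite ee; case: b; rewrite ?(negbTE t) ?(negbTE f).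
have Ul x : 2 * fib l U x <= fib l F x.
  have := M2 (inl x); rewrite cardl -/U /cap => h.
  by rewrite -[X in _ <= X]odd_double_half (negbTE (el x)) -mul2n leq_mul2l h.
have Ur y : fib r F y <= 2 * fib r U y.
  have := M2 (inr y); rewrite cardr UC /cap => h.
  have := fibD r y UF; have := odd_double_half (fib r F y); rewrite (negbTE (er y)) -muln2.
  by move: (_./2) h => c; clear; lia.
have sF (T : finType) (p : E -> T) (Y : {set E}) : \sum_w fib p Y w = #|Y|.
  exact: card_fibers.
have e1 : #|F| <= 2 * #|U| by rewrite -(sF _ r) -(sF _ r U) big_distrr leq_sum.
have e2 : 2 * #|U| <= #|F| by rewrite -(sF _ l) -(sF _ l F) big_distrr leq_sum.
exists U; split=> // w.
  by apply: (leq_sum_eq Ul); rewrite sF -big_distrr /= sF.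
by apply/esym/(leq_sum_eq Ur); rewrite sF -big_distrr /= sF.
Qed.
End Fibers.

(** * Splitting a balanced arc set into balanced classes *)

Lemma card_sum_set (T1 T2 : finType) (S : {set T1 + T2}) :
  #|S| = #|[set x | inl x \in S]| + #|[set y | inr y \in S]|.
Proof.
rewrite -(card_imset _ (@inl_inj T1 T2)) -(card_imset [set y | _] (@inr_inj T1 T2)).
rewrite -cardsUI; set I := _ :&: _; have -> : I = set0.
  by apply/setP=> x; rewrite !inE; apply/negP => /andP[/imsetP[e _ ->] /imsetP[] //].
rewrite cards0 addn0.
apply: eq_card => -[x|y]; rewrite inE; apply/idP/orP.
- by move=> xS; left; apply/imsetP; exists x; rewrite ?inE.
- by case=> /imsetP[z]; rewrite inE => zS // [->].
- by move=> yS; right; apply/imsetP; exists y; rewrite ?inE.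
by case=> /imsetP[z]; rewrite inE => zS // [->].
Qed.

Lemma card_ord_ltn n c : c <= n -> #|[set i : 'I_n | i < c]| = c.
Proof.
move=> cn; rewrite -[RHS]card_ord -(card_imset _ (_ : injective (widen_ord cn))).
  apply: eq_card => i; rewrite inE; apply/idP/imsetP => [ic|[j _ ->]]; last exact: (ltn_ord j).
  by exists (Ordinal ic) => //; apply: val_inj.
by move=> i j /(congr1 val) /= e; apply: val_inj.
Qed.

Section Arcs.
Variables (E W : finType).
Implicit Types (X Y : {set E}) (t h : E -> W).

(** Each vertex w is divided into a full copy, where k * [fl w] arcs start and
as many end, and a copy (w, true) with the remaining [md w] arcs, filled up with
loops to k outgoing and k incoming arcs. *)
Section Copies.
Variables (k : nat) (X : {set E}) (md fl : W -> nat).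
Hypothesis mdk : forall w, md w <= k.

Definition arcs_loops : {set E + W * 'I_k} :=
  [set z : E + W * 'I_k | match z with inl e => e \in X | inr u => (0 < md u.1) && (u.2 < k - md u.1) end].
Definition node (t : E -> W) (Ft : {set E}) (z : E + W * 'I_k) : W * bool :=
  match z with inl e => (t e, e \notin Ft) | inr u => (u.1, true) end.
Definition node_quota (x : W * bool) : nat := if x.2 then nat_of_bool (0 < md x.1) else fl x.1.

Lemma node_deg t (Ft : {set E}) x : Ft \subset X -> (forall w, fib t Ft w = k * fl w) ->
  (forall w, fib t X w = k * fl w + md w) ->
  #|[set z in arcs_loops | node t Ft z == x]| = k * node_quota x.
Proof.
move=> FX hF hX; rewrite card_sum_set; case: x => w [] /=; rewrite /node_quota /=; last first.
  rewrite -hF [X in _ + X]eq_card0 ?addn0; last by move=> u; rewrite !inE /= xpair_eqE andbF andbF.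
  apply: eq_card => e; rewrite !inE /= xpair_eqE.
  by case: (boolP (e \in Ft)) => [/(subsetP FX) ->|_]; rewrite ?andbT ?andbF.
have -> : #|[set e | inl e \in [set z in arcs_loops | node t Ft z == (w, true)]]| = md w.
  have := hX w; rewrite (fibD t w FX) hF => /addnI <-; apply: eq_card => e.
  by rewrite !inE /= xpair_eqE eqb_id; case: (e \in Ft); rewrite ?andbT ?andbF.
have -> : [set u | inr u \in [set z in arcs_loops | node t Ft z == (w, true)]] =
    [set (w, i) | i in [set i : 'I_k | (0 < md w) && (i < k - md w)]].
  apply/setP => -[w' i]; rewrite !inE /= xpair_eqE andbT; apply/andP/imsetP.
    by case=> h /eqP e; rewrite e in h *; exists i; rewrite ?inE.
  by case=> i'; rewrite inE => h [-> ->].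
rewrite card_imset; last by move=> i i' [].
case: (posnP (md w)) => [->|m0]; first by rewrite muln0 eq_card0 // => i; rewrite inE.
rewrite muln1; have := card_ord_ltn (leq_subr (md w) k); have := mdk w.
move=> h1; rewrite /= => ->; lia.
Qed.
End Copies.

(** A fair selection of one k-th of the arcs and loops of the divided vertices.
A selected loop counts for both the arcs leaving and those entering w, so the
selected arcs are balanced; there is at most one selected loop at w, and the
full copy alone provides [q w] arcs. *)
Lemma arc_class X t h k (q : W -> nat) : 0 < k ->
  (forall w, fib t X w = fib h X w) -> (forall w, k * q w <= fib t X w) ->
  exists Y : {set E}, [/\ Y \subset X, forall w, fib t Y w = fib h Y w &
    forall w, q w <= fib t Y w /\ fib t Y w + k.-1 * q w <= fib t X w].
Proof.
move=> k0 bal hq; pose fl w := fib t X w %/ k; pose md w := fib t X w %% k.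
have tE w : fib t X w = k * fl w + md w by rewrite mulnC; apply: divn_eq.
have hE w : fib h X w = k * fl w + md w by rewrite -bal.
have mdk w : md w <= k by apply/ltnW/ltn_pmod.
have [|Ft [FtX Ft1]] := @choose_sub _ _ t X (fun w => k * fl w).
  by move=> w; rewrite tE leq_addr.
have [|Fh [FhX Fh1]] := @choose_sub _ _ h X (fun w => k * fl w).
  by move=> w; rewrite hE leq_addr.
have [||| M [MF M1 M2]] := @fair_selection _ _ _ (arcs_loops k X md) (node t Ft) (node h Fh)
   k (node_quota md fl) (node_quota md fl).
- by [].
- by move=> x; rewrite (node_deg mdk _ FtX Ft1 tE).
- by move=> x; rewrite (node_deg mdk _ FhX Fh1 hE).
have {}M2 : forall x, #|[set e in M | node h Fh e == x]| = node_quota md fl x.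
  apply: leq_sum_eq => //; rewrite [X in _ <= X]card_fibers -(card_fibers (node t Ft) M).
  by apply: leq_sum => x _; rewrite M1.
pose Y := [set e | inl e \in M]; pose lp w := #|[set u : W * 'I_k | (inr u \in M) && (u.1 == w)]|.
have cnt s Fs w : #|[set e in M | @node k s Fs e == (w, false)]| +
    #|[set e in M | node s Fs e == (w, true)]| = fib s Y w + lp w.
  pose S b := [set z in M | @node k s Fs z == (w, b)].
  have -> : fib s Y w = #|[set e | inl e \in S false]| + #|[set e | inl e \in S true]|.
    rewrite /fib -(cardsID Fs); congr (_ + _); apply: eq_card => e; rewrite !inE /= xpair_eqE.
      by case: (e \in Fs); rewrite ?andbF ?andbT.
    by case: (e \in Fs); rewrite ?andbF ?andbT.
  have -> : lp w = #|[set u | inr u \in S true]|.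
    by apply: eq_card => u; rewrite !inE /= xpair_eqE andbT.
  rewrite -/(S false) -/(S true) [#|S false|]card_sum_set [#|S true|]card_sum_set.
  rewrite [X in _ + X + _]eq_card0 ?addn0 ?addnA // => u.
  by rewrite !inE /= xpair_eqE andbF andbF.
have lpM w : lp w <= (0 < md w).
  rewrite -[nat_of_bool _]/(node_quota md fl (w, true)) -M1 card_sum_set; apply: leq_trans (leq_addl _ _).
  by apply/subset_leq_card/subsetP => u; rewrite !inE xpair_eqE andbT.
have tY w : fib t Y w + lp w = fl w + (0 < md w).
  by rewrite -(cnt t Ft) !M1.
have hY w : fib h Y w + lp w = fl w + (0 < md w).
  by rewrite -(cnt h Fh) !M2.
exists Y; split.
- by apply/subsetP => e; rewrite inE => /(subsetP MF); rewrite inE.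
- by move=> w; have := hY w; rewrite -tY => /addIn.
move=> w; have qf : q w <= fl w by rewrite leq_divRL // mulnC.
have h1 := tY w; have h2 := lpM w; have h3 := tE w; split; first by clear -h1 h2 qf; lia.
have h4 : k.-1 * q w <= k.-1 * fl w by rewrite leq_mul2l qf orbT.
have h5 : k * fl w = fl w + k.-1 * fl w by rewrite -mulSn prednK.
have h6 : (0 < md w) <= md w by case: (md w).
by clear -h1 h2 h3 h4 h5 h6; lia.
Qed.

Lemma arc_classes X t h k (q : W -> nat) : 0 < k ->
  (forall w, fib t X w = fib h X w) -> (forall w, k * q w <= fib t X w) ->
  exists Xs : seq {set E}, [/\ size Xs = k, perm_eq (flatten [seq enum Y : seq E | Y <- Xs]) (enum X),
    forall Y, Y \in Xs -> Y \subset X,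
    forall Y w, Y \in Xs -> fib t Y w = fib h Y w /\ q w <= fib t Y w &
    forall Y w, Y \in Xs -> fib t X w = k * q w -> fib t Y w = q w].
Proof.
elim: k X => // k IHk X _ bal hq.
have [Y [YX balY hY]] := arc_class (ltn0Sn k) bal hq.
case: (posnP k) => [k0|kpos].
  exists [:: X]; rewrite /= cats0 k0; split=> //.
  - by move=> Z; rewrite inE => /eqP ->.
  - by move=> Z w; rewrite inE => /eqP ->; split=> //; rewrite -[q w]mul1n -k0.
  by move=> Z w; rewrite inE => /eqP -> ->; rewrite mul1n.
have DX : X :\: Y \subset X by apply: subsetDl.
have balD w : fib t (X :\: Y) w = fib h (X :\: Y) w.
  by have := bal w; rewrite (fibD t w YX) (fibD h w YX) balY => /addnI.
have hD w : k * q w <= fib t (X :\: Y) w.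
  by have [_] := hY w; rewrite (fibD t w YX) leq_add2l.
have [Xs [sz pe sub h1 h2]] := IHk _ kpos balD hD.
exists (Y :: Xs); split.
- by rewrite /= sz.
- rewrite /= (perm_trans (y := enum Y ++ enum (X :\: Y))) ?perm_cat2l //.
  apply: uniq_perm; rewrite ?cat_uniq ?enum_uniq ?andbT //=.
    by apply/hasPn => e; rewrite !mem_enum inE => /andP[].
  move=> e; rewrite mem_cat !mem_enum inE; case: (boolP (e \in Y)) => //= /(subsetP YX) //.
- move=> Z; rewrite inE => /orP[/eqP ->//|/sub ZD]; exact: subset_trans ZD DX.
- by move=> Z w; rewrite inE => /orP[/eqP ->|/h1 //]; have [] := hY w.
move=> Z w; rewrite inE => /orP[/eqP -> e|ZX e].
  by have [h3 h4] := hY w; rewrite e in h4; clear -h3 h4; lia.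
apply: h2 ZX _; have [h3 h4] := hY w; have := hD w; have := fibD t w YX; rewrite e.
by clear -h3; lia.
Qed.
End Arcs.

(** * A connected even set of low degree *)

Lemma odd_sum_card (V : finType) (F : V -> nat) :
  odd #|[set v | odd (F v)]| = odd (\sum_v F v).
Proof.
rewrite -sum1_card big_mkcond /= !(big_morph odd oddD (erefl : odd 0 = false)).
by apply: eq_bigr => v _; rewrite inE; case: (odd (F v)).
Qed.

Lemma fibU (E : finType) (W : eqType) (t : E -> W) (X Y : {set E}) w : [disjoint X & Y] ->
  fib t (X :|: Y) w = fib t X w + fib t Y w.
Proof.
move=> dXY; rewrite (fibD t w (subsetUl X Y)); congr (_ + fib _ _ _).
by rewrite setDUl setDv set0U; apply/setDidPl; rewrite disjoint_sym.
Qed.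

Lemma fib_bigcup (E W : finType) (I : finType) (t : E -> W) (T : I -> {set E}) w :
  (forall i j, i != j -> [disjoint T i & T j]) ->
  (forall i, 0 < fib t (T i) w) -> #|I| <= fib t (\bigcup_i T i) w.
Proof.
move=> dT hT; have -> : fib t (\bigcup_i T i) w = \sum_i fib t (T i) w.
  have -> : fib t (\bigcup_i T i) w = #|\bigcup_i [set e in T i | t e == w]|.
    apply: eq_card => e; rewrite inE; apply/andP/bigcupP.
      by case=> /bigcupP[i _ eT] ew; exists i; rewrite // inE eT.
    by case=> i _; rewrite inE => /andP[eT ->]; split=> //; apply/bigcupP; exists i.
  rewrite -sum1_card partition_disjoint_bigcup => [|i j /dT].
    by apply: eq_bigr => i _; rewrite sum1_card.
  by apply: disjointW; apply/subsetP => e; rewrite inE => /andP[].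
by rewrite -sum1_card; apply: leq_sum => i _; apply: hT.
Qed.

Section Core.
Variables (V : finType) (A : {set V}).
Implicit Types (X Y Z : {set V * V}).

Definition sided X := forall e, e \in X -> e.1 \in A /\ e.2 \notin A.

Lemma sided_fst X v : sided X -> v \notin A -> fib fst X v = 0.
Proof.
move=> sX vA; apply: eq_card0 => e; rewrite !inE; apply/negP => /andP[/sX[eA _] /eqP ev].
by rewrite ev (negbTE vA) in eA.
Qed.

Lemma sided_snd X v : sided X -> v \in A -> fib snd X v = 0.
Proof.
move=> sX vA; apply: eq_card0 => e; rewrite !inE; apply/negP => /andP[/sX[_ eA] /eqP ev].
by rewrite ev vA in eA.
Qed.

Lemma sidedS X Y : X \subset Y -> sided Y -> sided X.
Proof. by move=> /subsetP XY sY e /XY /sY. Qed.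

Lemma spanning_deg X v : 1 < #|V| -> spanning X -> 0 < fib fst X v + fib snd X v.
Proof.
move=> V1 spX; have [u uv] : exists u, u != v.
  by have /card_gt1P[x [y [_ _ xy]]] := V1; case: (eqVneq x v) xy => [->|]; [exists y; rewrite eq_sym | exists x].
have /connectP[[|z s] /= h] := spX v u; first by move=> e; rewrite e eqxx in uv.
move=> _; rewrite addn_gt0; case/andP: h => /orP[h|h] _; apply/orP; [left|right];
by apply/card_gt0P; eexists; rewrite inE; apply/andP; split; [exact: h|].
Qed.

Lemma spanning_fst X v : 1 < #|V| -> spanning X -> sided X -> v \in A -> 0 < fib fst X v.
Proof. by move=> V1 spX sX vA; have := spanning_deg v V1 spX; rewrite (sided_snd sX vA) addn0. Qed.

Lemma spanning_snd X v : 1 < #|V| -> spanning X -> sided X -> v \notin A -> 0 < fib snd X v.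
Proof. by move=> V1 spX sX vA; have := spanning_deg v V1 spX; rewrite (sided_fst sX vA). Qed.

Definition cdiv d m := (d + m.-1) %/ m.

Lemma leq_cdiv d m : 0 < m -> d <= m * cdiv d m.
Proof.
move=> m0; have := divn_eq (d + m.-1) m; have := ltn_pmod (d + m.-1) m0.
by rewrite /cdiv mulnC; lia.
Qed.

Lemma cdiv_leq d m : 0 < m -> m * cdiv d m <= d + m.-1.
Proof. by move=> m0; rewrite mulnC leq_trunc_div. Qed.

(** Take spanning sets of low degree inside P and inside Q.  Joining to the
first one a subset J of the second with the same odd vertices makes all degrees
even; each vertex is the end of edges on one side only, so its parities as first
and as second end need not be treated separately. *)
Lemma even_core (m : nat) (T T' : 'I_m -> {set V * V}) : 0 < m ->
  (forall i, sided (T i)) -> (forall i, sided (T' i)) ->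
  (forall i, spanning (T i)) -> (forall i, spanning (T' i)) ->
  (forall i j, i != j -> [disjoint T i & T j]) ->
  (forall i j, i != j -> [disjoint T' i & T' j]) ->
  let P := \bigcup_i T i in let Q := \bigcup_i T' i in [disjoint P & Q] ->
  exists Z : {set V * V}, [/\ Z \subset P :|: Q, spanning Z,
    forall v, ~~ odd (fib fst Z v), forall v, ~~ odd (fib snd Z v) &
    forall a, a \in A -> fib fst Z a <= cdiv (fib fst P a) m + cdiv (fib fst Q a) m].
Proof.
move=> m0 sT sT' spT spT' dT dT' P Q dPQ.
have [||T1 [T1P spT1 hT1]] :=
  @low_degree_spanning V A m T (fun a => cdiv (fib fst P a) m) m0 _ spT dT.
- by move=> i e /sT[].
- by move=> a _; apply: leq_cdiv.
have [||T2 [T2Q spT2 hT2]] :=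
  @low_degree_spanning V A m T' (fun a => cdiv (fib fst Q a) m) m0 _ spT' dT'.
- by move=> i e /sT'[].
- by move=> a _; apply: leq_cdiv.
have sP : sided P by move=> e /bigcupP[i _ /sT].
have sQ : sided Q by move=> e /bigcupP[i _ /sT'].
pose O := [set v | odd (fib fst T1 v + fib snd T1 v)].
have [x y _ _||J [JT2 parJ]] := @toggle_parity V _ fst snd T2 O.
- apply: connect_sub (spT2 x y) => u v huv; apply: connect1; apply/exists_inP.
  by case/orP: huv => h; [exists (u, v) | exists (v, u)]; rewrite //= !eqxx ?orbT.
- by rewrite odd_sum_card big_split /= !card_fibers addnn odd_double.
have dTJ : [disjoint T1 & J].
  by apply: disjointW dPQ => //; apply: subset_trans JT2 _.
pose Z := T1 :|: J.
have ZPQ : Z \subset P :|: Q by apply: setUSS => //; apply: subset_trans JT2 _.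
have sZ : sided Z.
  by move=> e /(subsetP ZPQ); rewrite inE => /orP[/sP|/sQ].
have oddZ v : ~~ odd (fib fst Z v + fib snd Z v).
  rewrite !fibU // !oddD; have := parJ v; rewrite inE oddD /tpar /fib.
  by do 4 case: (odd _).
exists Z; split=> //.
- move=> x y; apply: connect_sub (spT1 x y) => u v huv; apply: connect1.
  by case/orP: huv => h; rewrite /erel /= !inE h ?orbT.
- move=> v; have := oddZ v; case: (boolP (v \in A)) => vA.
    by rewrite (sided_snd sZ vA) addn0.
  by rewrite (sided_fst sZ vA).
- move=> v; have := oddZ v; case: (boolP (v \in A)) => vA; last by rewrite (sided_fst sZ vA).
  by rewrite (sided_snd sZ vA).
move=> a aA; rewrite fibU // leq_add //; first exact: hT1.
by apply: leq_trans (hT2 a aA); apply: fibS.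
Qed.
End Core.

(** * A set of last edges with an even remainder *)

Section Transversal.
Variables (V : finType) (A : {set V}) (Z : {set V * V}) (s : V * V -> V * V).
Hypothesis ps : pairing Z s.

Implicit Types S Y : {set V * V}.

Definition transversal S := S \subset Z /\ forall e, e \in Z -> (e \in S) != (s e \in S).

Lemma pairing_inj : {in Z &, injective s}.
Proof. by move=> x y xZ yZ e; have [_ _ <- _] := ps xZ; have [_ _ <- _] := ps yZ; rewrite e. Qed.

Lemma transversal_fst S a : transversal S -> 2 * fib fst S a = fib fst Z a.
Proof.
case=> SZ hS; rewrite (fibD fst a SZ) mul2n -addnn; congr (_ + _).
have inj : {in [set e in S | e.1 == a] &, injective s}.
  by move=> x y; rewrite !inE => /andP[/(subsetP SZ) h _] /andP[/(subsetP SZ) h' _]; apply: pairing_inj.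
rewrite /fib -(card_in_imset inj); apply: eq_card => e; rewrite !inE.
apply/imsetP/andP => [[x]|[/andP[eS eZ] ea]].
  rewrite inE => /andP[xS xa] ->; have xZ := subsetP SZ _ xS; have [sZ s1 _ _] := ps xZ.
  by rewrite s1 sZ xa andbT; split=> //; have := hS x xZ; rewrite xS; case: (_ \in S).
have [sZ s1 ss _] := ps eZ; exists (s e); last by rewrite ss.
by rewrite inE s1 ea andbT; have := hS e eZ; rewrite (negbTE eS); case: (_ \in S).
Qed.

Definition halfset := [set e in Z | enum_rank e < enum_rank (s e)].

Lemma halfset_transversal : transversal halfset.
Proof.
split; first by apply/subsetP => e; rewrite inE => /andP[].
move=> e eZ; have [sZ _ ss se] := ps eZ; rewrite !inE eZ sZ ss /=.
case: (ltngtP (enum_rank e) (enum_rank (s e))) => // h.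
by have := enum_rank_inj (val_inj h) => es; rewrite -es eqxx in se.
Qed.

(** Exchanging the chosen element in the pairs of Y does not change the degrees
in A and toggles the parities at both other ends of each pair. *)
Lemma toggle_transversal S Y : transversal S -> Y \subset S ->
  exists S', transversal S' /\ forall b, odd (fib snd S' b) =
    odd (fib snd S b) (+) tpar snd (fun e => (s e).2) Y b.
Proof.
case=> SZ hS YS; exists [set e in Z | if e \in S then e \notin Y else s e \in Y].
have YZ := subset_trans YS SZ.
split; first split.
- by apply/subsetP => e; rewrite inE => /andP[].
- move=> e eZ; have [sZ _ ss _] := ps eZ; have := hS e eZ; rewrite !inE eZ sZ ss /=.
  by case: (boolP (e \in S)); case: (boolP (s e \in S)) => //=; case: (_ \in Y).
move=> b; rewrite (fibD snd b YS) /tpar.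
set S' := [set e in Z | _].
have SYS' : S :\: Y \subset S'.
  by apply/subsetP => e; rewrite !inE => /andP[eY eS]; rewrite eS eY (subsetP SZ).
rewrite (fibD snd b SYS') -[#|[set e in Y | e.2 == b]|]/(fib snd Y b).
suff -> : fib snd (S' :\: (S :\: Y)) b = #|[set e in Y | (s e).2 == b]|.
  by rewrite !oddD; do 3 case: (odd _).
have inj : {in [set e in Y | (s e).2 == b] &, injective s}.
  by move=> x y; rewrite !inE => /andP[/(subsetP YZ) h _] /andP[/(subsetP YZ) h' _]; apply: pairing_inj.
rewrite /fib -(card_in_imset inj); apply: eq_card => e; rewrite !inE.
apply/andP/imsetP => [[/and3P[h eZ h'] eb]|[y]].
  have [sZ _ ss _] := ps eZ; exists (s e); last by rewrite ss.
  by move: h h'; rewrite inE ss eb andbT; case: (e \in S); case: (e \in Y).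
rewrite inE => /andP[yY sy] ->; have yZ := subsetP YZ _ yY; have [sZ _ ss _] := ps yZ.
have yS := subsetP YS _ yY; have := hS y yZ; rewrite yS ss sZ yY sy.
by case: (s y \in S) => //= _; rewrite andbF.
Qed.
End Transversal.

Section Half.
Variables (V : finType) (A : {set V}) (k : nat) (E1 : {set V * V}) (T : nat -> {set V * V}).
Let m := 2 * k + 1.
Hypotheses (k0 : 0 < k) (V1 : 1 < #|V|) (sE1 : sided A E1).
Hypothesis dvE1 : forall a, m %| fib fst E1 a.
Hypothesis TE1 : forall i, i < m * m.+1 -> T i \subset E1.
Hypothesis spT : forall i, i < m * m.+1 -> spanning (T i).
Hypothesis dT : forall i j, i < m * m.+1 -> j < m * m.+1 -> i != j -> [disjoint T i & T j].

Definition npaths a := fib fst E1 a %/ (2 * k + 1).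

Lemma npathsE a : fib fst E1 a = m * npaths a.
Proof. by rewrite mulnC divnK ?dvE1. Qed.

Lemma fam_disjoint c d : c + d <= m * m.+1 ->
  forall i j : 'I_d, i != j -> [disjoint T (c + i) & T (c + j)].
Proof.
move=> cd i j ij; apply: dT; rewrite ?eqn_add2l //;
by apply: leq_trans cd; rewrite -addnS leq_add2l.
Qed.

Lemma fam_disjoint2 c d c' d' : c + d <= m * m.+1 -> c' + d' <= m * m.+1 -> c + d <= c' ->
  [disjoint \bigcup_(i < d) T (c + i) & \bigcup_(i < d') T (c' + i)].
Proof.
move=> h h' cc; rewrite -setI_eq0; apply/eqP/setP => e; rewrite !inE; apply/negP.
case/andP=> /bigcupP[i _ ei] /bigcupP[j _ ej].
have li := ltn_ord i; have lj := ltn_ord j.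
have := @dT (c + i) (c' + j); rewrite -setI_eq0 => hd.
have /eqP/setP/(_ e) : T (c + i) :&: T (c' + j) == set0 by apply: hd; lia.
by rewrite !inE ei ej.
Qed.

(** M consists of one edge of each pair of Z and of edges outside Z, chosen
fairly, that bring the degree of each a in A up to [npaths a].  The number of
wrong parities is even because m is odd: if n is the sum of [npaths], then M has
n elements and E1 has m * n.  The spanning sets that are not used for Z leave a
degree of at least m * m - m at each vertex outside A, of which the fair
part takes at most one m-th, rounded up. *)
Lemma even_remainder : exists M : {set V * V}, [/\ M \subset E1,
  forall a, fib fst M a = npaths a,
  forall a, fib fst (E1 :\: M) a = 2 * k * npaths a,
  forall b, ~~ odd (fib snd (E1 :\: M) b) &
  forall b, b \notin A -> 4 * k * k <= fib snd (E1 :\: M) b].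
Proof.
have m0 : 0 < m by rewrite /m addn1.
(* two times m sets for building Z; the others provide large degrees *)
have rE : m * m.+1 = m + (m + (m * m - m)) by clear; lia.
have l1 : 0 + m <= m * m.+1 by clear -rE; lia.
have l2 : m + m <= m * m.+1 by clear -rE; lia.
have l3 : (m + m) + (m * m - m) <= m * m.+1 by clear -rE; lia.
have lt_ c d (i : 'I_d) : c + d <= m * m.+1 -> c + i < m * m.+1.
  by move=> cd; apply: leq_trans cd; rewrite -addnS leq_add2l.
have sT i : i < m * m.+1 -> sided A (T i) by move=> /TE1 h; apply: sidedS h sE1.
have [|||||||Z [ZPQ spZ Z1 Z2 Zc]] := @even_core V A m (fun i => T (0 + i)) (fun i => T (m + i)) m0.
- by move=> i; apply/sT/lt_.
- by move=> i; apply/sT/lt_.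
- by move=> i; apply/spT/lt_.
- by move=> i; apply/spT/lt_.
- exact: fam_disjoint.
- exact: fam_disjoint.
- by apply: fam_disjoint2.
move: ZPQ Zc; set P := \bigcup_(i < m) T (0 + i); set Q := \bigcup_(i < m) T (m + i) => ZPQ Zc.
pose R := \bigcup_(i < m * m - m) T (m + m + i).
have dPQ : [disjoint P & Q] by apply: fam_disjoint2.
have dPR : [disjoint P & R] by apply: fam_disjoint2 => //; rewrite add0n leq_addr.
have dQR : [disjoint Q & R] by apply: fam_disjoint2.
have bE c d : c + d <= m * m.+1 -> \bigcup_(i < d) T (c + i) \subset E1.
  by move=> cd; apply/bigcupsP => i _; apply/TE1/lt_.
have dPQR : [disjoint P :|: Q & R].
  by rewrite -setI_eq0 setIUl setU_eq0 !setI_eq0 dPR dQR.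
have PE : P :|: Q :|: R \subset E1 by rewrite !subUset !bE.
have ZE : Z \subset E1.
  by apply: subset_trans ZPQ (subset_trans (subsetUl _ R) PE).
have sZ : sided A Z := sidedS ZE sE1.
pose F0 := E1 :\: Z.
have RF0 : R \subset F0.
  rewrite subsetD (subset_trans (subsetUr _ _) PE) /= disjoint_sym.
  exact: disjointWl ZPQ dPQR.
have R1 a : a \in A -> m * m - m <= fib fst R a.
  move=> aA; rewrite -[X in X <= _]card_ord; apply: fib_bigcup.
    exact: fam_disjoint.
  by move=> i; apply: (spanning_fst (A := A)) => //; [apply/spT/lt_ | apply/sT/lt_].
have R2 b : b \notin A -> m * m - m <= fib snd R b.
  move=> aA; rewrite -[X in X <= _]card_ord; apply: fib_bigcup.
    exact: fam_disjoint.
  by move=> i; apply: (spanning_snd (A := A)) => //; [apply/spT/lt_ | apply/sT/lt_].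
have quot0 a : a \notin A -> npaths a = 0.
  by move=> aA; rewrite /npaths (sided_fst sE1 aA) div0n.
have mk : m = 2 * k + 1 by [].
have Zq a : fib fst Z a <= npaths a.
  case: (boolP (a \in A)) => aA; last by rewrite (sided_fst sZ aA).
  rewrite -(leq_pmul2l m0); have h1 := Zc a aA.
  have h2 := cdiv_leq (fib fst P a) m0; have h3 := cdiv_leq (fib fst Q a) m0.
  have h4 := fibS fst a PE; rewrite npathsE (fibU fst a dPQR) (fibU fst a dPQ) in h4.
  have h5 := R1 a aA.
  have h6 : m * fib fst Z a <= m * cdiv (fib fst P a) m + m * cdiv (fib fst Q a) m.
    by rewrite -mulnDr leq_mul2l h1 orbT.
  have h7 : 3 * m <= m * m by rewrite leq_mul2r mk; clear -k0; lia.
  clear -h2 h3 h4 h5 h6 h7 m0; lia.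
have Zhalf a : fib fst Z a = 2 * (fib fst Z a)./2.
  by have := odd_double_half (fib fst Z a); rewrite (negbTE (Z1 a)) mul2n.
pose n a := npaths a - (fib fst Z a)./2.
have F0E a : fib fst E1 a = fib fst Z a + fib fst F0 a by apply: fibD.
have F0E2 a : fib snd E1 a = fib snd Z a + fib snd F0 a by apply: fibD.
have [//|a|b|M0 [M0F M01 M02]] := @fair_selection _ _ _ F0 fst snd m n (fun b => cdiv (fib snd F0 b) m).
- have := F0E a; rewrite npathsE -/(fib fst F0 a) => h.
  have h1 : m * n a = m * npaths a - m * (fib fst Z a)./2 by rewrite /n mulnBr.
  have h2 : 2 * (fib fst Z a)./2 <= m * (fib fst Z a)./2 by rewrite leq_mul2r mk; clear -k0; lia.
  have h3 := Zhalf a; clear -h h1 h2 h3; lia.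
- exact: leq_cdiv.
have [s [ps cs]] := connected_pairing sZ spZ Z2 Z1.
have tS0 := halfset_transversal ps; set S0 := halfset Z s in tS0.
pose O := [set b | odd (fib snd M0 b + fib snd S0 b + fib snd E1 b)].
have sM0 : sided A M0 by apply: sidedS (subset_trans M0F (subsetDl _ _)) sE1.
have sS0 : sided A S0 by case: tS0 => h _; apply: sidedS h sZ.
have fS S a : transversal Z s S -> fib fst S a = (fib fst Z a)./2.
  by move=> tS; rewrite -(transversal_fst ps a tS) mul2n doubleK.
have OA b : b \in O -> b \notin A.
  rewrite inE; apply: contraL => bA.
  by rewrite (sided_snd sM0 bA) (sided_snd sS0 bA) (sided_snd sE1 bA).
have [x y xO yO||Y [YS parY]] := @toggle_parity V _ snd (fun e => (s e).2) S0 O.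
- have := cs x y (OA x xO) (OA y yO); apply: connect_sub => u v.
  case/exists_inP=> z zZ /andP[zu zv]; apply/connect1/exists_inP.
  have [sz _ ss _] := ps z zZ; case: tS0 => _ /(_ z zZ).
  case: (boolP (z \in S0)) => zS0; first by move=> _; exists z; rewrite ?zu ?zv.
  by case: (boolP (s z \in S0)) => // sS _; exists (s z); rewrite ?ss ?zu ?zv ?orbT.
- rewrite odd_sum_card !big_split /= !card_fibers.
  have -> : #|M0| + #|S0| = \sum_a npaths a.
    rewrite -(card_fibers fst M0) -(card_fibers fst S0) -big_split /=; apply: eq_bigr => a _.
    rewrite M01 -/(fib fst S0 a) fS // /n subnK //; have := Zq a; have := Zhalf a; clear; lia.
  have -> : #|E1| = m * \sum_a npaths a.
    rewrite -(card_fibers fst E1) big_distrr; apply: eq_bigr => a _.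
    exact: npathsE.
  by rewrite -mulSn oddM mk /= addn1 /= oddM.
have [S [tS parS]] := toggle_transversal ps tS0 YS.
have [SZ _] := tS.
have dMS : [disjoint M0 & S].
  by move: (subset_trans M0F (subxx _)); rewrite subsetD => /andP[_]; apply: disjointWr.
have sS := sidedS SZ sZ.
have M1 a : fib fst (M0 :|: S) a = npaths a.
  rewrite fibU // (fS S) // -[fib fst M0 a]/(#|_|) M01 /n subnK //.
  by have := Zq a; have := Zhalf a; clear; lia.
have ME : M0 :|: S \subset E1.
  by rewrite subUset (subset_trans M0F (subsetDl _ _)) (subset_trans SZ ZE).
exists (M0 :|: S); split=> //.
- move=> a; have := fibD fst a ME; rewrite M1 npathsE mk mulnDl mul1n addnC => /addnI <- //.
- move=> b; have h := fibD snd b ME; have p1 := parS b; have p2 := parY b.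
  rewrite p2 inE !oddD in p1.
  have : odd (fib snd E1 b) = odd (fib snd M0 b) (+) odd (fib snd S b) (+) odd (fib snd (E1 :\: (M0 :|: S)) b).
    by rewrite h fibU // !oddD.
  by rewrite p1; do 4 case: (odd _).
move=> b bA; have h1 : F0 :\: M0 \subset E1 :\: (M0 :|: S).
  apply/subsetP => e; rewrite !inE => /and3P[eM eZ ->]; rewrite andbT negb_or eM.
  by apply: contra eZ; apply: (subsetP SZ).
apply: leq_trans (fibS snd b h1); have h2 := fibD snd b M0F.
have h3 := leq_trans (R2 b bA) (fibS snd b RF0).
have h4 := M02 b; rewrite -/(fib snd M0 b) in h4; have h5 := cdiv_leq (fib snd F0 b) m0.
rewrite mk in h3 h5; move: h2 h3 h4 h5; move: (fib snd F0 b) (fib snd M0 b) (cdiv _ _).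
move: (fib snd (F0 :\: M0) b); clear => f d c q h2 h3 h4 h5.
case: (leqP q (2 * k)) => hq; first by nia.
have h6 : 2 * k * (2 * k + 1) <= 2 * k * q by rewrite leq_mul2l addn1 hq orbT.
by nia.
Qed.

End Half.

(** * Attaching one new edge to every path *)

Section Extension.
Variables (V : finType) (col : V -> bool).

Definition alt : rel V := [rel a b | col a != col b].
Definition edge2 (a b : V) : {set V} := [set a; b].
Definition eds (t : V * seq V) : seq {set V} := pairmap edge2 t.1 t.2.
Definition verts (t : V * seq V) : seq V := t.1 :: t.2.

Lemma edge2C a b : edge2 a b = edge2 b a.
Proof. exact: setUC. Qed.


Lemma eds_rev x p : perm_eq (pairmap edge2 (last x p) (rev (belast x p))) (pairmap edge2 x p).
Proof.
elim: p x => [|y p IHp] x //=.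
rewrite rev_cons -cats1 pairmap_cat perm_catC /=.
have -> : last (last y p) (rev (belast y p)) = y.
  by case: p {IHp} => //= z p; rewrite rev_cons last_rcons.
by rewrite edge2C perm_cons.
Qed.

Lemma alt_count x p : path alt x p ->
  count (fun y => col y != col x) (x :: p) = uphalf (size p) /\
  count (fun y => col y == col x) (x :: p) = (size p)./2.+1.
Proof.
elim: p x => [|y p IHp] x; first by rewrite /= eqxx.
move=> /= /andP[xy /IHp [h1 h2]]; rewrite /alt /= in xy.
have e1 : (fun z => col z != col x) =1 (fun z => col z == col y).
  by move=> z; move: xy; case: (col z); case: (col x); case: (col y).
have e2 : (fun z => col z == col x) =1 (fun z => col z != col y).
  by move=> z; move: xy; case: (col z); case: (col x); case: (col y).
rewrite -!/(count _ (y :: p)) (eq_count e1) (eq_count e2) h1 h2 !eqxx /=.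
by split; lia.
Qed.

Variables (s : bool) (j k : nat).
Hypothesis jk : j <= 2 * k.
Notation item := (V * (V * seq V))%type.

(** An item (w, (v, p)) is a path v :: p together with a new edge hung on its
head v, leading to w; it fits if w is not on the path.  A path of length j has
vertices of alternating colours, the colour of v being s. *)
Definition item_ok (i : item) := [&& uniq (verts i.2), path alt i.2.1 i.2.2,
  size i.2.2 == j, col i.2.1 == s & col i.1 != s].
Definition hung_edge (i : item) := edge2 i.2.1 i.1.
Definition item_edges (I : seq item) := map hung_edge I ++ flatten [seq eds i.2 | i <- I].
Definition fits (i : item) := i.1 \notin verts i.2.
Definition fits_at v (i : item) := (i.2.1 == v) && fits i.
Definition misfit (i : item) := ~~ fits i.

(** Since the colours alternate, at most k of the j + 1 <= 2k + 1 vertices have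
the colour of the new ends. *)
Lemma item_ok_count i : item_ok i -> count (fun y => col y != s) (verts i.2) <= k.
Proof.
case/and5P=> _ ap /eqP sz /eqP <- _; have [h _] := alt_count ap.
by rewrite /verts h sz; move: jk; lia.
Qed.

Lemma item_edges_perm I J : perm_eq I J -> perm_eq (item_edges I) (item_edges J).
Proof. by move=> p; apply: perm_cat; [apply: perm_map | apply/perm_flatten/perm_map]. Qed.

(** The new ends at a given head are distinct, and apart from w the path T has
room for only k - 1 of them. *)
Lemma pick_item (v w : V) (T : V * seq V) (L : seq item) :
  item_ok (w, T) -> T.1 = v -> w \in verts T -> uniq (map hung_edge ((w, T) :: L)) ->
  all item_ok L -> (forall i, i \in L -> i.2.1 = v) -> k <= size L ->
  exists2 i, i \in L & i.1 \notin verts T.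
Proof.
move=> okT Tv wT un okL hL kL; apply/hasP; apply: contraTT kL.
rewrite -all_predC => /allP hall; rewrite -ltnNge.
suff : size (w :: map fst L) <= count (fun y => col y != s) (verts T).
  by rewrite /= size_map => h; apply: leq_trans h (item_ok_count okT).
rewrite -size_filter; apply: uniq_leq_size.
  apply: (map_uniq (f := edge2 v)); move: un; rewrite /= {1}/hung_edge /= Tv.
  suff -> : map hung_edge L = map (edge2 v) (map fst L) by [].
  by rewrite -map_comp; apply/eq_in_map => i /hL; rewrite /hung_edge /= => ->.
move=> y; rewrite inE mem_filter => /orP[/eqP ->|/mapP[i iL ->]].
  by rewrite wT; case/and5P: okT => _ _ _ _ ->.
by have := hall i iL; rewrite /= negbK => ->; case/and5P: (allP okL i iL) => _ _ _ _ ->.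
Qed.

Lemma item_edges_swap w w' T T' I : T.1 = T'.1 ->
  perm_eq (item_edges ((w, T) :: (w', T') :: I)) (item_edges ((w', T) :: (w, T') :: I)).
Proof.
move=> e; rewrite /item_edges /= /hung_edge /= e; apply/permP => a /=; lia.
Qed.

Variables (E : seq {set V}) (Ws : seq V).
Hypothesis unE : uniq E.

Definition valid (I : seq item) :=
  [/\ all item_ok I, perm_eq (item_edges I) E & perm_eq (map fst I) Ws].

Lemma valid_perm I J : perm_eq I J -> valid I -> valid J.
Proof.
move=> p [a b c]; split; first by rewrite -(perm_all _ p).
  by rewrite -(permPl (item_edges_perm p)).
by rewrite -(permPl (perm_map fst p)).
Qed.

Lemma item_ok_swap w w' T T' : item_ok (w, T) -> item_ok (w', T') -> item_ok (w', T).
Proof. by move=> /and5P[a b c d _] /and5P[_ _ _ _ e]; apply/and5P. Qed.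

Lemma valid_swap w w' T T' I : T.1 = T'.1 -> valid ((w, T) :: (w', T') :: I) ->
  valid ((w', T) :: (w, T') :: I).
Proof.
move=> e [/= /and3P[o1 o2 o3] p1 p2]; split.
- by rewrite /= (item_ok_swap o1 o2) (item_ok_swap o2 o1).
- by rewrite -(permPl (item_edges_swap w w' I e)).
by apply: perm_trans p2; apply/permP => a /=; lia.
Qed.

Lemma valid_uniq I : valid I -> uniq (map hung_edge I) /\
  (forall c i, c \in I -> i \in I -> hung_edge c \notin eds i.2).
Proof.
case=> _ p _; have : uniq (item_edges I) by rewrite (perm_uniq p).
rewrite cat_uniq => /and3P[u /hasPn h _]; split=> // c i cI iI.
apply/negP => ce; have /h : hung_edge c \in flatten [seq eds i.2 | i <- I].
  by apply/flattenP; exists (eds i.2) => //; apply/mapP; exists i.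
by rewrite map_f.
Qed.

Lemma valid_ok I i : valid I -> i \in I -> item_ok i.
Proof. by case=> /allP h _ _ /h. Qed.

(** As long as fewer than k of the at least 2k items at a head fit, there is a
misfit and k others at the same head, so by [pick_item] an exchange of new
ends makes the first of them fit. *)
Lemma enough_fits I : valid I ->
  (forall v, col v = s -> 2 * k <= count (fun i => i.2.1 == v) I) ->
  exists I', valid I' /\ forall v, col v = s -> k <= count (fits_at v) I'.
Proof.
have [n] := ubnP (count misfit I); elim: n I => // n IHn I; rewrite ltnS => hn iI hI.
case: (boolP [forall v, (col v == s) ==> (k <= count (fits_at v) I)]).
  by move/forallP=> h; exists I; split=> // v /eqP vs; have := h v; rewrite vs.
case/forallPn=> v; rewrite negb_imply -ltnNge => /andP[/eqP vs ltk].
pose hb := [pred i : item | (i.2.1 == v) && misfit i].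
have split J : count (fun i => i.2.1 == v) J = count (fits_at v) J + count hb J.
  by elim: J => //= i J ->; rewrite /fits_at /misfit; case: (_ == v); case: (fits i) => /=; lia.
pose B := [seq i <- I | hb i].
have szB : k < size B.
  have -> : size B = count hb I by rewrite size_filter.
  have := hI v vs; rewrite split; move: ltk (count hb I) => + c; move: (count _ I) => d.
  by clear; lia.
have pI : perm_eq (B ++ [seq i <- I | predC hb i]) I by rewrite perm_filterC.
have inB i : i \in B -> [/\ i.2.1 = v, misfit i & item_ok i].
  by rewrite mem_filter => /andP[/andP[/eqP e b] /(valid_ok iI)].
have BI : {subset B <= I} by move=> i; rewrite mem_filter => /andP[].
have iI' : valid (B ++ [seq i <- I | predC hb i]) by apply: valid_perm iI; rewrite perm_sym.
have [uB _] := valid_uniq iI'; rewrite map_cat cat_uniq in uB.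
case/andP: uB => uB _.
move: pI; case defB : B uB szB inB => [|[w T] L] // uB szB inB pI.
have [Tv bT okT] := inB _ (mem_head _ _).
have [|//||||[w' T'] iL /= w'T] := pick_item (L := L) okT Tv.
- by move: bT; rewrite /misfit negbK.
- by apply/allP => i iL; have [] := inB i (mem_behead (s := _ :: _) iL).
- by move=> i iL; have [] := inB i (mem_behead (s := _ :: _) iL).
- by move: szB; rewrite /= ltnS.
have [T'v bT' okT'] := inB _ (mem_behead (s := _ :: _) iL).
pose R := rem (w', T') L ++ [seq i <- I | predC hb i].
have pI' : perm_eq I ((w, T) :: (w', T') :: R).
  rewrite perm_sym -(permPr pI) /= perm_cons -cat_cons perm_cat2r perm_sym.
  exact: perm_to_rem.
have i2 := valid_swap (etrans Tv (esym T'v)) (valid_perm pI' iI).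
apply: IHn i2 _.
  apply: leq_trans hn; rewrite (permP pI') /= bT bT' /= /misfit /fits /= w'T /=.
  by clear; case: (_ \in _); lia.
move=> u us; have := hI u us; by rewrite (permP pI') /= Tv T'v.
Qed.

Definition follows z w (t : V * seq V) := exists p1 p2, verts t = p1 ++ [:: z, w & p2].

Lemma follows_eds z w t : follows z w t -> edge2 z w \in eds t.
Proof.
case: t => x q [[|a p1] [p2]] /= [-> ->]; first by rewrite /eds /= mem_head.
by rewrite /eds /= pairmap_cat mem_cat /= !inE eqxx !orbT.
Qed.

Lemma valid_rotate w v p1 p2 R : valid ((w, (v, p1 ++ w :: p2)) :: R) ->
  valid ((w, (last v p1, rev (belast v p1) ++ w :: p2)) :: R).
Proof.
have lr : last (last v p1) (rev (belast v p1)) = v.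
  by case: p1 => //= z p; rewrite rev_cons last_rcons.
case=> /= /andP[/and5P[u1 a1 s1 c1 c2] oR] p q; split=> //=.
- rewrite oR andbT; apply/and5P; split=> //.
  + have e : perm_eq (verts (last v p1, rev (belast v p1) ++ w :: p2)) (verts (v, p1 ++ w :: p2)).
      rewrite /verts /= -cat_cons -rev_rcons -lastI -[v :: _ ++ _]cat_cons perm_cat2r.
      by rewrite perm_rev.
    by rewrite (perm_uniq e).
  + rewrite cat_path lr rev_path /=; move: a1; rewrite /= cat_path /= => /and3P[a1 a2 ->].
    rewrite (eq_path (e' := alt)) ?a1 /= ?andbT.
      by move: c1 c2; rewrite /alt /= => /eqP ->; rewrite eq_sym.
    by move=> x y; rewrite /alt /= eq_sym.
  + by move: s1; rewrite /= !size_cat size_rev size_belast.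
  move: a1; rewrite /= cat_path /alt /= => /and3P[_ + _]; move: c2 => /=.
  by clear; case: (col w); case: (col _); case: s.
apply: perm_trans p; rewrite /item_edges /= /hung_edge /= /eds /= !pairmap_cat /= lr.
apply/permP => a /=; have /permP/(_ a) := eds_rev v p1.
by rewrite /= !count_cat /= [edge2 v w]edge2C; clear; lia.
Qed.

(** The misfit (w, T) with head v exchanges its end with an item (w', T') that
fits, chosen such that (w', T) fits.  If w is not on T', nothing remains to be
done.  Otherwise attach the edge from v to w to T' and cut T' before w: this
gives a path with another head u on which the edge from u to w is hung, again a
misfit.  Meanwhile each head keeps its number of fitting items.  The heads
visited in this way never repeat: the last hypothesis says that an edge leading
to w from a visited vertex is only on paths with visited heads, so u, whose edge
to w is on T', is not visited as v is not. *)
Lemma reroute w T R (Vis : {set V}) : valid ((w, T) :: R) -> misfit (w, T) ->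
  (forall v, col v = s -> k <= count (fits_at v) R) -> T.1 \notin Vis ->
  (forall i z, i \in R -> follows z w i.2 -> z \in Vis -> i.2.1 \in Vis) ->
  exists I', [/\ valid I', forall v, col v = s -> k <= count (fits_at v) I' &
    count misfit I' <= count misfit R].
Proof.
have [n] := ubnP #|~: Vis|; elim: n w T R Vis => // n IHn w T R Vis; rewrite ltnS => hn.
move=> iI bT hR vVis hVis; have okT := valid_ok iI (mem_head _ _).
pose v := T.1; have vs : col v = s by case/and5P: okT => _ _ _ /eqP.
pose L := [seq i <- R | fits_at v i].
have inL i : i \in L -> [/\ i.2.1 = v, fits i & i \in R].
  by rewrite mem_filter => /andP[/andP[/eqP]].
have [uI dI] := valid_uniq iI.
have [|//||||[w' T'] iL /= w'T] := pick_item (L := L) okT (erefl v).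
- by move: bT; rewrite /misfit negbK.
- by apply: subseq_uniq uI => /=; rewrite eqxx; apply/map_subseq/filter_subseq.
- by apply/allP => i /inL[_ _ iR]; apply: (valid_ok iI); rewrite inE iR orbT.
- by move=> i /inL[].
- by rewrite size_filter; apply: hR.
have [/= T'v gT' iR] := inL _ iL.
have pR := perm_to_rem iR; set R' := rem _ R in pR.
have iI1 : valid ((w, T) :: (w', T') :: R') by apply: valid_perm iI; rewrite perm_cons.
have iI2 := valid_swap (esym T'v) iI1.
have gw'T : fits (w', T) by [].
have hgR u : count (fits_at u) R = (u == v) + count (fits_at u) R'.
  by rewrite (permP pR) /= /fits_at /= T'v gT' andbT eq_sym.
have badR : count misfit R = count misfit R' by rewrite (permP pR) /= /misfit gT'.
have hgT u : fits_at u (w', T) = (u == v) by rewrite /fits_at /= gw'T andbT eq_sym.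
case: (boolP (w \in verts T')) => wT'; last first.
  exists ((w', T) :: (w, T') :: R'); split=> // [u us|].
    by apply: leq_trans (hR u us) _; rewrite hgR /= hgT leq_add2l leq_addl.
  by rewrite /= {1 2}/misfit gw'T /fits /= wT' badR.
have iI3 : valid ((w, T') :: (w', T) :: R').
  by apply: valid_perm iI2; apply/permP => a /=; rewrite addnCA.
have wv : w != v.
  by apply/eqP => wv; case/and5P: okT => _ _ _ _; rewrite /= wv vs eqxx.
have R'R i : i \in R' -> i \in R by apply: mem_rem.
clearbody R'; clear gT' iL pR iI1 iI2.
case: T' T'v wT' iI3 iR => v' p' /= -> + + iR.
rewrite /verts inE (negbTE wv) /= => wp'; case/splitPr: wp' iR => p1 p2 iR iI3.
have iI4 := valid_rotate iI3; set u := last v p1 in iI4.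
have vw : edge2 v w = hung_edge (w, T) by [].
have fol : follows u w (v, p1 ++ w :: p2).
  by exists (belast v p1), p2; rewrite /verts /= -cat_cons lastI cat_rcons.
have uv : u != v.
  apply/eqP => uv; have := dI _ _ (mem_head _ _) (mem_behead (s := _ :: _) iR).
  by rewrite /= -vw -[in edge2 v w]uv (follows_eds fol).
have [||||i z|I' [iI' hI' bI']] := IHn w _ ((w', T) :: R') (v |: Vis) _ iI4.
- rewrite setCU; apply: leq_trans hn; rewrite (cardsD1 v (~: Vis)) inE vVis add1n ltnS.
  by apply/subset_leq_card/subsetP => x; rewrite !inE.
- by rewrite /misfit /fits negbK /verts /= inE mem_cat mem_head !orbT.
- by move=> x xs; apply: leq_trans (hR x xs) _; rewrite hgR /= hgT.
- rewrite !inE negb_or uv; apply/negP => uVis.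
  by have := hVis _ _ iR fol uVis; apply/negP.
- rewrite inE => /orP[/eqP -> _ _|/R'R iR1 fi]; first by rewrite !inE eqxx.
  rewrite !inE => /orP[/eqP zv|zV]; last by rewrite (hVis _ _ iR1 fi zV) orbT.
  have := dI _ _ (mem_head _ _) (mem_behead (s := _ :: _) iR1).
  by rewrite -vw -zv (follows_eds fi).
exists I'; split=> //; apply: leq_trans bI' _.
by rewrite /= /misfit gw'T badR.
Qed.

Lemma all_fits I : valid I -> (forall v, col v = s -> k <= count (fits_at v) I) ->
  exists I', valid I' /\ all fits I'.
Proof.
have [n] := ubnP (count misfit I); elim: n I => // n IHn I; rewrite ltnS => hn iI hI.
case: (boolP (all fits I)) => [gI|]; first by exists I.
rewrite -has_predC => /hasP[[w T] cI bT].
have pI := perm_to_rem cI; set R := rem _ I in pI.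
have [|||I' [iI' hI' bI']] := @reroute w T R set0 (valid_perm pI iI) bT.
- move=> v vs; have := hI v vs; rewrite (permP pI) /= {1}/fits_at /= (negbTE bT) andbF //.
- by rewrite inE.
- by move=> i z _ _; rewrite inE.
apply: IHn iI' hI'; apply: leq_trans hn; rewrite (permP pI) /= [misfit (w, T)]bT add1n ltnS.
exact: bI'.
Qed.

End Extension.

Lemma perm_map_lift (T1 T2 : eqType) (f : T1 -> T2) (s : seq T1) (t : seq T2) :
  perm_eq (map f s) t -> exists2 s', perm_eq s s' & map f s' = t.
Proof.
elim: t s => [|y t IHt] s p.
  by exists [::] => //; case: s p => // x s /perm_size.
have /mapP[x xs yx] : y \in map f s by rewrite (perm_mem p) mem_head.
have q := perm_to_rem xs.
have [|s' p' <-] := IHt (rem x s).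
  by rewrite -(perm_cons y) {1}yx -[_ :: _]/(map f (x :: rem x s)) -(permPl (perm_map f q)).
by exists (x :: s'); rewrite ?yx // (permPl q) perm_cons.
Qed.

Definition track (V : finType) (col : V -> bool) (j : nat) (s : bool) (t : V * seq V) :=
  [&& uniq (verts t), path (alt col) t.1 t.2, size t.2 == j & col t.1 == s].

(** Hang the new edges on the paths in any way that fits the heads.  By
exchanges at each head ([enough_fits]) k of them fit at each head, and then
the remaining misfits are removed one at a time ([all_fits]). *)
Lemma extend_paths (V : finType) (col : V -> bool) (s : bool) (j k : nat)
    (C : seq (V * seq V)) (H : seq (V * V)) :
  j <= 2 * k -> all (track col j s) C ->
  (forall e, e \in H -> col e.1 = s /\ col e.2 = ~~ s) ->
  perm_eq (map fst C) (map fst H) ->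
  (forall v, col v = s -> 2 * k <= count (pred1 v) (map fst C)) ->
  let E := [seq edge2 e.1 e.2 | e <- H] ++ flatten (map (@eds V) C) in
  uniq E ->
  exists C', [/\ all (track col j.+1 (~~ s)) C', perm_eq (flatten (map (@eds V) C')) E &
    perm_eq (map fst C') (map snd H)].
Proof.
move=> jk okC okH pCH hk E uE.
have [C0 pC C0H] := perm_map_lift pCH.
have szC : size (map snd H) = size C0.
  by rewrite size_map -(size_map fst H) -C0H size_map.
pose I := zip (map snd H) C0.
have I1 : map fst I = map snd H by apply: unzip1_zip; rewrite szC.
have I2 : map snd I = C0 by apply: unzip2_zip; rewrite szC.
have hI : map (@hung_edge V) I = [seq edge2 e.1 e.2 | e <- H].
  rewrite /I; move: C0H; clear; elim: H C0 => [|e H IH] [|t C] //= [h1 /IH ->].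
  by rewrite /hung_edge /= h1.
have okI : all (item_ok col s j) I.
  apply/allP => -[w t] iI; have tC : t \in C0 by rewrite -I2 (map_f snd iI).
  have : w \in map snd H by rewrite -I1 (map_f fst iI).
  case/mapP=> e /okH[_ e2] we; have := allP okC t; rewrite (perm_mem pC) => /(_ tC).
  by case/and4P=> a b c d; apply/and5P; split=> //=; rewrite we e2; case: (s).
have totI : perm_eq (item_edges I) E.
  rewrite /item_edges hI perm_cat2l (map_comp (@eds V) snd I) I2.
  by apply/perm_flatten/perm_map; rewrite perm_sym.
have iI : valid col s j E (map snd H) I by split=> //; rewrite I1.
have hI' v : col v = s -> 2 * k <= count (fun i : V * (V * seq V) => i.2.1 == v) I.
  move=> vs; apply: leq_trans (hk v vs) _; rewrite (permP (perm_map fst pC)) -I2 !count_map.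
  exact: leqnn.
have [J [iJ hJ]] := enough_fits jk uE iI hI'.
have [K [[okK totK fstK] gK]] := all_fits jk uE iJ hJ.
exists [seq (i.1, i.2.1 :: i.2.2) | i <- K]; split.
- apply/allP => _ /mapP[[w [v p]] iK ->].
  have /and5P[/= a b c /eqP d e] := allP okK _ iK.
  have g := allP gK _ iK; rewrite /track /verts /= {1}/alt /= d.
  rewrite -[_ \notin _]/(fits (w, (v, p))) g a b (eqP c) eqxx e /= .
  by move: e; case: (col w); case: (s).
- apply: perm_trans totK; rewrite -map_comp /item_edges; move: (K); clear; elim=> //= i K IH.
  rewrite /eds /= -/(eds _) edge2C perm_cons perm_sym perm_catCA perm_cat2l perm_sym.
  exact: IH.
by rewrite -map_comp.
Qed.

(** * Building the paths stage by stage *)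

Definition pair_edge (V : finType) (e : V * V) : {set V} := edge2 e.1 e.2.

Lemma count_enum (T : finType) (S : {set T}) (P : pred T) :
  count P (enum S) = #|[set e in S | P e]|.
Proof.
by rewrite -sum1_count big_enum_cond -sum1_card; apply: eq_bigl => e; rewrite inE.
Qed.

Lemma count_mem_perm (T : eqType) (s t : seq T) :
  (forall x, count_mem x s = count_mem x t) -> perm_eq s t.
Proof. by move=> h; apply/allP => x _; rewrite /= h. Qed.

Section Build.
Variables (V : finType) (A : {set V}) (k : nat) (E1 : {set V * V}).
Hypothesis sE1 : sided A E1.
Let col v := v \in A.

Lemma pair_edge_inj : {in E1 &, injective (@pair_edge V)}.
Proof.
move=> [a b] [a' b'] /sE1 /= [aA bA] /sE1 /= [a'A b'A] /setP e.
have := e a; rewrite /pair_edge !inE /= eqxx /= => /esym/orP[/eqP aa|/eqP ab]; last by rewrite ab (negbTE b'A) in aA.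
have := e b; rewrite /pair_edge !inE /= eqxx orbT => /esym/orP[/eqP ba|/eqP ->]; last by rewrite aa.
by rewrite ba a'A in bA.
Qed.

Definition end_of (s : bool) : V * V -> V := if s then fst else snd.

Lemma stage s j C L (S : {set V * V}) : j <= 2 * k -> all (track col j s) C ->
  perm_eq (flatten (map (@eds V) C)) (map (@pair_edge V) L) -> uniq (enum S ++ L) ->
  {subset S <= E1} -> {subset L <= E1} ->
  (forall v, count_mem v (map fst C) = fib (end_of s) S v) ->
  (forall v, col v = s -> 2 * k <= fib (end_of s) S v) ->
  exists C', [/\ all (track col j.+1 (~~ s)) C',
    perm_eq (flatten (map (@eds V) C')) (map (@pair_edge V) (enum S ++ L)) &
    forall v, count_mem v (map fst C') = fib (end_of (~~ s)) S v].
Proof.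
move=> jk okC pC uSL SE LE hC hk.
pose H := [seq (end_of s e, end_of (~~ s) e) | e <- enum S].
have HE : [seq edge2 e.1 e.2 | e <- H] = map (@pair_edge V) (enum S).
  rewrite /H -map_comp; apply: eq_map => e; rewrite /pair_edge /end_of /=.
  by case: (s) => //=; rewrite edge2C.
have [||||C' [okC' pC' fC']] := @extend_paths V col s j k C H jk okC.
- move=> _ /mapP[e + ->]; rewrite mem_enum => /SE /sE1 [eA eB]; rewrite /col /=.
  by case: (s); rewrite /= ?eA ?(negbTE eB).
- apply: count_mem_perm => v; rewrite hC /H -map_comp count_map count_enum.
  exact: eq_card.
- by move=> v /hk; rewrite -hC.
- rewrite HE (perm_uniq (perm_cat (perm_refl _) pC)) -map_cat map_inj_in_uniq //.
  move=> x y xs ys; apply: pair_edge_inj.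
    by move: xs; rewrite mem_cat mem_enum => /orP[/SE|/LE].
  by move: ys; rewrite mem_cat mem_enum => /orP[/SE|/LE].
exists C'; split=> //.
  by rewrite map_cat (perm_trans pC') // HE perm_cat2l.
move=> v; rewrite (permP fC') /H -map_comp count_map count_enum.
exact: eq_card.
Qed.

Lemma two_stages (U : {set V * V}) (qt : V -> nat) Xs j C L :
  j + 2 * size Xs <= 2 * k -> (forall a, a \in A -> 2 * k <= qt a) ->
  all (track col j true) C ->
  perm_eq (flatten (map (@eds V) C)) (map (@pair_edge V) L) ->
  uniq (flatten [seq enum Y : seq (V * V) | Y : {set V * V} <- Xs] ++ L) -> {subset L <= E1} ->
  (forall v, count_mem v (map fst C) = qt v) ->
  (forall Y : {set V * V}, Y \in Xs -> {subset Y <= E1}) ->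
  (forall (Y : {set V * V}) v, Y \in Xs -> fib fst (Y :&: U) v = qt v /\ fib fst (Y :\: U) v = qt v) ->
  (forall (Y : {set V * V}) v, Y \in Xs -> fib snd (Y :&: U) v = fib snd (Y :\: U) v /\
     (v \notin A -> 2 * k <= fib snd (Y :\: U) v)) ->
  exists C', [/\ all (track col (j + 2 * size Xs) true) C',
    perm_eq (flatten (map (@eds V) C')) (map (@pair_edge V) (flatten [seq enum Y : seq (V * V) | Y : {set V * V} <- Xs] ++ L)) &
    forall v, count_mem v (map fst C') = qt v].
Proof.
move=> + hq; elim: Xs j C L => [|Y Xs IH] j C L hj okC pC uL LE hC XE h1 h2.
  by exists C; rewrite /= muln0 addn0.
have YX : Y \in Y :: Xs by rewrite mem_head.
have YE := XE Y YX; have hY v := h1 Y v YX; have hY2 v := h2 Y v YX.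
have pY : perm_eq (enum (Y :\: U) ++ enum (Y :&: U)) (enum Y).
  apply: uniq_perm; rewrite ?cat_uniq ?enum_uniq ?andbT //=.
    by apply/hasPn => e; rewrite !mem_enum !inE => /andP[_ ->].
  by move=> e; rewrite mem_cat !mem_enum !inE; case: (e \in U); rewrite ?andbF ?andbT ?orbF.
move: uL; rewrite /= -catA; set R := flatten _ => uL.
have pL : perm_eq (R ++ (enum (Y :\: U) ++ enum (Y :&: U) ++ L)) (enum Y ++ R ++ L).
  apply/permP => a; have h := permP pY a; rewrite count_cat in h.
  by rewrite !count_cat -h addnCA -[RHS]addnA; congr (_ + _); apply: addnCA.
have uL' : uniq (R ++ (enum (Y :\: U) ++ enum (Y :&: U) ++ L)) by rewrite (perm_uniq pL).
have uL2 : uniq (enum (Y :\: U) ++ enum (Y :&: U) ++ L).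
  by move: uL'; rewrite cat_uniq => /and3P[].
have uL1 : uniq (enum (Y :&: U) ++ L) by move: uL2; rewrite cat_uniq => /and3P[].
have j2 : j.+1 < 2 * k by move: hj; rewrite /=; clear; lia.
have [|||||C1 [okC1 pC1 hC1]] := @stage true j C L (Y :&: U) _ okC pC uL1.
- by apply: ltnW; apply: ltnW.
- by move=> e /setIP[/YE].
- by [].
- by move=> v; rewrite hC; have [] := hY v.
- by move=> v vA; rewrite /end_of; have [-> _] := hY v; apply: hq.
have [|||||C2 [okC2 pC2 hC2]] := @stage false j.+1 C1 (enum (Y :&: U) ++ L) (Y :\: U) _ okC1 pC1 uL2.
- exact: ltnW.
- by move=> e /setDP[/YE].
- by move=> e; rewrite mem_cat mem_enum => /orP[/setIP[/YE]|/LE].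
- by move=> v; rewrite hC1 /end_of /=; have [] := hY2 v.
- by move=> v vA; rewrite /end_of; have [_] := hY2 v; apply; rewrite -[v \in A]/(col v) vA.
have [||||||C' [okC' pC' hC']] := IH j.+2 C2 _ _ okC2 pC2 uL'.
- by move: hj; rewrite /=; clear; lia.
- by move=> e; rewrite !mem_cat !mem_enum => /or3P[/setDP[/YE]|/setIP[/YE]|/LE].
- by move=> v; rewrite hC2 /=; have [] := hY v.
- by move=> Z ZX; apply: XE; rewrite inE ZX orbT.
- by move=> Z v ZX; apply: h1; rewrite inE ZX orbT.
- by move=> Z v ZX; apply: h2; rewrite inE ZX orbT.
exists C'; split=> //; first by rewrite (_ : j + _ = j.+2 + 2 * size Xs) //=; clear; lia.
exact: perm_trans pC' (perm_map _ pL).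
Qed.
End Build.

(** * Path lists when the degrees on one side are divisible *)

Section HalfMain.
Variables (V : finType) (A : {set V}) (k : nat) (E1 : {set V * V}) (T : nat -> {set V * V}).
Hypotheses (k0 : 0 < k) (V1 : 1 < #|V|) (sE1 : sided A E1).
Let m := 2 * k + 1.
Hypothesis dvE1 : forall a, m %| fib fst E1 a.
Hypothesis TE1 : forall i, i < m * m.+1 -> T i \subset E1.
Hypothesis spT : forall i, i < m * m.+1 -> spanning (T i).
Hypothesis dT : forall i j, i < m * m.+1 -> j < m * m.+1 -> i != j -> [disjoint T i & T j].

Lemma npaths_large a : a \in A -> 2 * k <= npaths k E1 a.
Proof.
move=> aA; have m0 : 0 < m by rewrite /m addn1.
rewrite -(leq_pmul2l m0) -(npathsE dvE1).
have h : m * m.+1 <= fib fst (\bigcup_(i < m * m.+1) T i) a.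
  rewrite -[X in X <= _]card_ord; apply: fib_bigcup.
    by move=> i j ij; apply: dT.
  move=> i; apply: (spanning_fst (A := A)) => //; first exact: spT.
  exact: sidedS (TE1 (ltn_ord i)) sE1.
apply: leq_trans (leq_trans h (fibS fst a _)).
  by rewrite leq_mul2l /m; clear; lia.
by apply/bigcupsP => i _; apply: TE1.
Qed.

(** The vertices of the auxiliary digraph of [arc_classes] are [inl a] for a in
A and [inr b] for b outside A; the arcs of U lead from left to right, the others
back. *)
Lemma path_list : exists C : seq (V * seq V),
  all (fun t => uniq (verts t) && (size t.2 == m)) C /\
  perm_eq (flatten (map (@eds V) C)) (map (@pair_edge V) (enum E1)).
Proof.
have [M [ME M1 F1 F2 F3]] := even_remainder k0 V1 sE1 dvE1 TE1 spT dT.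
set F := E1 :\: M in F1 F2 F3; pose qt := npaths k E1.
have FE : F \subset E1 by apply: subsetDl.
have sF : sided A F := sidedS FE sE1.
have [|//|U [UF U1 U2]] := @euler_split _ V V fst snd F.
  by move=> a; rewrite F1 -mulnA mul2n odd_double.
pose t (e : V * V) : V + V := if e \in U then inl e.1 else inr e.2.
pose h (e : V * V) : V + V := if e \in U then inr e.2 else inl e.1.
pose q (w : V + V) := match w with inl a => qt a | inr b => if b \in A then 0 else 2 * k end.
have tl (Y : {set V * V}) a : fib t Y (inl a) = fib fst (Y :&: U) a.
  apply: eq_card => e; rewrite !inE /t; case: (e \in U); rewrite ?andbT ?andbF //.
have tr (Y : {set V * V}) b : fib t Y (inr b) = fib snd (Y :\: U) b.
  by apply: eq_card => e; rewrite !inE /t; case: (e \in U); rewrite ?andbT ?andbF.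
have hl (Y : {set V * V}) a : fib h Y (inl a) = fib fst (Y :\: U) a.
  by apply: eq_card => e; rewrite !inE /h; case: (e \in U); rewrite ?andbT ?andbF.
have hr (Y : {set V * V}) b : fib h Y (inr b) = fib snd (Y :&: U) b.
  by apply: eq_card => e; rewrite !inE /h; case: (e \in U); rewrite ?andbT ?andbF.
have FU : F :&: U = U by apply/setIidPr.
have D1 a : fib fst (F :\: U) a = fib fst U a.
  by have := U1 a; rewrite (fibD fst a UF) mul2n -addnn => /addnI.
have D2 b : fib snd (F :\: U) b = fib snd U b.
  by have := U2 b; rewrite (fibD snd b UF) mul2n -addnn => /addnI.
have Uq a : fib fst U a = k * qt a.
  by have := U1 a; rewrite F1 -mulnA => /eqP; rewrite eqn_mul2l => /eqP.
have bal w : fib t F w = fib h F w.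
  by case: w => [a|b]; rewrite ?tl ?tr ?hl ?hr FU ?D1 ?D2.
have hq w : k * q w <= fib t F w.
  case: w => [a|b]; rewrite ?tl ?tr ?FU ?Uq ?D2 //=.
  case: ifP => bA; first by rewrite muln0.
  have := F3 b (negbT bA); rewrite -U2 -[4]/(2 * 2) -!mulnA leq_pmul2l //.
  by rewrite mulnCA.
have [Xs [sz pX XF h1 h2]] := arc_classes k0 bal hq.
set L := flatten _ in pX.
pose C0 := flatten [seq nseq (qt a) (a, [::] : seq V) | a <- enum A].
have C0a : all (track (fun v => v \in A) 0 true) C0.
  apply/allP => x /flattenP[_ /mapP[a + ->]]; rewrite mem_enum => aA /nseqP[-> _].
  by rewrite /track /= aA.
have C0e : flatten (map (@eds V) C0) = [::].
  apply/eqP; rewrite -nilpE /nilp size_flatten /shape -map_comp sumnE big_map big1_seq //.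
  by move=> x /andP[_ /flattenP[_ /mapP[a _ ->]]] /nseqP[-> _].
have C0c v : count_mem v (map fst C0) = qt v.
  rewrite /C0 map_flatten count_flatten -!map_comp sumnE big_map.
  rewrite (eq_bigr (fun a => (a == v) * qt a)) => [|a _]; last first.
    by rewrite /= map_nseq count_nseq.
  rewrite big_enum_cond /=; case: (boolP (v \in A)) => vA.
    by rewrite (bigD1 v) ?vA //= eqxx mul1n big1 ?addn0 // => a /andP[_ /negbTE ->].
  rewrite big1 => [|a /andP[aA _]]; last by case: eqP => // av; rewrite av (negbTE vA) in aA.
  by rewrite /qt /npaths (sided_fst sE1 vA) div0n.
have uX : uniq L.
  by rewrite (perm_uniq pX) enum_uniq.
have [||||||||C1 [C1a C1e C1c]] := @two_stages V A k E1 sE1 U qt Xs 0 C0 [::] _ npaths_large C0a.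
- by rewrite sz.
- by rewrite C0e.
- by rewrite cats0.
- by [].
- exact: C0c.
- by move=> Y YX e eY; apply: (subsetP FE); apply: (subsetP (XF Y YX)).
- move=> Y v YX; have e1 : fib t F (inl v) = k * q (inl v) by rewrite tl FU Uq.
  have := h2 Y (inl v) YX e1; have [+ _] := h1 Y (inl v) YX.
  by rewrite tl hl => -> ->.
- move=> Y v YX; have [] := h1 Y (inr v) YX; rewrite tr hr => -> /=; split=> //.
  by move=> vA; rewrite (negbTE vA) in b.
rewrite cats0 in C1e.
have uML : uniq (enum M ++ L).
  rewrite cat_uniq enum_uniq uX andbT /=; apply/hasPn => e; rewrite (perm_mem pX) !mem_enum inE.
  by case/andP.
have [|||||C2 [C2a C2e C2c]] := @stage V A k E1 sE1 true _ C1 L M _ C1a C1e uML.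
- by rewrite add0n sz.
- exact/subsetP.
- by move=> e; rewrite (perm_mem pX) mem_enum => /(subsetP FE).
- by move=> v; rewrite C1c /end_of M1.
- by move=> v vA; rewrite /end_of M1; apply: npaths_large.
exists C2; split.
  apply: sub_all C2a => x /and4P[-> _ /eqP -> _]; by rewrite add0n sz /m addn1 eqxx.
apply: perm_trans C2e _; apply: perm_map.
rewrite (perm_trans (y := enum M ++ enum F)) ?perm_cat2l //.
apply: uniq_perm; rewrite ?cat_uniq ?enum_uniq ?andbT //=.
  by apply/hasPn => e; rewrite !mem_enum inE => /andP[].
move=> e; rewrite mem_cat !mem_enum inE; case: (boolP (e \in M)) => //= /(subsetP ME) //.
Qed.
End HalfMain.

(** * Splitting the edges by an orientation *)

Section Split.
Import GRing.Theory Num.Theory Order.TTheory.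
Local Open Scope ring_scope.
Variables (V : finType) (A : {set V}).
Implicit Types (X S R : {set V * V}).

Lemma net_set (es : seq (V * V)) f : uniq es -> net es f ->
  exists S, forall v, f v = \sum_(e <- es) (if e \in S then arc_net e v else - arc_net e v).
Proof.
elim: es f => [|e es IH] f /=; first by move=> _ h; exists set0 => v; rewrite h big_nil.
case/andP=> ees ues [f' [/(IH _ ues) [S hS] h]].
have eqS (S' : {set V * V}) v : (forall x, x != e -> (x \in S') = (x \in S)) ->
    \sum_(x <- es) (if x \in S' then arc_net x v else - arc_net x v) = f' v.
  move=> h'; rewrite hS; apply: eq_big_seq => x xes; rewrite h' //.
  by apply: contraNneq ees => <-.
case: h => h; [exists (e |: S) | exists (S :\ e)] => v; rewrite big_cons h eqS.
- by rewrite setU11 addrC.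
- by move=> x xe; rewrite !inE (negbTE xe).
- by rewrite !inE eqxx addrC.
by move=> x xe; rewrite !inE xe.
Qed.

Lemma sum_arc_net_set X v : \sum_(e in X) arc_net e v = (fib fst X v)%:Z - (fib snd X v)%:Z.
Proof.
have h (p : V * V -> V) : \sum_(e in X) (v == p e)%:Z = (fib p X v)%:Z.
  rewrite /fib -sum1_card -natz natr_sum big_mkcond [RHS]big_mkcond /=.
  apply: eq_bigr => e _; rewrite inE eq_sym; case: (e \in X) => //=.
  by case: (p e == v).
by rewrite /arc_net sumrB !h.
Qed.

(** [mod_orientation] without half-edges: the number of edges leaving v is to be
- s v mod m, and the net degree of v is twice this number minus its degree. *)
Lemma oriented_split (m : nat) R (s : V -> nat) : (1 < m)%N -> sided A R ->
  (forall C : {set V}, C != set0 -> C != setT -> (3 * m <= #|cut R C| + 2)%N) ->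
  (m %| \sum_v s v + #|R|)%N ->
  exists S, [/\ S \subset R, forall a, a \in A -> (m %| s a + fib fst S a)%N &
    forall b, b \notin A -> (m %| s b + fib snd (R :\: S) b)%N].
Proof.
move=> m1 sR cutR arc_net.
have m2 : 2 <= m%:Z :> int by lia.
pose d v := (fib fst R v + fib snd R v)%N.
pose b v : int := - (2 * (s v)%:Z) - (d v)%:Z.
have bdE (C : {set V}) : cross_num (enum R) C = #|cut R C|%:Z by rewrite /cross_num count_enum.
have bd1 v : cross_num (enum R) [set v] = (d v)%:Z.
  rewrite /cross_num count_enum /d /fib; congr Posz; rewrite -cardsUI [X in (_ + X)%N]eq_card0.
    rewrite addn0; apply: eq_card => e; rewrite !inE /crosses !inE.
    case: (boolP (e \in R)) => //= /sR [e1 e2].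
    case: (eqVneq e.1 v) => [<-|_] /=; last by case: (_ == v).
    by case: (eqVneq e.2 e.1) => // e21; rewrite e21 e1 in e2.
  move=> e; rewrite !inE; case: (boolP (e \in R)) => //= /sR [e1 e2].
  by apply/negP => /andP[/eqP e1v /eqP e2v]; rewrite e2v -e1v e1 in e2.
have sumb : cong m%:Z (fsum b setT) 0.
  have -> : fsum b setT = - (2 * (\sum_v s v + #|R|)%N%:Z).
    rewrite /fsum /b big_split /= !sumrN -mulr_sumr.
    have hp (F : V -> nat) : \sum_(v in [set: V]) (F v)%:Z = (\sum_v F v)%N%:Z.
      by rewrite -natz natr_sum; apply: eq_big => v; rewrite ?inE // natz.
    rewrite !hp /d big_split /= !card_fibers; move: (\sum_v s v)%N #|R| => x y.
    by clear; lia.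
  by rewrite /cong subr0 dvdzE abszN !abszM /= dvdn_pmul2l.
have [|f [nf fb]] := @mod_orientation V m%:Z m2 setT (enum R) (fun=> 0) (fun=> 0) b set0.
  split.
  - by apply/allP => e _; rewrite /inside !inE.
  - by [].
  - by move=> v _; rewrite bd1 /b; lia.
  - exact: sumb.
  - by left.
  - rewrite [X in X <= _]big1 //; have := mdist_bound m2 (fsum (fadd b (fun=> 0)) setT).
    by move: (mdist _ _); clear -m2; lia.
  move=> C _ C0 CT _; rewrite bdE [fsum (fun=> 0) C]big1 // addr0; have := cutR C C0 CT.
  have := mdist_bound m2 (fsum (fadd b (fun=> 0)) C).
  by move: (mdist _ _); clear; lia.
have [S0 fS] := net_set (enum_uniq R) nf.
pose S := R :&: S0; have SR : S \subset R by apply: subsetIl.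
have fE v : f v = (fib fst S v)%:Z - (fib snd S v)%:Z - ((fib fst (R :\: S) v)%:Z - (fib snd (R :\: S) v)%:Z).
  rewrite fS big_enum /= -!sum_arc_net_set (big_setID S) /= (setIidPr SR); congr (_ + _).
    by apply: eq_bigr => e; rewrite inE => /andP[_ ->].
  rewrite -sumrN; apply: eq_bigr => e; rewrite !inE => /andP[+ eR].
  by rewrite eR /= => /negbTE ->.
have sS : sided A S := sidedS SR sR.
have sD : sided A (R :\: S) := sidedS (subsetDl _ _) sR.
have half (x y z w : int) (n : nat) : cong m%:Z (x - y) (- (2 * z) - w) -> w = x + y -> z + x = n%:Z -> (m %| n)%N.
  rewrite /cong => h wE zx; move: h; rewrite wE.
  have -> : x - y - (- (2 * z) - (x + y)) = 2 * n%:Z by rewrite -zx; ring.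
  by rewrite dvdzE !abszM /= dvdn_pmul2l.
exists S; split=> // v vA; have := fb v (in_setT v); rewrite fE /b /d.
  rewrite (sided_snd sS vA) (sided_snd sD vA) (sided_snd sR vA) addn0 !subr0.
  by move/half; apply; rewrite ?(fibD fst v SR).
rewrite (sided_fst sS vA) (sided_fst sD vA) (sided_fst sR vA) add0n !sub0r opprK.
rewrite addrC => /half; apply; rewrite ?(fibD snd v SR) //.
by rewrite PoszD addrC.
Qed.
End Split.

(** * Decomposition of the whole graph *)

Lemma uniq_flatten_inj (T1 : eqType) (T2 : eqType) (F : T1 -> seq T2) (C : seq T1) x y f :
  uniq (flatten (map F C)) -> x \in C -> y \in C -> f \in F x -> f \in F y -> x = y.
Proof.
elim: C => //= z C IH; rewrite cat_uniq => /and3P[_ /hasPn h u].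
have out w : w \in C -> f \in F w -> f \notin F z.
  by move=> wC fw; apply: h; apply/flattenP; exists (F w) => //; apply: map_f.
rewrite !inE => /orP[/eqP ->|xC] /orP[/eqP ->|yC] // fx fy.
- by rewrite (negbTE (out y yC fy)) in fx.
- by rewrite (negbTE (out x xC fx)) in fy.
exact: IH.
Qed.

Lemma eds_verts (V : finType) (t : V * seq V) f : f \in eds t -> {subset f <= verts t}.
Proof.
case: t => x p; rewrite /eds /verts /=; elim: p x => //= y p IH x.
rewrite inE => /orP[/eqP ->|/IH h] u.
  by rewrite !inE => /orP[/eqP ->|/eqP ->]; rewrite eqxx ?orbT.
by move=> /h; rewrite !inE => ->; rewrite orbT.
Qed.

Section Swap.
Variables (V : finType).
Definition swap_pair (e : V * V) := (e.2, e.1).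
Lemma swap_pair_inj : injective swap_pair. Proof. by move=> [a b] [c d] [-> ->]. Qed.
Implicit Types X : {set V * V}.

Lemma fib_swap X v : fib fst (swap_pair @: X) v = fib snd X v.
Proof.
rewrite /fib -[RHS](card_imset _ swap_pair_inj); apply: eq_card => e; rewrite inE.
apply/andP/imsetP => [[/imsetP[x xX ->] h]|[x]].
  by exists x; rewrite // inE xX.
by rewrite inE => /andP[xX xv] ->; rewrite imset_f.
Qed.

Lemma spanning_swap X : spanning X -> spanning (swap_pair @: X).
Proof.
move=> spX x y; apply: connect_sub (spX x y) => u v h; apply: connect1; rewrite /erel /=.
by case/orP: h => h; rewrite (imset_f swap_pair h) ?orbT.
Qed.

Lemma pair_edge_swap X : perm_eq (map (@pair_edge V) (enum (swap_pair @: X))) (map (@pair_edge V) (enum X)).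
Proof.
have -> : map (@pair_edge V) (enum X) = map (@pair_edge V) (map swap_pair (enum X)).
  by rewrite -map_comp; apply: eq_map => e; rewrite /pair_edge /= edge2C.
apply: perm_map; apply: uniq_perm; rewrite ?(map_inj_uniq swap_pair_inj) ?enum_uniq //.
move=> e; rewrite mem_enum; apply/imsetP/mapP => [[x xX ->]|[x]].
  by exists x; rewrite ?mem_enum.
by rewrite mem_enum; exists x.
Qed.
End Swap.

Lemma spanning_cut (V : finType) (X : {set V * V}) (C : {set V}) : spanning X ->
  C != set0 -> C != setT -> 0 < #|cut X C|.
Proof.
move=> spX /set0Pn[x xC] CT; rewrite lt0n cards_eq0; apply: contra CT => /eqP cX.
apply/eqP/setP => y; rewrite inE.
have cl : closed (erel X) C.
  apply: intro_closed; first exact: connect_erel_sym.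
  move=> u v h uC; apply: contraT => vC; move/setP: cX.
  by case/orP: h => h /(_ (_, _)); [move=> /(_ u v) | move=> /(_ v u)]; rewrite !inE h /= uC (negbTE vC).
by rewrite -(closed_connect cl (spX x y)).
Qed.

Section Assembly.
Variables (G : sgraph) (A : {set G}).
Hypothesis hA : forall x y : G, adj x y -> (x \in A) != (y \in A).

Definition bip_edges : {set G * G} := [set e | (e.1 \in A) && adj e.1 e.2].

Lemma bip_sided : sided A bip_edges.
Proof. by move=> e; rewrite inE => /andP[eA /hA]; rewrite eA; case: (_ \in A). Qed.

Lemma edges_bip : edges G = [set pair_edge e | e in bip_edges].
Proof.
apply/setP => f; apply/imset2P/imsetP => [[x y _ xy ->]|[e]].
  have {}xy : adj x y := xy; have := hA xy; case: (boolP (x \in A)) => xA yA.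
    by exists (x, y); rewrite // inE xA.
  exists (y, x); last by rewrite /pair_edge edge2C.
  by rewrite inE /= adj_sym xy andbT; case: (_ \in A) yA.
by rewrite inE => /andP[_ h] ->; exists e.1 e.2.
Qed.

(** A smaller cut would be a set of edges whose deletion disconnects G. *)
Lemma connected_cut n : edge_connected G n -> forall C : {set G}, C != set0 -> C != setT ->
  n <= #|cut bip_edges C|.
Proof.
move=> con C /set0Pn[x xC] CT; rewrite leqNgt; apply: contra CT => lt.
pose F := [set pair_edge e | e in cut bip_edges C].
have FE : F \subset edges G.
  by rewrite edges_bip; apply: imsetS; apply/subsetP => e; rewrite inE => /andP[].
have ltF : #|F| < n := leq_ltn_trans (leq_imset_card _ _) lt.
have cross u v : adj u v -> u \in C -> v \notin C -> [set u; v] \in F.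
  move=> uv uC vC; have := hA uv; case: (boolP (u \in A)) => uA vA.
    by apply/imsetP; exists (u, v); rewrite // !inE uA uv uC (negbTE vC).
  apply/imsetP; exists (v, u); last by rewrite /pair_edge edge2C.
  rewrite !inE /= uC (negbTE vC) adj_sym uv.
  by move: vA; case: (v \in A).
apply/eqP/setP => y; rewrite inE.
have sym : connect_sym (del_edges F).
  by apply: sym_connect_sym => u v; rewrite /del_edges /= adj_sym setUC.
have cl : closed (del_edges F) C.
  apply: intro_closed => // u v /andP[uv nF] uC; apply: contraT => vC.
  by rewrite cross in nF.
by rewrite -(closed_connect cl (con F FE ltF x y)).
Qed.

Definition path_graph (t : G * seq G) : pregraph G := ([set:: verts t], [set:: eds t]).

Lemma decomposition_of_list (l : nat) (C : seq (G * seq G)) :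
  all (fun t => uniq (verts t) && (size t.2 == l)) C ->
  perm_eq (flatten (map (@eds G) C)) (map (@pair_edge G) (enum bip_edges)) ->
  path_decomposition l [set:: map path_graph C].
Proof.
move=> hC pC; have mE f : (f \in flatten (map (@eds G) C)) = (f \in edges G).
  rewrite (perm_mem pC) edges_bip; apply/mapP/imsetP => [[e]|[e eE ->]].
    by rewrite mem_enum; exists e.
  by exists e; rewrite ?mem_enum.
have uC : uniq (flatten (map (@eds G) C)).
  rewrite (perm_uniq pC) map_inj_in_uniq ?enum_uniq // => x y; rewrite !mem_enum.
  exact: pair_edge_inj bip_sided x y.
split.
- move=> H; rewrite inE => /mapP[t tC ->]; have /andP[ut /eqP st] := allP hC t tC.
  split; last by exists t.1, t.2.
  split=> [|f]; last first.
    by rewrite inE => ft; apply/subsetP => u uf; rewrite inE; apply: (eds_verts ft).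
  apply/subsetP => f; rewrite inE -mE => ft; apply/flattenP; exists (eds t) => //.
  exact: map_f.
- move=> H1 H2; rewrite !inE => /mapP[t1 t1C ->] /mapP[t2 t2C ->] ne.
  rewrite -setI_eq0; apply/eqP/setP => f; rewrite !inE; apply/negP => /andP[f1 f2].
  by rewrite (uniq_flatten_inj uC t1C t2C f1 f2) eqxx in ne.
apply/setP => f; rewrite -mE; apply/bigcupP/flattenP.
  case=> H; rewrite inE => /mapP[t tC ->]; rewrite inE => ft.
  by exists (eds t) => //; apply: map_f.
case=> _ /mapP[t tC ->] ft; exists (path_graph t); last by rewrite inE.
by rewrite inE map_f.
Qed.
End Assembly.

Theorem theorem7p1 (k r : nat) (G : sgraph) (k_gt0 : 0 < k)
    (def_r : r = (2 * k + 1) * (2 * k + 2))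
    (bipG : bipartite G)
    (connG : edge_connected G (2 * (6 * k + 2 * r + 1)))
    (dvdG : 2 * k + 1 %| #|edges G|) :
  exists D : {set pregraph G}, path_decomposition (2 * k + 1) D.
Proof.
have [A hA] := bipG; case: (leqP #|G| 1) => V1.
  exists [set:: map (@path_graph G) [::]]; apply: (decomposition_of_list hA) => //.
  suff -> : bip_edges A = set0 by rewrite enum_set0.
  apply/setP => e; rewrite !inE; apply/negP => /andP[_].
  have -> : e.1 = e.2 by move/card_le1_eqP: V1 => h; apply: h.
  by rewrite adj_irr.
set m := 2 * k + 1; set E0 := bip_edges A; pose t := 6 * k + 2 * r + 1.
have sE0 : sided A E0 := bip_sided hA.
have [||X [XE spX dX]] := @nash_williams G E0 t.
- exact: ltnW.
- exact: connected_cut hA _ connG.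
pose T i := if insub i is Some j then X j else set0 : {set G * G}.
have TX i (it : i < t) : T i = X (Ordinal it) by rewrite /T insubT.
have TE i : i < t -> T i \subset E0 by move=> it; rewrite TX.
have spT i : i < t -> spanning (T i) by move=> it; rewrite TX.
have dT i j : i < t -> j < t -> i != j -> [disjoint T i & T j].
  by move=> it jt ij; rewrite !TX; apply: dX.
have sT i : i < t -> sided A (T i) by move=> it; apply: sidedS (TE i it) sE0.
have rm : r = m * m.+1 by rewrite def_r /m; clear; lia.
have lt1 i : i < r -> i < t by rewrite /t; clear; lia.
have lt2 i : i < r -> r + i < t by rewrite /t; clear; lia.
(* 6k + 1 = 3m - 2 sets remain after the two times r reserved ones *)
have lt3 i : i < 6 * k + 1 -> r + r + i < t by rewrite /t; clear; lia.
pose H1 := \bigcup_(i < r) T i; pose H2 := \bigcup_(i < r) T (r + i).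
pose R := E0 :\: (H1 :|: H2).
have H1E : H1 \subset E0 by apply/bigcupsP => i _; apply/TE/lt1.
have H2E : H2 \subset E0 by apply/bigcupsP => i _; apply/TE/lt2.
have dH : [disjoint H1 & H2].
  rewrite -setI_eq0; apply/eqP/setP => e; rewrite !inE; apply/negP.
  case/andP=> /bigcupP[i _ ei] /bigcupP[j _ ej].
  have li := ltn_ord i; have := dT _ _ (lt1 i li) (lt2 j (ltn_ord j)).
  rewrite -setI_eq0 => h; have /eqP/setP/(_ e) : T i :&: T (r + j) == set0.
    by apply: h; clear -li; lia.
  by rewrite !inE ei ej.
have TR i : i < 6 * k + 1 -> T (r + r + i) \subset R.
  move=> ik; apply/subsetP => e eT; rewrite in_setD in_setU negb_or.
  rewrite (subsetP (TE _ (lt3 i ik)) _ eT) andbT; apply/andP; split; apply/negP.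
    case/bigcupP=> j _ ej; have lj := ltn_ord j; have := dT _ _ (lt1 j lj) (lt3 i ik).
    rewrite -setI_eq0 => h; have /eqP/setP/(_ e) : T j :&: T (r + r + i) == set0.
      by apply: h; clear -lj; lia.
    by rewrite !inE ej eT.
  case/bigcupP=> j _ ej; have lj := ltn_ord j; have := dT _ _ (lt2 j lj) (lt3 i ik).
  rewrite -setI_eq0 => h; have /eqP/setP/(_ e) : T (r + j) :&: T (r + r + i) == set0.
    by apply: h; clear -lj; lia.
  by rewrite !inE ej eT.
have RE : R \subset E0 by apply: subsetDl.
have sR := sidedS RE sE0; have sH1 := sidedS H1E sE0; have sH2 := sidedS H2E sE0.
have cutR (C : {set G}) : C != set0 -> C != setT -> 3 * m <= #|cut R C| + 2.
  move=> C0 CT; pose c (e : G * G) := (e.1 \in C) != (e.2 \in C).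
  have cE (Y : {set G * G}) : #|cut Y C| = fib c Y true.
    by apply: eq_card => e; rewrite !inE eqb_id.
  have h : 6 * k + 1 <= fib c (\bigcup_(i < 6 * k + 1) T (r + r + i)) true.
    rewrite -[X in X <= _]card_ord; apply: fib_bigcup => [i j ij|i].
      by apply: dT; rewrite ?lt3 // eqn_add2l.
    by rewrite -cE; apply: spanning_cut => //; apply/spT/lt3.
  have : 6 * k + 1 <= #|cut R C|.
    rewrite cE; apply: leq_trans h (fibS _ _ _); apply/bigcupsP => i _; exact: TR.
  by rewrite /m; clear; lia.
pose s v := fib fst H1 v + fib snd H2 v.
have m1 : 1 < m by rewrite /m; clear -k_gt0; lia.
have dvR : m %| \sum_v s v + #|R|.
  rewrite big_split /= !card_fibers -/m.
  have -> : #|H1| + #|H2| = #|H1 :|: H2|.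
    by rewrite cardsU (disjoint_setI0 dH) cards0 subn0.
  have HE : H1 :|: H2 \subset E0 by rewrite subUset H1E.
  have := cardsID (H1 :|: H2) E0; rewrite (setIidPr HE) => ->.
  by rewrite -(card_in_imset (pair_edge_inj sE0)) -edges_bip.
have [S [SR dv1 dv2]] := oriented_split m1 sR cutR dvR.
have dHR (H Y : {set G * G}) : H \subset H1 :|: H2 -> Y \subset R -> [disjoint H & Y].
  move=> hH hY; apply: (disjointW hH hY); rewrite disjoint_sym -setI_eq0.
  by apply/eqP/setP => e; rewrite !inE; do 2 case: (_ \in _); rewrite ?andbF.
pose G1 := H1 :|: S; pose G2 := H2 :|: (R :\: S).
have dvG1 a : m %| fib fst G1 a.
  rewrite fibU; last by apply: dHR => //; apply: subsetUl.
  case: (boolP (a \in A)) => aA; last first.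
    by rewrite (sided_fst sH1 aA) (sided_fst (sidedS SR sR) aA).
  by have := dv1 a aA; rewrite /s (sided_snd sH2 aA) addn0.
have dvG2 b : m %| fib snd G2 b.
  rewrite fibU; last by apply: dHR; [apply: subsetUr | apply: subsetDl].
  case: (boolP (b \in A)) => bA.
    by rewrite (sided_snd sH2 bA) (sided_snd (sidedS (subsetDl _ _) sR) bA).
  by have := dv2 b bA; rewrite /s (sided_fst sH1 bA).
have G1E : G1 \subset E0 by rewrite subUset H1E (subset_trans SR).
have G2E : G2 \subset E0 by rewrite subUset H2E (subset_trans (subsetDl _ _) RE).
have [|||C1 [C1p C1e]] := @path_list G A k G1 T k_gt0 V1 (sidedS G1E sE0) dvG1.
- by move=> i; rewrite -rm => ir; apply: subset_trans (subsetUl _ _); apply: (bigcup_sup (Ordinal ir)).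
- by move=> i; rewrite -rm => /lt1; apply: spT.
- by move=> i j; rewrite -rm => /lt1 it /lt1; apply: dT.
have sG2 : sided (~: A) (@swap_pair G @: G2).
  by move=> _ /imsetP[e /(subsetP G2E) /sE0 [e1 e2] ->]; rewrite !inE e1 e2.
have [||||C2 [C2p C2e]] := @path_list G (~: A) k (@swap_pair G @: G2) (fun i => @swap_pair G @: T (r + i)) k_gt0 V1 sG2.
- by move=> b; rewrite fib_swap.
- move=> i; rewrite -rm => ir; apply: imsetS; apply: subset_trans (subsetUl _ _).
  exact: (bigcup_sup (Ordinal ir)).
- by move=> i; rewrite -rm => /lt2 it; apply/spanning_swap/spT.
- move=> i j; rewrite -rm => /lt2 it /lt2 jt ij.
  by rewrite imset_disjoint; [apply: dT; rewrite ?eqn_add2l | apply: swap_pair_inj].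
exists [set:: map (@path_graph G) (C1 ++ C2)]; apply: (decomposition_of_list hA).
  by rewrite all_cat C1p.
rewrite map_cat flatten_cat; apply: perm_trans (perm_cat C1e (perm_trans C2e (pair_edge_swap _))) _.
have G2D : G2 = E0 :\: G1.
  apply/setP => e; have h1 := subsetP H1E e; have h2 := subsetP H2E e.
  have h3 := subsetP SR e; have /setP/(_ e) := disjoint_setI0 dH.
  move: h1 h2 h3; rewrite !inE; case: (e \in E0); case: (e \in S); case: (e \in H1);
  case: (e \in H2) => //= h1 h2 h3 h4;
  solve [by [] | by move: (h1 isT) | by move: (h2 isT) | by move: (h3 isT)].
rewrite G2D -map_cat; apply: perm_map; apply: uniq_perm; rewrite ?cat_uniq ?enum_uniq ?andbT //=.
  by apply/hasPn => e; rewrite !mem_enum inE => /andP[].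
by move=> e; rewrite mem_cat !mem_enum in_setD; case: (boolP (e \in G1)) => [/(subsetP G1E) ->|_].
Qed.
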